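(* $R^{(2,2)}(u)$ is gauge equivalent to Fateev's $R$-matrix $R_F(u)$. Namely, as $9\times9$ matrices, $$R_F(u)=(U\otimes U)\,R^{(2,2)}(u)\,(U\otimes U)^{-1},$$ where $$U=\begin{pmatrix}1&0&0\\0&\xi&0\\0&0&\eta\end{pmatrix}\begin{pmatrix}\frac1{\sqrt2}&0&\frac1{\sqrt2}\\0&1&0\\\frac1{\sqrt2}&0&-\frac1{\sqrt2}\end{pmatrix},$$ and $$\xi^2=-\frac12\,\frac{\vartheta_0(0|\tau)\,\vartheta_3\left(\frac1r\big|\tau\right)}{\vartheta_0\left(\frac1r\big|\tau\right)\vartheta_3(0|\tau)},\qquad \eta^2=-\frac{\vartheta_2(0|\tau)\,\vartheta_3\left(\frac1r\big|\tau\right)}{\vartheta_2\left(\frac1r\big|\tau\right)\vartheta_3(0|\tau)}.$$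
   Context: Parameters: $K,K',\lambda$ are complex parameters, $x=e^{-\frac{\pi\lambda}{2K}}$, $\tau=\frac{2iK}{K'}$ with $\mathrm{Im}\,\tau>0$, $r=\frac{K'}{\lambda}$, $p=e^{-\pi K'/K}=e^{-2\pi i/\tau}=x^{2r}$, and $|x|<1$. Identities are between meromorphic functions of the spectral parameter $u$. Theta functions: with $\tilde p=e^{2\pi i\tau}$ and $(\tilde p;\tilde p)_\infty=\prod_{n\ge1}(1-\tilde p^n)$, $\vartheta_1(u|\tau)=2\tilde p^{1/8}(\tilde p;\tilde p)_\infty\sin\pi u\prod_{n=1}^\infty(1-2\tilde p^n\cos2\pi u+\tilde p^{2n})$, $\vartheta_0(u|\tau)=-ie^{\pi i(u+\tau/4)}\vartheta_1(u+\frac\tau2|\tau)$, $\vartheta_2(u|\tau)=\vartheta_1(u+\frac12|\tau)$, $\vartheta_3(u|\tau)=e^{\pi i(u+\tau/4)}\vartheta_1(u+\frac{\tau+1}2|\tau)$; in $\vartheta_i(\cdot|\frac{\tau}{2})$ one replaces $\tau$ by $\tau/2$ throughout. $[u]=C\,\vartheta_1(\frac{u}{r}|\tau)$ with $C=x^{-r/4}e^{-\pi i/4}\tau^{1/2}$. Elliptic functions: $$\mathrm{sn}\,\lambda u=\frac{\vartheta_3(0|\tau)\vartheta_1(\frac ur|\tau)}{\vartheta_2(0|\tau)\vartheta_0(\frac ur|\tau)},\quad \mathrm{cn}\,\lambda u=\frac{\vartheta_0(0|\tau)\vartheta_2(\frac ur|\tau)}{\vartheta_2(0|\tau)\vartheta_0(\frac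 ur|\tau)},\quad \mathrm{dn}\,\lambda u=\frac{\vartheta_0(0|\tau)\vartheta_3(\frac ur|\tau)}{\vartheta_3(0|\tau)\vartheta_0(\frac ur|\tau)}.$$ Baxter's $R$-matrix: $V=\mathbb{C}v_+\oplus\mathbb{C}v_-$; $R(u)\in\mathrm{End}(V\otimes V)$ is, in the ordered basis $v_+\otimes v_+,v_+\otimes v_-,v_-\otimes v_+,v_-\otimes v_-$, $$R(u)=R_0(u)\begin{pmatrix}a(u)&0&0&d(u)\\0&b(u)&c(u)&0\\0&c(u)&b(u)&0\\d(u)&0&0&a(u)\end{pmatrix},$$ where, with $\theta_i(k)=\vartheta_i(\frac{k}{2r}|\frac\tau2)$, $a(u)=\frac{\theta_2(1)\theta_2(u)}{\theta_2(0)\theta_2(1+u)}$, $b(u)=\frac{\theta_2(1)\theta_1(u)}{\theta_2(0)\theta_1(1+u)}$, $c(u)=\frac{\theta_1(1)\theta_2(u)}{\theta_2(0)\theta_1(1+u)}$, $d(u)=-\frac{\theta_1(1)\theta_1(u)}{\theta_2(0)\theta_2(1+u)}$, and with $z=x^{2u}$ (so $z^{s}=x^{2us}$), $(z;x^4,p)_\infty=\prod_{m,n\ge0}(1-zx^{4m}p^n)$, $$R_0(u)=z^{-\frac{r-1}{2r}}\frac{(px^2z;x^4,p)_\infty(x^2z;x^4,p)_\infty(p/z;x^4,p)_\infty(x^4/z;x^4,p)_\infty}{(px^2/z;x^4,p)_\infty(x^2/z;x^4,p)_\infty(pz;x^4,p)_\infty(x^4z;x^4,p)_\infty}.$$ Fusion: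 $P$ is the flip on $V\otimes V$, $\Pi=\frac12(P+\mathrm{id})$ is the projection on the space $V^{(2)}\subset V\otimes V$ of symmetric tensors, with basis $v^{(2)}_2=v_+\otimes v_+$, $v^{(2)}_0=\frac12(v_+\otimes v_-+v_-\otimes v_+)$, $v^{(2)}_{-2}=v_-\otimes v_-$. Let $V_1,V_2,V_{\bar1},V_{\bar2}$ be copies of $V$; subscripts of an operator indicate the tensor factors on which it acts. Put $R^{(2,1)}_{12,\bar j}(u)=\Pi_{12}R_{1\bar j}(u+1)R_{2\bar j}(u)$, which satisfies $R^{(2,1)}_{12,\bar j}(u)\Pi_{12}=R^{(2,1)}_{12,\bar j}(u)$ and is regarded as an operator on $V^{(2)}\otimes V_{\bar j}$. The $2\times2$ fused $R$-matrix is $R^{(2,2)}(u)=\Pi_{\bar1\bar2}R^{(2,1)}_{12,\bar2}(u)R^{(2,1)}_{12,\bar1}(u-1)$, regarded as an operator on $V^{(2)}\otimes V^{(2)}$, written as a matrix (columns: inputs, rows: outputs) in the basis $v^{(2)}_{\mu_1}\otimes v^{(2)}_{\mu_2}$ with $(\mu_1,\mu_2)$ ordered lexicographically with $2,0,-2$. Fateev's $R$-matrix (21-vertex model): in lexicographic order of pairs $(i,j)$, $i,j\in\{1,2,3\}$, $$R_F(u)=\tilde F(u)\begin{pmatrix} s_1&0&0&0&\mu&0&0&0&\nu\\ 0&t&0&\mathsf r&0&0&0&0&0\\ 0&0&T&0&0&0&\mathsf R&0&0\\ 0&\mathsf r&0&t&0&0&0&0&0\\ \mu&0&0&0&s_2&0&0&0&\rho\\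 0&0&0&0&0&\mathsf a&0&\mathsf q&0\\ 0&0&\mathsf R&0&0&0&T&0&0\\ 0&0&0&0&0&\mathsf q&0&\mathsf a&0\\ \nu&0&0&0&\rho&0&0&0&s_3 \end{pmatrix},$$ with, setting $\kappa=\frac{\mathrm{sn}\lambda\,\mathrm{sn}2\lambda}{\mathrm{sn}\lambda u\,\mathrm{sn}\lambda(u+1)}$: $s_1=\mathrm{cn}2\lambda+\kappa$, $s_2=\mathrm{cn}2\lambda+\mathrm{dn}2\lambda-1+\kappa$, $s_3=\mathrm{dn}2\lambda+\kappa$, $T=1$, $t=\mathrm{cn}2\lambda$, $\mathsf a=\mathrm{dn}2\lambda$, $\mathsf r=\frac{\mathrm{cn}\lambda u\,\mathrm{sn}2\lambda}{\mathrm{sn}\lambda u}$, $\mu=-\frac{\mathrm{cn}\lambda(u+1)\,\mathrm{sn}2\lambda}{\mathrm{sn}\lambda(u+1)}$, $\mathsf R=\frac{\mathrm{sn}2\lambda}{\mathrm{sn}\lambda u}$, $\nu=-\frac{\mathrm{sn}2\lambda}{\mathrm{sn}\lambda(u+1)}$, $\mathsf q=\frac{\mathrm{dn}\lambda u\,\mathrm{sn}2\lambda}{\mathrm{sn}\lambda u}$, $\rho=-\frac{\mathrm{dn}\lambda(u+1)\,\mathrm{sn}2\lambda}{\mathrm{sn}\lambda(u+1)}$, and the normalization factor is $$\tilde F(u)=\frac{[u+1]}{[u-1]}\,\frac{\vartheta_0(\frac2r|\tau)\vartheta_1(\frac ur|\tau)}{\vartheta_0(0|\tau)\vartheta_1(\frac{u+2}r|\tau)}.$$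 *)

(* Defs.v *)
From HB Require Import structures.
From mathcomp Require Import all_boot all_order all_algebra.
From mathcomp Require Import complex mxtens.
From mathcomp Require Import all_classical all_reals all_analysis.

Set Implicit Arguments.
Unset Strict Implicit.
Unset Printing Implicit Defensive.

Import Order.TTheory GRing.Theory Num.Theory.
Import numFieldNormedType.Exports.

Local Open Scope classical_set_scope.
Local Open Scope ring_scope.

Section ComplexFunctions.
Context {R : realType}.
Local Notation C := R[i].
Implicit Types z u t : C.

Definition iC : C := ('i)%C.
Definition piC : C := (pi%:C)%C.

Definition cexp z : C :=
  ((expR (complex.Re z))%:C * (cos (complex.Im z) +i* sin (complex.Im z)))%C.
Definition csin z : C := (cexp (iC * z) - cexp (- (iC * z))) / (2 * iC).
Definition ccos z : C := (cexp (iC * z) + cexp (- (iC * z))) / 2.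

(* The topology of C is that of the normed space R[i]^o over R[i]. *)
Definition clim (f : nat -> C) : C := lim ((f : nat -> R[i]^o) @ \oo).

(* \prod_{n >= 1} f n *)
Definition infprod (f : nat -> C) : C :=
  clim (fun N => \prod_(1 <= n < N) f n).

(* (z; q1, q2)_oo as the limit of square partial products; for
   |q1|, |q2| < 1 the double product converges absolutely, so that the order
   of the factors does not matter. *)
Definition dqpoch z q1 q2 : C :=
  clim (fun N => \prod_(m < N) \prod_(n < N) (1 - z * q1 ^+ m * q2 ^+ n)).

(* vtheta_i u t is \vartheta_i(u | t); the fractional power of
   q = e^{2 pi i t} is q^s = e^{2 pi i t s}. *)
Definition vtheta1 u t : C :=
  let q := cexp (2 * piC * iC * t) in
  2 * cexp (2 * piC * iC * t / 8) * infprod (fun n => 1 - q ^+ n)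
    * csin (piC * u)
    * infprod (fun n => 1 - 2 * q ^+ n * ccos (2 * piC * u) + q ^+ (2 * n)).
Definition vtheta0 u t : C :=
  - iC * cexp (piC * iC * (u + t / 4)) * vtheta1 (u + t / 2) t.
Definition vtheta2 u t : C := vtheta1 (u + 1 / 2) t.
Definition vtheta3 u t : C :=
  cexp (piC * iC * (u + t / 4)) * vtheta1 (u + (t + 1) / 2) t.

End ComplexFunctions.

Section TensorFactors.
Context {R : realType}.
Local Notation C := R[i].

Definition mx_of_rows m n (s : seq (seq C)) : 'M[C]_(m, n) :=
  \matrix_(i, j) (nth [::] s i)`_j.

(* V has the basis v_+ (index 0), v_- (index 1).  Indices of tensor products
   are ordered lexicographically, as given by mxtens_index, and operators are
   matrices acting on column vectors.  The space
   V_1 (x) V_2 (x) V_1bar (x) V_2bar is indexed by 'I_(2 * 2 * (2 * 2)). *)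
Definition f1 : 'I_4 := inord 0.
Definition f2 : 'I_4 := inord 1.
Definition fb1 : 'I_4 := inord 2.
Definition fb2 : 'I_4 := inord 3.

Definition leg (s : 'I_(2 * 2 * (2 * 2))) (k : 'I_4) : 'I_2 :=
  let: (s12, sb) := mxtens_unindex s in
  let: (s1, s2) := mxtens_unindex s12 in
  let: (sb1, sb2) := mxtens_unindex sb in
  nth s1 [:: s1; s2; sb1; sb2] k.

(* A_{ij}: the operator A on V (x) V, acting on the factors i and j. *)
Definition on2 (i j : 'I_4) (A : 'M[C]_(2 * 2)) : 'M[C]_(2 * 2 * (2 * 2)) :=
  \matrix_(s, t)
    (A (mxtens_index (leg s i, leg s j)) (mxtens_index (leg t i, leg t j))
     *+ [forall k : 'I_4, (k \notin [:: i; j]) ==> (leg s k == leg t k)]).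

Definition flip : 'M[C]_(2 * 2) :=
  \matrix_(s, t)
    (let: (t1, t2) := @mxtens_unindex 2 2 t in
     @mxtens_unindex 2 2 s == (t2, t1))%:R.

Definition symproj : 'M[C]_(2 * 2) := 2^-1 *: (flip + 1%:M).

(* The columns are v^(2)_2, v^(2)_0, v^(2)_{-2} in V (x) V. *)
Definition sym_incl : 'M[C]_(2 * 2, 3) :=
  mx_of_rows _ _ [:: [:: 1;    0; 0];
                     [:: 0; 2^-1; 0];
                     [:: 0; 2^-1; 0];
                     [:: 0;    0; 1]].

(* Coordinates of a symmetric tensor in that basis;
   sym_coord *m sym_incl = 1 and sym_incl *m sym_coord = symproj. *)
Definition sym_coord : 'M[C]_(3, 2 * 2) :=
  mx_of_rows _ _ [:: [:: 1; 0; 0; 0];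
                     [:: 0; 1; 1; 0];
                     [:: 0; 0; 0; 1]].

End TensorFactors.

Section Models.
Context {R : realType}.
Local Notation C := R[i].
Variables K K' lam : C.
Implicit Types u s z : C.

Definition par_tau : C := 2 * iC * K / K'.
Definition par_r : C := K' / lam.
Definition par_p : C := cexp (- piC * K' / K).
Definition par_x : C := cexp (- piC * lam / (2 * K)).
Local Notation tau := par_tau.
Local Notation r := par_r.
Local Notation p := par_p.
Local Notation x := par_x.

(* The power x^s of x = e^{- pi lam / (2 K)}, for complex s. *)
Definition xpow s : C := cexp (- piC * lam / (2 * K) * s).

(* [u] *)
Definition br u : C :=
  xpow (- r / 4) * cexp (- piC * iC / 4) * sqrtC tau * vtheta1 (u / r) tau.

(* sn u, cn u, dn u stand for sn (lam u), cn (lam u), dn (lam u). *)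
Definition sn u : C :=
  vtheta3 0 tau * vtheta1 (u / r) tau / (vtheta2 0 tau * vtheta0 (u / r) tau).
Definition cn u : C :=
  vtheta0 0 tau * vtheta2 (u / r) tau / (vtheta2 0 tau * vtheta0 (u / r) tau).
Definition dn u : C :=
  vtheta0 0 tau * vtheta3 (u / r) tau / (vtheta3 0 tau * vtheta0 (u / r) tau).

Definition th1 u : C := vtheta1 (u / (2 * r)) (tau / 2).
Definition th2 u : C := vtheta2 (u / (2 * r)) (tau / 2).

Definition wa u : C := th2 1 * th2 u / (th2 0 * th2 (1 + u)).
Definition wb u : C := th2 1 * th1 u / (th2 0 * th1 (1 + u)).
Definition wc u : C := th1 1 * th2 u / (th2 0 * th1 (1 + u)).
Definition wd u : C := - (th1 1 * th1 u / (th2 0 * th2 (1 + u))).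

Definition R0_num u : C :=
  let z := xpow (2 * u) in
  dqpoch (p * x ^+ 2 * z) (x ^+ 4) p * dqpoch (x ^+ 2 * z) (x ^+ 4) p
  * dqpoch (p / z) (x ^+ 4) p * dqpoch (x ^+ 4 / z) (x ^+ 4) p.
Definition R0_den u : C :=
  let z := xpow (2 * u) in
  dqpoch (p * x ^+ 2 / z) (x ^+ 4) p * dqpoch (x ^+ 2 / z) (x ^+ 4) p
  * dqpoch (p * z) (x ^+ 4) p * dqpoch (x ^+ 4 * z) (x ^+ 4) p.
Definition R0 u : C :=
  xpow (2 * u * - ((r - 1) / (2 * r))) * (R0_num u / R0_den u).

Definition Rbaxter u : 'M[C]_(2 * 2) :=
  R0 u *: mx_of_rows _ _ [:: [:: wa u; 0;    0;    wd u];
                             [:: 0;    wb u; wc u; 0   ];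
                             [:: 0;    wc u; wb u; 0   ];
                             [:: wd u; 0;    0;    wa u]].

(* R^{(2,1)}_{12,j}(u) and R^{(2,2)}(u) on the whole of
   V_1 (x) V_2 (x) V_1bar (x) V_2bar. *)
Definition R21 (j : 'I_4) u : 'M[C]_(2 * 2 * (2 * 2)) :=
  on2 f1 f2 symproj *m on2 f1 j (Rbaxter (u + 1)) *m on2 f2 j (Rbaxter u).
Definition R22_full u : 'M[C]_(2 * 2 * (2 * 2)) :=
  on2 fb1 fb2 symproj *m R21 fb2 u *m R21 fb1 (u - 1).

(* The restriction to V^(2) (x) V^(2); the image of R22_full lies in it. *)
Definition R22 u : 'M[C]_(3 * 3) :=
  (sym_coord *t sym_coord) *m R22_full u *m (sym_incl *t sym_incl).

Definition fateev_factor u : C :=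
  br (u + 1) / br (u - 1)
  * (vtheta0 (2 / r) tau * vtheta1 (u / r) tau
     / (vtheta0 0 tau * vtheta1 ((u + 2) / r) tau)).

Definition Rfateev u : 'M[C]_(3 * 3) :=
  let kappa := sn 1 * sn 2 / (sn u * sn (u + 1)) in
  let s1 := cn 2 + kappa in
  let s2 := cn 2 + dn 2 - 1 + kappa in
  let s3 := dn 2 + kappa in
  let T := 1 in
  let t := cn 2 in
  let a := dn 2 in
  let rr := cn u * sn 2 / sn u in
  let mu := - (cn (u + 1) * sn 2 / sn (u + 1)) in
  let RR := sn 2 / sn u in
  let nu := - (sn 2 / sn (u + 1)) in
  let q := dn u * sn 2 / sn u in
  let rho := - (dn (u + 1) * sn 2 / sn (u + 1)) in
  fateev_factor u *: mx_of_rows _ _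
    [:: [:: s1; 0;  0;  0;  mu; 0; 0;  0; nu ];
        [:: 0;  t;  0;  rr; 0;  0; 0;  0; 0  ];
        [:: 0;  0;  T;  0;  0;  0; RR; 0; 0  ];
        [:: 0;  rr; 0;  t;  0;  0; 0;  0; 0  ];
        [:: mu; 0;  0;  0;  s2; 0; 0;  0; rho];
        [:: 0;  0;  0;  0;  0;  a; 0;  q; 0  ];
        [:: 0;  0;  RR; 0;  0;  0; T;  0; 0  ];
        [:: 0;  0;  0;  0;  0;  q; 0;  a; 0  ];
        [:: nu; 0;  0;  0;  rho; 0; 0; 0; s3 ]].

(* Division is total (x / 0 = 0), so an identity between meromorphic functions
   of u is stated at the points u at which no denominator vanishes.  The
   constants th2 0 and vtheta_i 0 tau (i = 0, 2, 3) never vanish for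
   Im tau > 0. *)
Definition Rbaxter_regular u : Prop :=
  [/\ th1 (1 + u) != 0, th2 (1 + u) != 0 & R0_den u != 0].

Definition R22_regular u : Prop :=
  [/\ Rbaxter_regular (u + 1), Rbaxter_regular u & Rbaxter_regular (u - 1)].

Definition elliptic_regular u : Prop := vtheta0 (u / r) tau != 0.

Definition Rfateev_regular u : Prop :=
  [/\ elliptic_regular u /\ sn u != 0,
      elliptic_regular (u + 1) /\ sn (u + 1) != 0,
      br (u - 1) != 0
    & vtheta1 ((u + 2) / r) tau != 0].

End Models.

Definition gauge {R : realType} (xi eta : R[i]) : 'M[R[i]]_3 :=
  let h := (sqrtC (2 : R[i]))^-1 in
  mx_of_rows 3 3 [:: [:: 1; 0;  0  ];
                     [:: 0; xi; 0  ];
                     [:: 0; 0;  eta]]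
  *m mx_of_rows 3 3 [:: [:: h; 0; h  ];
                        [:: 0; 1; 0  ];
                        [:: h; 0; - h]].

(* Main.v *)
Require Import Defs.
From mathcomp Require Import all_boot all_order all_algebra.
From mathcomp Require Import complex mxtens.
From mathcomp Require Import all_classical all_reals all_analysis.
From mathcomp Require Import zify ring lra.
Import Order.TTheory GRing.Theory Num.Theory.
Import numFieldNormedType.Exports.
Local Open Scope ring_scope.

Set Implicit Arguments.
Unset Strict Implicit.
Unset Printing Implicit Defensive.

(** A quasi-periodic function with multipliers [1] and [e^{-2 pi i v - pi i t}] for the periods
    [1] and [t] is determined up to a constant: only smoothness is needed, since its Fourier
    coefficients on the real line are obtained from one of them by translation by multiples of
    [t]. This uniqueness gives Jacobi's imaginary transformation, whence the product of the four
    scalar factors [R0] is [br (u + 1) / br (u - 1)], and the addition and duplication formulas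
    that link the theta functions of modulus [tau / 2] to those of modulus [tau].

    Put [al = th1 1], [be = th2 1], [d] proportional to [vtheta0 (1 / r) tau], [S = th1 u / th2
    u], [T = th1 (u + 1) / th2 (u + 1)]. The addition formulas express [th1 / th2] at [u - 1] and
    [u + 2], the elliptic functions at [u], [u + 1] and [2], and [d] itself rationally in [al, be,
    S, T]: [2 S T d = (S^2 + T^2) be^2 - al^2 - al^2 S^2 T^2]. After conjugation by the orthogonal
    part of the gauge matrix, the entries of [R22] split into sums of products of two fused
    weights, and every entry of the theorem becomes an identity between rational functions of [al,
    be, S, T]. *)

(** * Norms and limits of complex sequences *)

(** Smoothness is measured by three constants whose sum is submultiplicative, so partial products of
    theta functions stay uniformly bounded and the limit inherits the bounds. Fourier analysis takes
    place on grids of [2M + 1] points, where inversion is exact, and passes to the limit by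
    Tannery's theorem.

    The scalar factors are double products in [x^4] and [p], whereas [br] has nome e^{2 pi i tau}. A
    shift of [u] by 1 multiplies z by [x^2], so two consecutive [R0] telescope to a quotient of
    theta functions of nome [p]; the imaginary transformation, up to a constant, returns to modulus
    [tau].

    Fusion mixes weights at [u - 1], [u], [u + 1], hence th1 / th2 at four points. The sum and the
    product of the ratios at z + 1 and z - 1 are rational in the ratio at z: this removes two of the
    four and yields the relation for [d].

    The orthogonal part of the gauge matrix diagonalizes the exchange of v_+ and v_-, which commutes
    with the weights. The resulting zero pattern lets [xi] and [eta] enter the conjugation only
    through even combinations, so prescribing their squares suffices. *)

Section Modulus.
Context {R : realType}.
Local Notation C := R[i].
Implicit Types (z w : C) (x : R).

(** The norm of [R[i]] takes values in [R[i]]; this real-valued modulus keeps all estimates in the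
    ordered field [R], within reach of [lra] and [nra]. *)
Definition nrm (z : C) : R := ComplexField.Normc.normc z.

Lemma nrm0 : nrm 0 = 0.
Proof. exact: ComplexField.Normc.normc0. Qed.
Lemma nrm1 : nrm 1 = 1.
Proof. exact: ComplexField.Normc.normc1. Qed.
Lemma nrmM z w : nrm (z * w) = nrm z * nrm w.
Proof. exact: ComplexField.Normc.normcM. Qed.
Lemma nrmN z : nrm (- z) = nrm z.
Proof. exact: (@normcN R z). Qed.
Lemma nrmV z : nrm z^-1 = (nrm z)^-1.
Proof. exact: ComplexField.Normc.normcV. Qed.
Lemma nrmD z w : nrm (z + w) <= nrm z + nrm w.
Proof. exact: (@le_normcD R z w). Qed.
Lemma nrm_ge0 z : 0 <= nrm z.
Proof. by case: z => a b; rewrite /nrm /= sqrtr_ge0. Qed.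
Lemma nrm_normr z : `|z| = (nrm z)%:C%C.
Proof. by rewrite normc_def; case: z. Qed.
Lemma nrm_eq0 z : (nrm z == 0) = (z == 0).
Proof.
by apply/eqP/eqP => [|->]; [exact: ComplexField.Normc.eq0_normc | exact: nrm0].
Qed.
Lemma nrm_gt0 z : (0 < nrm z) = (z != 0).
Proof. by rewrite lt_neqAle nrm_ge0 andbT eq_sym nrm_eq0. Qed.
Lemma nrmX z n : nrm (z ^+ n) = nrm z ^+ n.
Proof. by elim: n => [|n IH]; rewrite ?expr0 ?nrm1 // !exprS nrmM IH. Qed.
Lemma nrmBC z w : nrm (z - w) = nrm (w - z).
Proof. by rewrite -nrmN opprB. Qed.
Lemma nrmB z w : nrm (z - w) <= nrm z + nrm w.
Proof. by rewrite (le_trans (nrmD _ _))// nrmN. Qed.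
Lemma nrm_real x : nrm (x%:C)%C = `|x|.
Proof. by rewrite /nrm /= expr0n /= addr0 sqrtr_sqr. Qed.
Lemma nrm_nat n : nrm n%:R = n%:R.
Proof. by rewrite -(rmorph_nat (real_complex R)) nrm_real normr_nat. Qed.
Lemma nrm_sum (I : Type) (s : seq I) (P : pred I) (F : I -> C) :
  nrm (\sum_(i <- s | P i) F i) <= \sum_(i <- s | P i) nrm (F i).
Proof.
elim/big_rec2: _ => [|i x z _ le]; first by rewrite nrm0.
by rewrite (le_trans (nrmD _ _))// lerD2l.
Qed.
Lemma nrm_prod (I : Type) (s : seq I) (P : pred I) (F : I -> C) :
  nrm (\prod_(i <- s | P i) F i) = \prod_(i <- s | P i) nrm (F i).
Proof. exact: (big_morph nrm nrmM nrm1). Qed.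
Lemma Re_le_nrm z : `|complex.Re z| <= nrm z.
Proof.
by case: z => a b /=; rewrite /nrm /= -(sqrtr_sqr a) ler_wsqrtr// lerDl sqr_ge0.
Qed.
Lemma Im_le_nrm z : `|complex.Im z| <= nrm z.
Proof.
by case: z => a b /=; rewrite /nrm /= -(sqrtr_sqr b) ler_wsqrtr// lerDr sqr_ge0.
Qed.
Lemma nrm_leD z : nrm z <= `|complex.Re z| + `|complex.Im z|.
Proof.
rewrite {1}[z]complexE (le_trans (nrmD _ _))// nrmM !nrm_real lerD2l.
by rewrite /nrm/= !expr0n expr1n/= add0r sqrtr1 mul1r.
Qed.
Lemma ler_nrmB z w : nrm z - nrm w <= nrm (z - w).
Proof. by rewrite lerBlDr -{1}(subrK w z) nrmD. Qed.

End Modulus.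

Section Limits.
Context {R : realType}.
Local Notation C := R[i].
Implicit Types (f g : nat -> C) (a b z : C).

Definition tends f a := forall e : R, 0 < e ->
  exists N : nat, forall n, (N <= n)%N -> nrm (f n - a) < e.

(** The bridge from the elementary epsilon-N convergence to the topological limit [clim], through
    which all infinite products are defined. *)
Lemma tends_clim f a : tends f a -> clim f = a.
Proof.
move=> fa; rewrite /clim; apply: (@cvg_lim (R[i]^o) _ nat \oo%classic _ f a).
  exact: (@norm_hausdorff _ (R[i]^o)).
apply/(@cvgrPdist_lt _ (R[i]^o)) => e e0.
(* The radius [e] is an element of [R[i]]; being positive, it is real. *)
have /complex_realP[e' ee'] : e \is Num.real by rewrite gtr0_real.
move: e0; rewrite ee' ltcR => e0.
have [N HN] := fa _ e0.
exists N => // n /= Nn; rewrite nrm_normr ltcR nrmBC; exact: HN.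
Qed.

Lemma tends_cst a : tends (fun=> a) a.
Proof. by move=> e e0; exists 0%N => n _; rewrite subrr nrm0. Qed.

Lemma tends_le f a (x : nat -> R) : (forall n, nrm (f n - a) <= x n) ->
  (forall e : R, 0 < e -> exists N : nat, forall n, (N <= n)%N -> x n < e) ->
  tends f a.
Proof.
move=> fx x0 e /x0[N HN]; exists N => n /HN; exact: le_lt_trans.
Qed.

Lemma tendsD f g a b : tends f a -> tends g b -> tends (fun n => f n + g n) (a + b).
Proof.
move=> fa gb e e0; have e2 : 0 < e / 2 by rewrite divr_gt0.
have [N HN] := fa _ e2; have [M HM] := gb _ e2.
exists (maxn N M) => n; rewrite geq_max => /andP[/HN h1 /HM h2].
rewrite opprD addrACA (le_lt_trans (nrmD _ _))//.
by rewrite [ltRHS]splitr ltrD.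
Qed.

Lemma tendsN f a : tends f a -> tends (fun n => - f n) (- a).
Proof.
move=> fa e /fa[N HN]; exists N => n /HN.
by rewrite -opprD nrmN.
Qed.

Lemma tendsB f g a b : tends f a -> tends g b -> tends (fun n => f n - g n) (a - b).
Proof. by move=> fa gb; apply: tendsD => //; exact: tendsN. Qed.

Lemma tends0 f a : tends f a <-> tends (fun n => f n - a) 0.
Proof.
split=> h e /h[N HN]; exists N => n /HN; by rewrite subr0.
Qed.

Lemma tends_bounded f a : tends f a -> exists2 B : R, 0 < B & forall n, nrm (f n) <= B.
Proof.
move=> /(_ 1 ltr01)[N HN].
exists (nrm a + 1 + \sum_(i < N) nrm (f i)).
  by rewrite ltr_wpDr ?ltr_wpDl ?nrm_ge0// sumr_ge0// => i _; exact: nrm_ge0.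
move=> n; have [nN|Nn] := ltnP n N.
  rewrite ler_wpDl// ?addr_ge0 ?nrm_ge0//.
  rewrite (bigD1 (Ordinal nN))//= lerDl sumr_ge0// => i _; exact: nrm_ge0.
rewrite ler_wpDr//; first by rewrite sumr_ge0// => i _; exact: nrm_ge0.
have := HN _ Nn; have := ler_nrmB (f n) a; lra.
Qed.

Lemma tends0Mr f g (B : R) : (forall n, nrm (g n) <= B) ->
  tends f 0 -> tends (fun n => f n * g n) 0.
Proof.
move=> gB f0 e e0.
have B1 : 0 < `|B| + 1 by rewrite ltr_wpDl.
have eB : 0 < e / (`|B| + 1) by rewrite divr_gt0.
have [N HN] := f0 _ eB; exists N => n /HN.
rewrite !subr0 nrmM ltr_pdivlMr// => h; apply: le_lt_trans h.
rewrite ler_wpM2l ?nrm_ge0// (le_trans (gB n))// ler_wpDr// ler_norm//.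
Qed.

Lemma tendsM f g a b : tends f a -> tends g b -> tends (fun n => f n * g n) (a * b).
Proof.
move=> fa gb; have [B _ gB] := tends_bounded gb.
apply/(tends0 _ _).2.
have -> : (fun n => f n * g n - a * b)
        = (fun n => (f n - a) * g n + (g n - b) * a).
  by apply/funext => n; ring.
rewrite -[0]addr0; apply: tendsD.
  exact: (tends0Mr gB ((tends0 _ _).1 fa)).
by apply: (@tends0Mr _ _ (nrm a)) ((tends0 _ _).1 gb).
Qed.

Lemma tends_uniq f a b : tends f a -> tends f b -> a = b.
Proof. by move=> /tends_clim <- /tends_clim <-. Qed.

Lemma tends_shift f a k : tends f a -> tends (fun n => f (n + k)%N) a.
Proof.
move=> fa e /fa[N HN]; exists N => n Nn; apply: HN.
exact: leq_trans (leq_addr _ _).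
Qed.

Lemma tends_unshift f a k : tends (fun n => f (n + k)%N) a -> tends f a.
Proof.
move=> fa e /fa[N HN]; exists (N + k)%N => n Nn.
have kn : (k <= n)%N by apply: leq_trans Nn; exact: leq_addl.
by rewrite -(subnK kn); apply: HN; rewrite leq_subRL// addnC.
Qed.

Lemma tends_nrm_le f a (B : R) : tends f a -> (forall n, nrm (f n) <= B) -> nrm a <= B.
Proof.
move=> fa fB; apply/ler_addgt0Pr => e e0.
have [N HN] := fa _ e0; have := HN _ (leqnn N); have := fB N.
have := ler_nrmB a (f N); rewrite nrmBC; lra.
Qed.

Lemma geometric_small (k : R) (B : R) : 0 <= k < 1 -> forall e : R, 0 < e ->
  exists N : nat, forall n, (N <= n)%N -> B * k ^+ n < e.
Proof.
move=> /andP[k0 k1] e e0.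
have := @cvg_geometric R B k; rewrite ger0_norm// => /(_ k1)/cvgrPdist_lt/(_ _ e0)[N _ HN].
exists N => n Nn; have := HN n Nn; rewrite /= sub0r normrN => h.
by apply: le_lt_trans h; rewrite ler_norm.
Qed.

Lemma real_geometric_cvg (x : nat -> R) (B k : R) : 0 <= k < 1 ->
  (forall n, `|x n.+1 - x n| <= B * k ^+ n) ->
  exists l : R, forall e : R, 0 < e ->
    exists N : nat, forall n, (N <= n)%N -> `|x n - l| < e.
Proof.
move=> k01 xB; have /andP[k0 k1] := k01.
have B0 : 0 <= B by have := le_trans (normr_ge0 _) (xB 0%N); rewrite expr0 mulr1.
have : cvgn (series (fun n => x n.+1 - x n)).
  apply: normed_cvg; apply: (@series_le_cvg _ _ (geometric B k)) => //=.
  - by move=> n; rewrite mulr_ge0// exprn_ge0.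
  - by apply: is_cvg_geometric_series; rewrite ger0_norm.
move=> /cvg_ex[l] /cvgrPdist_lt hl.
exists (l + x 0%N) => e /hl[N _ HN]; exists N => n /HN /=.
rewrite /series/= telescope_sumr// => h.
rewrite distrC; move: h; congr (`|_| < _); ring.
Qed.

(** Completeness is applied to the real and imaginary parts separately: their increments form
    absolutely convergent real series. *)
Lemma geometric_tends f (B k : R) : 0 <= k < 1 ->
  (forall n, nrm (f n.+1 - f n) <= B * k ^+ n) -> exists l, tends f l.
Proof.
move=> k01 fB.
have hRe n : `|complex.Re (f n.+1) - complex.Re (f n)| <= B * k ^+ n.
  by rewrite -raddfB; apply: le_trans (fB n); exact: Re_le_nrm.
have hIm n : `|complex.Im (f n.+1) - complex.Im (f n)| <= B * k ^+ n.
  by rewrite -raddfB; apply: le_trans (fB n); exact: Im_le_nrm.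
have [a ha] := real_geometric_cvg k01 hRe.
have [b hb] := real_geometric_cvg k01 hIm.
exists (a +i* b)%C => e e0; have e2 : 0 < e / 2 by rewrite divr_gt0.
have [N HN] := ha _ e2; have [M HM] := hb _ e2.
exists (maxn N M) => n; rewrite geq_max => /andP[/HN h1 /HM h2].
rewrite (le_lt_trans (nrm_leD _))// !raddfB /= .
by rewrite [ltRHS]splitr ltrD.
Qed.

End Limits.

(** * The complex exponential *)

Section RealBounds.
Context {R : realType}.
Implicit Types x y : R.

Lemma sin_le x : 0 <= x -> sin x <= x.
Proof.
move=> x0; have := @ger0_derive1_ndecr R (fun y => y - sin y) 0 x.
have dr (y : R) : is_derive y 1 (fun y => y - sin y) (1 - cos y).
  by apply: is_deriveB.
move=> /(_ _ _ _ 0 x (lexx _) x0 (lexx _)); rewrite sin0 subrr subr_ge0; apply.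
- by move=> y _; have [] := dr y.
- by move=> y _; rewrite derive1E (@derive_val _ _ _ _ _ _ _ (dr y)) subr_ge0 cos_le1.
- apply: continuous_subspaceT => y; apply: differentiable_continuous.
  by apply/derivable1_diffP; have [] := dr y.
Qed.

Lemma normr_sin_le x : `|sin x| <= `|x|.
Proof.
wlog x0 : x / 0 <= x.
  move=> h; have [/h//|x0] := leP 0 x.
  by rewrite -normrN -sinN -[leRHS]normrN h// oppr_ge0 ltW.
rewrite (ger0_norm x0) ler_norml sin_le// andbT.
have [x2|x2] := leP x 2.
  by have := @sin_ge0_pi R x; rewrite x0 (le_trans x2 (pi_ge2 R)) => /(_ isT); lra.
by have := sin_geN1 x; lra.
Qed.

Lemma cos_ge_sub x : 1 - cos x <= x ^+ 2 / 2.
Proof.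
have -> : 1 - cos x = 2 * sin (x / 2) ^+ 2.
  have -> : cos x = cos ((x / 2) *+ 2) by congr cos; rewrite mulr2n; field.
  rewrite cos_mulr2n cos2sin2 mulr2n; ring.
have : sin (x / 2) ^+ 2 <= (x / 2) ^+ 2.
  by rewrite -[leLHS]real_normK ?num_real// -[leRHS]real_normK ?num_real//
    ler_pXn2r ?nnegrE// normr_sin_le.
nra.
Qed.

Lemma sin_ge_sub x : 0 <= x -> x - sin x <= x ^+ 2.
Proof.
rewrite le_eqVlt => /predU1P[<-|x0]; first by rewrite sin0 subrr sqr_ge0.
have [|c] := @MVT R sin cos 0 x x0 (fun y _ => is_derive_sin y).
  by apply: continuous_subspaceT; exact: continuous_sin.
rewrite in_itv /= sin0 !subr0 => /andP[c0 cx] ->.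
suff : 1 - cos c <= x by nra.
(* For [c <= 2], 1 - cos c is at most c^2 / 2, hence at most c; for larger c the trivial bound 2 is
   enough. *)
have [c2|c2] := leP c 2; last by have := cos_geN1 c; lra.
by have := cos_ge_sub c; nra.
Qed.

Lemma normr_sin_sub x : `|sin x - x| <= x ^+ 2.
Proof.
wlog x0 : x / 0 <= x.
  move=> h; have [/h//|x0] := leP 0 x.
  have := h (- x); rewrite oppr_ge0 (ltW x0) sinN sqrrN opprK => /(_ isT).
  by rewrite -normrN opprD !opprK.
by rewrite distrC ger0_norm ?subr_ge0 ?sin_le// sin_ge_sub.
Qed.

(** The upper bound comes from e^{-x} >= 1 - x, that is e^x <= 1 / (1 - x) = 1 + x + x^2 / (1 - x),
    where 1 / (1 - x) <= 2. *)
Lemma expR_bounds x : `|x| <= 1 / 2 -> 0 <= expR x - 1 - x <= 2 * x ^+ 2.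
Proof.
move=> /ler_normlP[h1 h2]; apply/andP; split; first by have := expR_ge1Dx x; lra.
have h := expR_ge1Dx (- x); have := expRxMexpNx_1 x; have := expR_gt0 x.
set a := expR x in h *; set b := expR (- x) in h *; move=> a0 ab.
have : a * (1 - x) <= a * b by rewrite ler_wpM2l// ltW.
rewrite ab.
have : 0 < 1 - x by lra.
nra.
Qed.

End RealBounds.

Section Exponential.
Context {R : realType}.
Local Notation C := R[i].
Implicit Types (z w : C).

Lemma cexpD z w : cexp (z + w) = cexp z * cexp w.
Proof.
case: z => a b; case: w => c d; rewrite /cexp /= expRD cosD sinD rmorphM /=.
by apply/eqP; rewrite eq_complex /=; apply/andP; split; apply/eqP; ring.
Qed.

Lemma cexp0 : cexp (0 : C) = 1.
Proof. by rewrite /cexp /= expR0 cos0 sin0 mul1r. Qed.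

Lemma nrm_cexp z : nrm (cexp z) = expR (complex.Re z).
Proof.
by rewrite nrmM nrm_real ger0_norm ?expR_ge0// /nrm/= cos2Dsin2 sqrtr1 mulr1.
Qed.

Lemma cexp_neq0 z : cexp z != 0.
Proof. by rewrite -nrm_gt0 nrm_cexp expR_gt0. Qed.

Lemma cexpN z : cexp (- z) = (cexp z)^-1.
Proof.
by apply: (mulfI (cexp_neq0 z)); rewrite -cexpD subrr cexp0 divff ?cexp_neq0.
Qed.

Lemma cexpB z w : cexp (z - w) = cexp z / cexp w.
Proof. by rewrite cexpD cexpN. Qed.

Lemma cexpMn n z : cexp (n%:R * z) = cexp z ^+ n.
Proof.
elim: n => [|n IH]; first by rewrite mul0r cexp0.
by rewrite -natr1 mulrDl cexpD IH mul1r exprSr.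
Qed.

Lemma sqr_iC : iC * iC = -1 :> C.
Proof. by rewrite /iC -expr2 sqr_i. Qed.

Lemma iC_neq0 : iC != 0 :> C.
Proof. by rewrite eq_complex /= oner_eq0 andbF. Qed.

Lemma two_neq0 : 2 != 0 :> C.
Proof. by rewrite pnatr_eq0. Qed.

Lemma iC_mul z : iC * z = (- complex.Im z +i* complex.Re z)%C.
Proof.
by case: z => a b; rewrite /iC; apply/eqP; rewrite eq_complex /=; apply/andP; split; apply/eqP; ring.
Qed.

Lemma cexp_iC (x : R) : cexp (iC * (x%:C)%C) = (cos x +i* sin x)%C.
Proof. by rewrite iC_mul /cexp /= oppr0 expR0 mul1r. Qed.

Lemma cexp_pi : cexp (piC * iC) = -1 :> C.
Proof.
rewrite mulrC iC_mul /cexp /piC /= oppr0 expR0 mul1r cospi sinpi.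
by apply/eqP; rewrite eq_complex /= oppr0 !eqxx.
Qed.

Lemma cexp_2pi : cexp (2 * piC * iC) = 1 :> C.
Proof. by rewrite -mulrA cexpMn cexp_pi sqrrN expr1n. Qed.

Lemma cexp_pihalf : cexp (piC * iC / 2) = iC :> C.
Proof.
have -> : piC * iC / 2 = (0 +i* (pi / 2))%C :> C.
  rewrite [piC * _]mulrC iC_mul /piC /= oppr0.
  rewrite -[2](rmorph_nat (real_complex R)) -(fmorphV (real_complex R)) /=.
  by apply/eqP; rewrite eq_complex /=; apply/andP; split; apply/eqP; ring.
by rewrite /cexp /= expR0 mul1r cos_pihalf sin_pihalf.
Qed.

Lemma nrm_cexp_real (x : R) : nrm (cexp (2 * piC * iC * (x%:C)%C)) = 1.
Proof.
rewrite nrm_cexp; suff -> : complex.Re (2 * piC * iC * (x%:C)%C) = 0 by rewrite expR0.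
have -> : 2 * piC * iC * (x%:C)%C = iC * (2 * pi * x)%:C%C.
  by rewrite !rmorphM /= rmorph_nat /piC; ring.
by rewrite iC_mul /= oppr0.
Qed.

Lemma cexp_sub_small z : nrm z <= 1 / 2 -> nrm (cexp z - 1 - z) <= 8 * nrm z ^+ 2.
Proof.
move=> z2; apply: le_trans (nrm_leD _) _.
have := Re_le_nrm z; have := Im_le_nrm z; have := nrm_ge0 z.
move: z2; set t := nrm z; case: z @t => x y t /=; move=> t2 t0 yt xt.
have /expR_bounds/andP[e1 e2] : `|x| <= 1 / 2 by lra.
have c1 := cos_ge_sub y; have c2 := cos_le1 y; have s1 := normr_sin_sub y.
have s2 := normr_sin_le y.
rewrite !mul0r !subr0 !addr0.
have x2 : x ^+ 2 <= t ^+ 2 by rewrite -(real_normK (num_real x)) ler_pXn2r ?nnegrE.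
have y2 : y ^+ 2 <= t ^+ 2 by rewrite -(real_normK (num_real y)) ler_pXn2r ?nnegrE.
have ex1 : `|expR x - 1| <= 2 * `|x|.
  have -> : expR x - 1 = (expR x - 1 - x) + x by ring.
  apply: le_trans (ler_normD _ _) _; rewrite (ger0_norm e1).
  have : x ^+ 2 <= `|x| * (1 / 2).
    by rewrite -(real_normK (num_real x)) expr2 ler_wpM2l// (le_trans xt).
  lra.
have ex2 : expR x <= 2 by have := ler_norm (expR x - 1); lra.
have hre : `|expR x * cos y - 1 - x| <= 3 * t ^+ 2.
  have -> : expR x * cos y - 1 - x = (expR x - 1 - x) - expR x * (1 - cos y) by ring.
  apply: le_trans (ler_normB _ _) _; rewrite (ger0_norm e1).
  rewrite ger0_norm ?mulr_ge0 ?expR_ge0 ?subr_ge0//.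
  have : expR x * (1 - cos y) <= 2 * (y ^+ 2 / 2).
    by rewrite ler_pM ?expR_ge0 ?subr_ge0.
  lra.
have him : `|expR x * sin y - y| <= 3 * t ^+ 2.
  have -> : expR x * sin y - y = (expR x - 1) * sin y + (sin y - y) by ring.
  apply: le_trans (ler_normD _ _) _; rewrite normrM.
  have : `|expR x - 1| * `|sin y| <= (2 * t) * t.
    by rewrite ler_pM//; [apply: le_trans ex1 _; lra | exact: le_trans yt].
  by rewrite -mulrA -expr2; lra.
lra.
Qed.

(** Small arguments are covered by [cexp_sub_small]. For the others the left side is at most e^r + 1
    + r, while [nrm z ^+ 2] exceeds 1 / 4, whence the factor 4 in the constant. *)
Lemma cexp_sub_bound (r : R) : exists2 B : R, 0 <= B &
  forall z, nrm z <= r -> nrm (cexp z - 1 - z) <= B * nrm z ^+ 2.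
Proof.
exists (8 + 4 * (expR `|r| + 1 + `|r|)).
  by have := expR_ge0 `|r|; have := normr_ge0 r; lra.
move=> z zr; have z0 := nrm_ge0 z.
have r0 : 0 <= r by apply: le_trans zr.
rewrite (ger0_norm r0); have er := expR_ge0 r.
have [z2|z2] := leP (nrm z) (1 / 2).
  apply: le_trans (cexp_sub_small z2) _; rewrite ler_wpM2r ?sqr_ge0//; lra.
have ez : nrm (cexp z) <= expR r.
  by rewrite nrm_cexp ler_expR (le_trans _ zr)// (le_trans (ler_norm _))// Re_le_nrm.
have : nrm (cexp z - 1 - z) <= expR r + 1 + r.
  apply: le_trans (nrmB _ _) _; apply: lerD => //.
  apply: le_trans (nrmB _ _) _; rewrite nrm1; lra.
have t4 : 1 / 4 <= nrm z ^+ 2 by nra.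
move=> /le_trans; apply.
have K0 : 0 <= expR r + 1 + r by lra.
nra.
Qed.

End Exponential.

(** * Smooth functions *)

Section Smooth.
Context {R : realType}.
Local Notation C := R[i].
Implicit Types (F G : C -> C) (w z : C) (r b : R).

(* A majorant of F, of its difference quotients and of their variation on the disc of radius r;
   as b bounds the sum of the three constants, it is submultiplicative and survives infinite
   products. *)
Definition smooth_bound r F b := exists f0 f1 f2 : R,
  [/\ [/\ 0 <= f0, 0 <= f1, 0 <= f2 & f0 + f1 + f2 <= b],
      forall w, nrm w <= r -> nrm (F w) <= f0,
      forall w w1, nrm w <= r -> nrm w1 <= r -> nrm (F w1 - F w) <= f1 * nrm (w1 - w) &
      forall w w1 w2, nrm w <= r -> nrm w1 <= r -> nrm w2 <= r ->
        nrm ((w2 - w) * (F w1 - F w) - (w1 - w) * (F w2 - F w))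
          <= f2 * (nrm (w1 - w) * nrm (w2 - w) * (nrm (w1 - w) + nrm (w2 - w)))].

Definition smooth F := forall r, exists b, smooth_bound r F b.

Lemma smooth_bound_ge0 r F b : smooth_bound r F b -> 0 <= b.
Proof. by move=> [f0 [f1 [f2 [[? ? ? ?] _ _ _]]]]; lra. Qed.

Lemma smooth_bound_le r F b c : b <= c -> smooth_bound r F b -> smooth_bound r F c.
Proof.
move=> bc [f0 [f1 [f2 [[h0 h1 h2 hb] hF0 hF1 hF2]]]].
by exists f0, f1, f2; split => //; split => //; exact: le_trans bc.
Qed.

Lemma smooth_bound_cst r (c : C) : smooth_bound r (fun=> c) (nrm c).
Proof.
exists (nrm c), 0, 0; split => //; first by rewrite !addr0 !lexx nrm_ge0.
- by move=> w z _ _; rewrite subrr nrm0 mul0r.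
- by move=> w z1 z2 _ _ _; rewrite subrr !mulr0 subrr nrm0 mul0r.
Qed.

Lemma smooth_bound_id r : smooth_bound r id (`|r| + 1).
Proof.
exists `|r|, 1, 0; split => //; first by rewrite addr0 normr_ge0 ler01 !lexx.
- by move=> w wr; rewrite (le_trans wr)// ler_norm.
- by move=> w z _ _; rewrite mul1r.
- by move=> w z1 z2 _ _ _; rewrite mulrC subrr nrm0 mul0r.
Qed.

Lemma smooth_boundD r F G b c : smooth_bound r F b -> smooth_bound r G c ->
  smooth_bound r (fun v => F v + G v) (b + c).
Proof.
move=> [f0 [f1 [f2 [[h0 h1 h2 hb] hF0 hF1 hF2]]]].
move=> [g0 [g1 [g2 [[k0 k1 k2 kb] hG0 hG1 hG2]]]].
exists (f0 + g0), (f1 + g1), (f2 + g2); split.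
- by split; lra.
- by move=> w wr; rewrite (le_trans (nrmD _ _))// lerD ?hF0 ?hG0.
- move=> w z wr zr; rewrite opprD addrACA (le_trans (nrmD _ _))// mulrDl.
  by rewrite lerD ?hF1 ?hG1.
- move=> w w1 w2 wr z1r z2r.
  set X := (X in nrm X); have -> : X =
      ((w2 - w) * (F w1 - F w) - (w1 - w) * (F w2 - F w)) +
      ((w2 - w) * (G w1 - G w) - (w1 - w) * (G w2 - G w)) by rewrite /X; ring.
  by rewrite [leRHS]mulrDl (le_trans (nrmD _ _))// lerD ?hF2 ?hG2.
Qed.

(** The Leibniz rule produces six of the nine terms of (f0 + f1 + f2)(g0 + g1 + g2); [f1 * g1] stems
    from the product of the two first differences. The sum of the constants is thus
    submultiplicative with factor exactly 1, as infinite products require. *)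
Lemma smooth_boundM r F G b c : smooth_bound r F b -> smooth_bound r G c ->
  smooth_bound r (fun v => F v * G v) (b * c).
Proof.
move=> [f0 [f1 [f2 [[h0 h1 h2 hb] hF0 hF1 hF2]]]].
move=> [g0 [g1 [g2 [[k0 k1 k2 kb] hG0 hG1 hG2]]]].
exists (f0 * g0), (f0 * g1 + f1 * g0), (f0 * g2 + f2 * g0 + f1 * g1); split.
- split; rewrite ?addr_ge0 ?mulr_ge0//.
  have : (f0 + f1 + f2) * (g0 + g1 + g2) <= b * c by rewrite ler_pM//; lra.
  have : 0 <= f1 * g2 + f2 * g1 + f2 * g2 by rewrite ?addr_ge0 ?mulr_ge0//.
  lra.
- by move=> w wr; rewrite nrmM ler_pM ?nrm_ge0 ?hF0 ?hG0.
- move=> w w1 wr w1r.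
  have -> : F w1 * G w1 - F w * G w = F w * (G w1 - G w) + (F w1 - F w) * G w1 by ring.
  rewrite [leRHS]mulrDl (le_trans (nrmD _ _))// !nrmM lerD// -?mulrA.
    by rewrite ler_pM ?nrm_ge0 ?hF0 ?hG1.
  by rewrite [g0 * _]mulrC mulrA ler_pM ?nrm_ge0 ?hF1 ?hG0.
- move=> w w1 w2 wr w1r w2r.
  set X := (X in nrm X); have -> : X =
      F w * ((w2 - w) * (G w1 - G w) - (w1 - w) * (G w2 - G w)) +
      ((w2 - w) * (F w1 - F w) - (w1 - w) * (F w2 - F w)) * G w +
      ((w2 - w) * ((F w1 - F w) * (G w1 - G w)) -
       (w1 - w) * ((F w2 - F w) * (G w2 - G w))) by rewrite /X; ring.
  have n1 := nrm_ge0 (w1 - w); have n2 := nrm_ge0 (w2 - w).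
  have ha : nrm (F w * ((w2 - w) * (G w1 - G w) - (w1 - w) * (G w2 - G w))) <=
     f0 * (g2 * (nrm (w1 - w) * nrm (w2 - w) * (nrm (w1 - w) + nrm (w2 - w)))).
    by rewrite nrmM ler_pM ?nrm_ge0 ?hF0 ?hG2.
  have hb' : nrm (((w2 - w) * (F w1 - F w) - (w1 - w) * (F w2 - F w)) * G w) <=
     (f2 * (nrm (w1 - w) * nrm (w2 - w) * (nrm (w1 - w) + nrm (w2 - w)))) * g0.
    by rewrite nrmM ler_pM ?nrm_ge0 ?hF2 ?hG0.
  have hd w' : nrm w' <= r -> nrm ((F w' - F w) * (G w' - G w)) <=
      f1 * nrm (w' - w) * (g1 * nrm (w' - w)).
    by move=> w'r; rewrite nrmM ler_pM ?nrm_ge0 ?hF1 ?hG1.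
  have hc : nrm ((w2 - w) * ((F w1 - F w) * (G w1 - G w)) -
       (w1 - w) * ((F w2 - F w) * (G w2 - G w))) <=
     nrm (w2 - w) * (f1 * nrm (w1 - w) * (g1 * nrm (w1 - w))) +
     nrm (w1 - w) * (f1 * nrm (w2 - w) * (g1 * nrm (w2 - w))).
    rewrite (le_trans (nrmB _ _))// !(nrmM (_ - w)).
    by rewrite lerD// ler_wpM2l ?hd.
  rewrite (le_trans (nrmD _ _))// (le_trans (lerD (nrmD _ _) hc))//.
  rewrite (le_trans (lerD (lerD ha hb') (lexx _)))// le_eqVlt; apply/orP; left.
  apply/eqP; ring.
Qed.

(** With D = F w1 - F w, the increment of the exponential is [cexp (F w)] times e^D - 1. Here D
    stays in the disc of radius [2 * f0], on which [cexp_sub_bound] replaces e^D - 1 by D up to a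
    quadratic error. *)
Lemma smooth_bound_cexp r F b : smooth_bound r F b ->
  exists c, smooth_bound r (fun v => cexp (F v)) c.
Proof.
move=> [f0 [f1 [f2 [[h0 h1 h2 hb] hF0 hF1 hF2]]]].
have [B B0 hB] := @cexp_sub_bound R (2 * f0).
set E := expR f0; have E0 : 0 <= E by exact: expR_ge0.
have eF w : nrm w <= r -> nrm (cexp (F w)) <= E.
  move=> wr; rewrite nrm_cexp ler_expR (le_trans (ler_norm _))//.
  by rewrite (le_trans (Re_le_nrm _))// hF0.
have dF w w1 : nrm w <= r -> nrm w1 <= r -> nrm (F w1 - F w) <= 2 * f0.
  by move=> wr w1r; rewrite (le_trans (nrmB _ _))// mulr_natl mulr2n lerD ?hF0.
have eE w w1 : cexp (F w1) - cexp (F w) = cexp (F w) * (cexp (F w1 - F w) - 1).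
  by rewrite cexpB; field; rewrite cexp_neq0.
have hd w w1 : nrm w <= r -> nrm w1 <= r ->
    nrm (cexp (F w1 - F w) - 1 - (F w1 - F w)) <= B * (f1 * nrm (w1 - w)) ^+ 2.
  move=> wr w1r; rewrite (le_trans (hB _ (dF _ _ wr w1r)))// ler_wpM2l//.
  by rewrite ler_pXn2r ?nnegrE ?nrm_ge0 ?mulr_ge0 ?nrm_ge0// hF1.
exists (E + E * (1 + B * (2 * f0)) * f1 + E * (f2 + B * f1 ^+ 2)).
exists E, (E * (1 + B * (2 * f0)) * f1), (E * (f2 + B * f1 ^+ 2)); split => //.
- split => //; first by rewrite !mulr_ge0// addr_ge0// !mulr_ge0.
  by rewrite mulr_ge0// addr_ge0// mulr_ge0// sqr_ge0.
- move=> w w1 wr w1r; rewrite (eE w w1) nrmM -!mulrA ler_pM ?nrm_ge0 ?eF//.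
  have d0 := nrm_ge0 (F w1 - F w).
  have -> : cexp (F w1 - F w) - 1 =
    (cexp (F w1 - F w) - 1 - (F w1 - F w)) + (F w1 - F w) by ring.
  rewrite (le_trans (nrmD _ _))// (le_trans (lerD (hB _ (dF _ _ wr w1r)) (lexx _)))//.
  have hh : nrm (F w1 - F w) <= f1 * nrm (w1 - w) by exact: hF1.
  apply: (@le_trans _ _ ((1 + B * (2 * f0)) * nrm (F w1 - F w))); last first.
    by rewrite ler_wpM2l// addr_ge0// !mulr_ge0.
  rewrite mulrDl mul1r addrC lerD2l -mulrA ler_wpM2l// expr2 ler_wpM2r//.
  exact: dF.
- move=> w w1 w2 wr w1r w2r; rewrite (eE w w1) (eE w w2).
  set X := (X in nrm X); have -> : X = cexp (F w) *
      (((w2 - w) * (F w1 - F w) - (w1 - w) * (F w2 - F w)) +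
       ((w2 - w) * (cexp (F w1 - F w) - 1 - (F w1 - F w)) -
        (w1 - w) * (cexp (F w2 - F w) - 1 - (F w2 - F w)))) by rewrite /X; ring.
  rewrite nrmM -mulrA ler_pM ?nrm_ge0 ?eF// [leRHS]mulrDl.
  rewrite (le_trans (nrmD _ _))// lerD ?hF2// (le_trans (nrmB _ _))// !(nrmM (_ - w)).
  have n1 := nrm_ge0 (w1 - w); have n2 := nrm_ge0 (w2 - w).
  apply: le_trans (lerD (ler_wpM2l n2 (hd _ _ wr w1r)) (ler_wpM2l n1 (hd _ _ wr w2r))) _.
  by rewrite le_eqVlt; apply/orP; left; apply/eqP; ring.
Qed.

Lemma smooth_bound_affine r F (c d : C) b : smooth_bound (nrm c * `|r| + nrm d) F b ->
  exists b', smooth_bound r (fun v => F (c * v + d)) b'.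
Proof.
move=> [f0 [f1 [f2 [[h0 h1 h2 hb] hF0 hF1 hF2]]]].
(* The constant case is separate because the last estimate cancels a factor [nrm c]. *)
have [->|c0] := eqVneq c 0.
  exists (nrm (F d)); under eq_fun do rewrite mul0r add0r.
  exact: smooth_bound_cst.
have nc : 0 < nrm c by rewrite nrm_gt0.
have hr w : nrm w <= r -> nrm (c * w + d) <= nrm c * `|r| + nrm d.
  move=> wr; rewrite (le_trans (nrmD _ _))// lerD2r nrmM ler_wpM2l ?nrm_ge0//.
  by rewrite (le_trans wr)// ler_norm.
have hB w w1 : c * w1 + d - (c * w + d) = c * (w1 - w) by ring.
exists (f0 + f1 * nrm c + f2 * nrm c ^+ 2), f0, (f1 * nrm c), (f2 * nrm c ^+ 2).
split => //.
- by split => //; rewrite mulr_ge0// ?exprn_ge0// ltW.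
- by move=> w wr; apply: hF0; exact: hr.
- move=> w w1 wr w1r; have := hF1 _ _ (hr _ wr) (hr _ w1r).
  by rewrite hB nrmM mulrA.
- move=> w w1 w2 wr w1r w2r; have := hF2 _ _ _ (hr _ wr) (hr _ w1r) (hr _ w2r).
  rewrite !hB -!mulrA -mulrBr !nrmM => h.
  rewrite -(ler_pM2l nc); apply: le_trans h _.
  by rewrite le_eqVlt; apply/orP; left; apply/eqP; ring.
Qed.

(** The three constants may change with n, only their sum being controlled; each is replaced by [b],
    which gives [3 * b]. *)
Lemma smooth_bound_lim r (F : nat -> C -> C) G b :
  (forall n, smooth_bound r (F n) b) -> (forall v, tends (fun n => F n v) (G v)) ->
  smooth_bound r G (3 * b).
Proof.
move=> hF FG; have b0 := smooth_bound_ge0 (hF 0%N).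
exists b, b, b; split; first by split => //; lra.
- move=> w wr; apply: (tends_nrm_le (FG w)) => n.
  have [f0 [f1 [f2 [[? ? ? ?] h _ _]]]] := hF n.
  by apply: le_trans (h _ wr) _; lra.
- move=> w w1 wr w1r; apply: (tends_nrm_le (tendsB (FG w1) (FG w))) => n.
  have [f0 [f1 [f2 [[? ? ? ?] _ h _]]]] := hF n.
  by apply: le_trans (h _ _ wr w1r) _; rewrite ler_wpM2r ?nrm_ge0//; lra.
- move=> w w1 w2 wr w1r w2r.
  apply: (tends_nrm_le (tendsB (tendsM (tends_cst (w2 - w)) (tendsB (FG w1) (FG w)))
    (tendsM (tends_cst (w1 - w)) (tendsB (FG w2) (FG w))))) => n.
  have [f0 [f1 [f2 [[? ? ? ?] _ _ h]]]] := hF n.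
  apply: le_trans (h _ _ _ wr w1r w2r) _; rewrite ler_wpM2r//; last lra.
  by rewrite !mulr_ge0 ?addr_ge0 ?nrm_ge0.
Qed.

Lemma smooth_bound_prod r (I : Type) (s : seq I) (F : I -> C -> C) (b : I -> R) :
  (forall i, smooth_bound r (F i) (b i)) ->
  smooth_bound r (fun v => \prod_(i <- s) F i v) (\prod_(i <- s) b i).
Proof.
move=> hF; elim: s => [|i s IH].
  rewrite big_nil; under eq_fun do rewrite big_nil.
  by rewrite -nrm1; exact: smooth_bound_cst.
rewrite big_cons; under eq_fun do rewrite big_cons.
exact: smooth_boundM.
Qed.

Lemma smooth_cst (c : C) : smooth (fun=> c).
Proof. by move=> r; exists (nrm c); exact: smooth_bound_cst. Qed.

Lemma smooth_id : smooth id.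
Proof. by move=> r; eexists; exact: smooth_bound_id. Qed.

Lemma smoothD F G : smooth F -> smooth G -> smooth (fun v => F v + G v).
Proof.
by move=> hF hG r; have [b hb] := hF r; have [c hc] := hG r;
  exists (b + c); exact: smooth_boundD.
Qed.

Lemma smoothM F G : smooth F -> smooth G -> smooth (fun v => F v * G v).
Proof.
by move=> hF hG r; have [b hb] := hF r; have [c hc] := hG r;
  exists (b * c); exact: smooth_boundM.
Qed.

Lemma smoothZ (c : C) F : smooth F -> smooth (fun v => c * F v).
Proof. by move=> hF; apply: smoothM => //; exact: smooth_cst. Qed.

Lemma smoothB F G : smooth F -> smooth G -> smooth (fun v => F v - G v).
Proof.
move=> hF hG; under eq_fun do rewrite -[in X in _ + X]mulN1r.
by apply: smoothD => //; exact: smoothZ.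
Qed.

Lemma smooth_cexp F : smooth F -> smooth (fun v => cexp (F v)).
Proof. by move=> hF r; have [b hb] := hF r; exact: smooth_bound_cexp hb. Qed.

Lemma smooth_affine (c d : C) F : smooth F -> smooth (fun v => F (c * v + d)).
Proof. by move=> hF r; have [b hb] := hF (nrm c * `|r| + nrm d); exact: smooth_bound_affine hb. Qed.

End Smooth.

(** * Infinite products and theta functions *)

Section InfiniteProducts.
Context {R : realType}.
Local Notation C := R[i].
Implicit Types (q y z : C) (k B : R).

Lemma geometric_sum_le k B N : 0 <= k < 1 -> 0 <= B ->
  \sum_(i < N) B * k ^+ i <= B / (1 - k).
Proof.
move=> /andP[k0 k1] B0; have k1' : 0 < 1 - k by rewrite subr_gt0.
rewrite -mulr_sumr ler_wpM2l// -[leRHS]mul1r ler_pdivlMr// mulrC.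
have -> : (1 - k) * \sum_(i < N) k ^+ i = 1 - k ^+ N.
  by rewrite -opprB mulNr -subrX1 opprB.
by rewrite gerBl exprn_ge0.
Qed.

Lemma prod1D_le_exp (I : Type) (s : seq I) (x : I -> R) : (forall i, 0 <= x i) ->
  \prod_(i <- s) (1 + x i) <= expR (\sum_(i <- s) x i).
Proof.
move=> x0; elim: s => [|i s IH]; first by rewrite !big_nil expR0.
rewrite !big_cons expRD ler_pM ?expR_ge1Dx ?addr_ge0//.
by apply: prodr_ge0 => j _; rewrite addr_ge0.
Qed.

Lemma prod1D_le (a : nat -> C) k B N : 0 <= k < 1 -> 0 <= B ->
  (forall n, nrm (a n) <= B * k ^+ n) ->
  nrm (\prod_(i < N) (1 + a i)) <= expR (B / (1 - k)).
Proof.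
move=> k01 B0 aB; rewrite nrm_prod.
apply: (@le_trans _ _ (\prod_(i < N) (1 + B * k ^+ i))).
  apply: ler_prod => i _; rewrite nrm_ge0 /= (le_trans (nrmD _ _))// nrm1 lerD2l//.
have /andP[k0 _] := k01.
apply: le_trans (prod1D_le_exp _ _) _; first by move=> i; rewrite mulr_ge0// exprn_ge0.
by rewrite ler_expR geometric_sum_le.
Qed.

Lemma prod1D_tends (a : nat -> C) k B : 0 <= k < 1 ->
  (forall n, nrm (a n) <= B * k ^+ n) ->
  exists l, tends (fun N => \prod_(i < N) (1 + a i)) l.
Proof.
move=> k01 aB.
have B0 : 0 <= B by have := le_trans (nrm_ge0 _) (aB 0%N); rewrite expr0 mulr1.
apply: (@geometric_tends _ _ (expR (B / (1 - k)) * B) k k01) => N.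
rewrite big_ord_recr /= mulrDr mulr1 addrC addKr nrmM -mulrA.
by rewrite ler_pM ?nrm_ge0// prod1D_le.
Qed.

(** The inverse factors 1 / (1 + a) = 1 + a' again deviate from 1 geometrically, since |1 + a| >= 1
    - c. Their product converges too, and its limit is an inverse of [l]. *)
Lemma prod1D_neq0 (a : nat -> C) k B (c : R) l : 0 <= k < 1 ->
  (forall n, nrm (a n) <= B * k ^+ n) -> c < 1 -> (forall n, nrm (a n) <= c) ->
  tends (fun N => \prod_(i < N) (1 + a i)) l -> l != 0.
Proof.
move=> k01 aB c1 ac hl.
have B0 : 0 <= B by have := le_trans (nrm_ge0 _) (aB 0%N); rewrite expr0 mulr1.
have c1' : 0 < 1 - c by rewrite subr_gt0.
have a1 n : 1 - c <= nrm (1 + a n).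
  by have := ler_nrmB 1 (- a n); rewrite nrmN nrm1 opprK; have := ac n; lra.
have a0 n : 1 + a n != 0 by rewrite -nrm_gt0 (lt_le_trans c1').
pose a' n := - a n / (1 + a n).
have aa' n : (1 + a n) * (1 + a' n) = 1 by rewrite /a'; field; exact: a0.
have [|l' hl'] := @prod1D_tends a' k (B / (1 - c)) k01.
  move=> n; rewrite /a' nrmM nrmN nrmV ler_pdivrMr ?(lt_le_trans c1')//.
  apply: le_trans (aB n) _; rewrite -!mulrA ler_wpM2l// mulrCA.
  rewrite -[leLHS]mulr1 ler_wpM2l ?exprn_ge0//; first by case/andP: k01.
  by rewrite ler_pdivlMl// mulr1.
apply/eqP => l0; have := tendsM hl hl'.
rewrite l0 mul0r; under [X in tends X _]eq_fun do rewrite -big_split /=.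
have -> : (fun N => \prod_(i < N) ((1 + a i) * (1 + a' i))) = (fun=> 1).
  by apply/funext => N; apply: big1 => i _.
move=> /(tends_uniq (tends_cst 1))/eqP; rewrite oner_eq0//.
Qed.

Lemma big_nat1_mkord (F : nat -> C) N :
  \prod_(1 <= n < N.+1) F n = \prod_(i < N) F i.+1.
Proof. by rewrite big_add1 /= big_mkord. Qed.

(** This is (q y; q)_oo: the product starts at n = 1, so (y; q)_oo is [(1 - y) * qinf q y]. *)
Definition qinf q y : C := infprod (fun n => 1 - q ^+ n * y).

Lemma qinf_ex q y : nrm q < 1 ->
  exists l, tends (fun N => \prod_(i < N) (1 + - (q ^+ i.+1 * y))) l.
Proof.
move=> q1; apply: (@prod1D_tends (fun i => - (q ^+ i.+1 * y)) (nrm q) (nrm q * nrm y)); first by rewrite nrm_ge0.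
by move=> n; rewrite nrmN nrmM nrmX exprS mulrAC.
Qed.

Lemma qinf_tends_ord q y : nrm q < 1 ->
  tends (fun N => \prod_(i < N) (1 + - (q ^+ i.+1 * y))) (qinf q y).
Proof.
move=> q1; have [l hl] := qinf_ex y q1.
suff -> : qinf q y = l by [].
apply: tends_clim; apply: (@tends_unshift _ _ _ 1).
by under eq_fun do rewrite addn1 big_nat1_mkord.
Qed.

Lemma qinf_tends q y : nrm q < 1 ->
  tends (fun N => \prod_(1 <= n < N) (1 - q ^+ n * y)) (qinf q y).
Proof.
move=> q1; apply: (@tends_unshift _ _ _ 1).
under eq_fun do rewrite addn1 big_nat1_mkord; exact: qinf_tends_ord.
Qed.

Lemma qinf_neq0 q y : nrm q < 1 -> nrm (q * y) < 1 -> qinf q y != 0.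
Proof.
move=> q1 qy; apply: (@prod1D_neq0 (fun i => - (q ^+ i.+1 * y)) (nrm q) (nrm q * nrm y) (nrm (q * y))).
- by rewrite nrm_ge0.
- by move=> n; rewrite nrmN nrmM nrmX exprS mulrAC.
- exact: qy.
- move=> n; rewrite nrmN exprSr -mulrA [leLHS]nrmM nrmX ler_piMl ?nrm_ge0//.
  by rewrite exprn_ile1 ?nrm_ge0// ltW.
- exact: qinf_tends_ord.
Qed.

Lemma qinf_shift q y : nrm q < 1 -> qinf q y = (1 - q * y) * qinf q (q * y).
Proof.
move=> q1; apply: (tends_uniq (@tends_shift _ _ _ 1 (qinf_tends_ord y q1))).
have := tendsM (tends_cst (1 - q * y)) (qinf_tends_ord (q * y) q1).
congr tends; apply/funext => N; rewrite addn1 big_ord_recl expr1; congr (_ * _).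
by apply: eq_bigr => i _; rewrite lift0 [in RHS]exprSr mulrA.
Qed.

End InfiniteProducts.

Local Opaque cexp.

Section ThetaBasics.
Context {R : realType}.
Local Notation C := R[i].
Implicit Types (q y z u v t : C).

Definition expi u : C := cexp (2 * piC * iC * u).

Lemma Im_muliC z : complex.Re (2 * piC * iC * z) = - (2 * pi * complex.Im z).
Proof.
have -> : 2 * piC * iC * z = iC * ((2 * pi)%:C%C * z).
  by rewrite !rmorphM /= rmorph_nat /piC; ring.
by rewrite iC_mul /=; case: z => a b /=; ring.
Qed.

Lemma nrm_expi_lt1 t : 0 < complex.Im t -> nrm (expi t) < 1.
Proof.
by move=> t0; rewrite nrm_cexp expR_lt1 Im_muliC oppr_lt0 !mulr_gt0// pi_gt0.
Qed.

Lemma expi_add1 u : expi (u + 1) = expi u.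
Proof. by rewrite /expi mulrDr mulr1 cexpD cexp_2pi mulr1. Qed.

Lemma expi_neq0 u : expi u != 0.
Proof. exact: cexp_neq0. Qed.

Lemma expiD u v : expi (u + v) = expi u * expi v.
Proof. by rewrite /expi mulrDr cexpD. Qed.

Lemma expiN u : expi (- u) = (expi u)^-1.
Proof. by rewrite /expi mulrN cexpN. Qed.

Definition theta_cst t : C := 2 * cexp (2 * piC * iC * t / 8) * qinf (expi t) 1.

Lemma vtheta1E u t : 0 < complex.Im t ->
  vtheta1 u t = theta_cst t * csin (piC * u) *
    (qinf (expi t) (expi u) * qinf (expi t) (expi u)^-1).
Proof.
move=> t0; have q1 := nrm_expi_lt1 t0.
rewrite /vtheta1 -/(expi t) /theta_cst /qinf; congr (_ * _ * _ * _).
  by congr infprod; apply/funext => n; rewrite mulr1.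
apply: tends_clim; have := tendsM (qinf_tends (expi u) q1) (qinf_tends (expi u)^-1 q1).
congr tends; apply/funext => N; rewrite -big_split /=; apply: eq_bigr => n _.
have E0 := expi_neq0 u.
have -> : ccos (2 * piC * u) = (expi u + (expi u)^-1) / 2.
  by rewrite /ccos -expiN /expi; congr ((cexp _ + cexp _) / 2); ring.
have -> : expi t ^+ (2 * n) = expi t ^+ n * expi t ^+ n by rewrite mul2n -addnn exprD.
by field; exact: E0.
Qed.

Lemma theta_cst_neq0 t : 0 < complex.Im t -> theta_cst t != 0.
Proof.
move=> t0; apply: mulf_neq0; last by apply: qinf_neq0; rewrite ?mulr1 nrm_expi_lt1.
by apply: mulf_neq0; [exact: two_neq0 | exact: cexp_neq0].
Qed.

Lemma csinE u : csin (piC * u) = cexp (- (piC * iC * u)) * (expi u - 1) / (2 * iC).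
Proof.
rewrite /csin /expi; congr (_ / _); rewrite mulrBr mulr1 -cexpD.
by congr (cexp _ - cexp _); ring.
Qed.

Lemma csin_add1 u : csin (piC * (u + 1)) = - csin (piC * u).
Proof.
rewrite !csinE expi_add1.
have -> : cexp (- (piC * iC * (u + 1))) = - cexp (- (piC * iC * u)).
  by rewrite mulrDr opprD cexpD mulr1 (cexpN (piC * iC)) cexp_pi invrN invr1 mulrN1.
by rewrite !mulNr.
Qed.

Lemma vtheta1_add1 u t : 0 < complex.Im t -> vtheta1 (u + 1) t = - vtheta1 u t.
Proof. by move=> t0; rewrite !vtheta1E// expi_add1 csin_add1; ring. Qed.

Lemma vtheta1N u t : 0 < complex.Im t -> vtheta1 (- u) t = - vtheta1 u t.
Proof.
move=> t0; rewrite !vtheta1E// expiN invrK.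
have -> : csin (piC * - u) = - csin (piC * u).
  by rewrite /csin !mulrN opprK; ring.
by rewrite mulrN mulNr; congr (- (_ * _)); rewrite mulrC.
Qed.

(** Multiplying E = e^{2 pi i u} by q makes the product in E lose its factor 1 - q E and the product
    in 1 / E gain the factor 1 - 1 / E; the sine factor accounts for the rest. *)
Lemma vtheta1_addt u t : 0 < complex.Im t ->
  vtheta1 (u + t) t = - cexp (- (2 * piC * iC * u) - piC * iC * t) * vtheta1 u t.
Proof.
move=> t0; have q1 := nrm_expi_lt1 t0; rewrite !vtheta1E// !csinE expiD.
set E := expi u; set q := expi t.
have E0 : E != 0 by exact: expi_neq0.
have q0 : q != 0 by exact: cexp_neq0.
have hE : qinf q E = (1 - q * E) * qinf q (E * q) by rewrite [E * q]mulrC -qinf_shift.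
have hV : qinf q (E * q)^-1 = (1 - E^-1) * qinf q E^-1.
  by rewrite qinf_shift// invfM mulrCA divff// mulr1.
rewrite hE hV.
have -> : cexp (- (piC * iC * (u + t))) = cexp (- (piC * iC * u)) * cexp (- (piC * iC * t)).
  by rewrite -cexpD; congr cexp; ring.
have -> : cexp (- (2 * piC * iC * u) - piC * iC * t) = E^-1 * cexp (- (piC * iC * t)).
  by rewrite -expiN -cexpD; congr cexp; ring.
by field; rewrite E0 iC_neq0.
Qed.

(** In the annulus |q| < |e^{2 pi i u}| < 1 / |q| every factor of the infinite products stays at
    distance less than 1 from 1, so only the sine can vanish. *)
Lemma vtheta1_neq0 u t : 0 < complex.Im t -> expi u != 1 ->
  nrm (expi t * expi u) < 1 -> nrm (expi t / expi u) < 1 -> vtheta1 u t != 0.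
Proof.
move=> t0 u1 h1 h2; have q1 := nrm_expi_lt1 t0.
rewrite vtheta1E// csinE; apply: mulf_neq0; last by apply: mulf_neq0; exact: qinf_neq0.
apply: mulf_neq0; first exact: theta_cst_neq0.
apply: mulf_neq0; first by apply: mulf_neq0; [exact: cexp_neq0 | rewrite subr_eq0].
by rewrite invr_eq0; apply: mulf_neq0; [exact: two_neq0 | exact: iC_neq0].
Qed.

(** By submultiplicativity the N-th partial product is bounded by a product of factors 1 + |q| b
    |q|^i, hence by an exponential independent of N; then the bound passes to the limit. *)
Lemma smooth_qinf q (F : C -> C) : nrm q < 1 -> smooth F -> smooth (fun v => qinf q (F v)).
Proof.
move=> q1 hF r; have [b hb] := hF r; have b0 := smooth_bound_ge0 hb.
exists (3 * expR (nrm q * b / (1 - nrm q))).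
apply: (@smooth_bound_lim _ _ (fun N v => \prod_(i < N) (1 + - (q ^+ i.+1 * F v)))); last first.
  by move=> v; exact: qinf_tends_ord.
move=> N; have hi (i : 'I_N) :
    smooth_bound r (fun v => 1 + - (q ^+ i.+1 * F v)) (1 + nrm q * b * nrm q ^+ i).
  under eq_fun do rewrite -mulNr.
  rewrite -nrm1; apply: smooth_boundD; first exact: smooth_bound_cst.
  apply: smooth_bound_le (smooth_boundM (smooth_bound_cst r (- q ^+ i.+1)) hb).
  by rewrite nrmN nrmX exprS mulrAC.
apply: smooth_bound_le (smooth_bound_prod (index_enum 'I_N) hi).
apply: le_trans (prod1D_le_exp _ _) _.
  by move=> i; rewrite !mulr_ge0 ?exprn_ge0 ?nrm_ge0.
by rewrite ler_expR geometric_sum_le ?nrm_ge0 ?mulr_ge0 ?nrm_ge0.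
Qed.

Lemma smooth_linexp (c : C) : smooth (fun v => cexp (c * v)).
Proof. by apply: smooth_cexp; apply: smoothZ; exact: smooth_id. Qed.

Lemma smooth_vtheta1 t : 0 < complex.Im t -> smooth (fun v => vtheta1 v t).
Proof.
move=> t0; under eq_fun do rewrite vtheta1E// -expiN.
apply: smoothM; last first.
  apply: smoothM; apply: smooth_qinf; rewrite ?nrm_expi_lt1//; first exact: smooth_linexp.
  rewrite /expi; under eq_fun do rewrite mulrN -mulNr; exact: smooth_linexp.
apply: smoothZ; rewrite /csin; under eq_fun do rewrite mulrC.
apply: smoothZ; apply: smoothB.
  under eq_fun do rewrite mulrA; exact: smooth_linexp.
under eq_fun do rewrite mulrA -mulNr; exact: smooth_linexp.
Qed.

End ThetaBasics.

(** * Points of the unit circle *)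

Section UnitCircle.
Context {R : realType}.
Local Notation C := R[i].
Implicit Types (x : R) (u : C).

Lemma expi0 : expi (0 : C) = 1.
Proof. by rewrite /expi mulr0 cexp0. Qed.

Lemma expi_int (k : int) : expi (k%:~R : C) = 1.
Proof.
have hn (n : nat) : expi (n%:R : C) = 1.
  elim: n => [|n IH]; first exact: expi0.
  by rewrite -natr1 expi_add1.
case: k => n; first exact: hn.
by rewrite NegzE mulrNz expiN hn invr1.
Qed.

Lemma nrm_expi_real x : nrm (expi (x%:C)%C) = 1.
Proof. exact: nrm_cexp_real. Qed.

Lemma nrm_expi_sub1 x : nrm (expi (x%:C)%C - 1) = 2 * `|sin (pi * x)|.
Proof.
have -> : expi (x%:C)%C = (cos ((pi * x) *+ 2) +i* sin ((pi * x) *+ 2))%C :> C.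
  rewrite /expi; have -> : 2 * piC * iC * (x%:C)%C = iC * ((pi * x) *+ 2)%:C%C.
    by rewrite rmorphMn /= rmorphM /= /piC mulr2n; ring.
  exact: cexp_iC.
rewrite /nrm /= sin_mulr2n cos_mulr2n.
have -> : 2 * `|sin (pi * x)| = Num.sqrt ((2 * sin (pi * x)) ^+ 2).
  by rewrite sqrtr_sqr normrM ger0_norm.
congr Num.sqrt; rewrite subr0 !mulr2n; have := cos2Dsin2 (pi * x).
set c := cos _; set s := sin _ => cs.
have -> : c ^+ 2 = 1 - s ^+ 2 by rewrite -cs; ring.
have hc : c * c = 1 - s * s by have := cs; rewrite !expr2; lra.
ring: hc.
Qed.

Lemma expi_neq1 x : 0 < x < 1 -> expi (x%:C)%C != 1 :> C.
Proof.
move=> /andP[x0 x1]; rewrite -subr_eq0 -nrm_gt0 nrm_expi_sub1 mulr_gt0// normr_gt0 gt_eqF//.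
by rewrite sin_gt0_pi// mulr_gt0 ?pi_gt0//= gtr_pMr ?pi_gt0.
Qed.

(** With y = pi x in [0, pi / 2], sin y >= y / 8: for y <= 1 / 2 from y - sin y <= y^2, beyond that
    from sin (1 / 2) >= 1 / 4 and y < 2. Since y >= 2 x, the claim follows. It makes Fourier
    coefficients decay in [fourier_decay]. *)
Lemma nrm_expi_sub1_ge x : `|x| <= 1 / 2 -> `|x| / 2 <= nrm (expi (x%:C)%C - 1).
Proof.
rewrite nrm_expi_sub1; wlog x0 : x / 0 <= x.
  move=> h; have [/h//|x0] := leP 0 x.
  by have := h (- x); rewrite normrN mulrN sinN normrN oppr_ge0 (ltW x0) => /(_ isT).
rewrite (ger0_norm x0) => x2; have p2 := pi_ge2 R.
have hp : pi / 2 < 2 :> R by exact: pihalf_lt2.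
set y := pi * x; have y0 : 0 <= y by rewrite mulr_ge0// pi_ge0.
have yx : 2 * x <= y by rewrite ler_wpM2r.
have yp : y <= pi / 2 by rewrite /y; nra.
have hs : y / 8 <= sin y.
  have [y2|y2] := leP y (1 / 2); first by have := sin_ge_sub y0; nra.
  have h1 : sin (1 / 2) <= sin y.
    by rewrite ltW// ltr_sin ?in_itv //=; lra.
  have h2 := @sin_ge_sub R (1 / 2); have {}h2 := h2 ltac:(lra).
  by lra.
by rewrite ger0_norm; lra.
Qed.

End UnitCircle.

(** * Uniqueness of quasi-periodic functions *)

Section SymmetricSums.
Context {R : realType}.
Local Notation C := R[i].
Implicit Types (f : int -> C) (B : R).

(** The frequencies are -M, ..., M; their number [2M + 1] is the size of the grid in
    [fourier_inversion]. *)
Definition zsum (M : nat) f : C := \sum_(j < M.*2.+1) f (j%:Z - M%:Z).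

Lemma zsumS M f : zsum M.+1 f = zsum M f + (f M.+1%:Z + f (- M.+1%:Z)).
Proof.
rewrite /zsum doubleS big_ord_recl big_ord_recr /= addrCA addrA addrC !addrA.
have -> : (M.*2.+1).+1%:Z - M.+1%:Z = M.+1%:Z by rewrite -addnn; lia.
have -> : 0%:Z - M.+1%:Z = - M.+1%:Z by lia.
congr (_ + _); rewrite addrC; congr (_ + _); apply: eq_bigr => i _.
by congr f; rewrite /bump /=; lia.
Qed.

(** Telescoping: 1 / (m + 1)^2 <= 1 / m - 1 / (m + 1). Keeping the difference of inverses in the
    bound lets the induction close. *)
Lemma zsum_tail f B K M : 0 <= B -> (0 < K <= M)%N ->
  (forall k : nat, (K < k <= M)%N ->
     nrm (f k%:Z) <= B / k%:R ^+ 2 /\ nrm (f (- k%:Z)) <= B / k%:R ^+ 2) ->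
  nrm (zsum M f - zsum K f) <= 2 * B * (K%:R^-1 - M%:R^-1).
Proof.
move=> B0 /andP[K0 KM]; rewrite -(subnK KM); elim: (M - K)%N => [|n IH] hf.
  by rewrite !add0n !subrr nrm0 mulr0.
have {IH}h1 : nrm (zsum (n + K) f - zsum K f) <= 2 * B * (K%:R^-1 - (n + K)%:R^-1).
  by apply: IH => k hk; apply: hf; lia.
rewrite addSn zsumS [X in nrm (X - _)]addrC -[X in nrm X]addrA.
have [|h2 h3] := hf (n + K).+1; first by lia.
apply: le_trans (nrmD _ _) _; apply: le_trans (lerD (nrmD _ _) h1) _.
have : nrm (f (n + K).+1%:Z) + nrm (f (- (n + K).+1%:Z)) <= 2 * B * ((n + K)%:R^-1 - (n + K).+1%:R^-1).
  apply: le_trans (lerD h2 h3) _; set m := (n + K)%N.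
  have m0 : 0 < m%:R :> R by rewrite ltr0n addn_gt0 K0 orbT.
  rewrite -mulr2n -[leLHS]mulr_natl mulrA ler_wpM2l ?mulr_ge0//.
  rewrite -natr1.
  have -> : m%:R^-1 - (m%:R + 1)^-1 = (m%:R * (m%:R + 1))^-1 :> R.
    by field; rewrite !gt_eqF// ltr_wpDr.
  rewrite lef_pV2 ?posrE ?mulr_gt0 ?exprn_gt0 ?ltr_wpDr//.
  nra.
move=> h4; apply: le_trans (lerD h4 (lexx _)) _; rewrite -mulrDr.
by rewrite [X in _ * X]addrC addrA subrK.
Qed.

(* Tannery's theorem. *)
Lemma zsum_tends0 (a : nat -> int -> C) B :
  (forall k, tends (fun M => a M k) 0) ->
  (forall M (k : nat), (0 < k <= M)%N ->
     nrm (a M k%:Z) <= B / k%:R ^+ 2 /\ nrm (a M (- k%:Z)) <= B / k%:R ^+ 2) ->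
  tends (fun M => zsum M (a M)) 0.
Proof.
move=> a0 aB.
have B0 : 0 <= B.
  have [|h _] := aB 1%N 1%N; first by [].
  by have := le_trans (nrm_ge0 _) h; rewrite expr1n divr1.
have aK K : tends (fun M => zsum K (a M)) 0.
  rewrite /zsum; elim: (K.*2.+1) => [|n IH].
    under eq_fun do rewrite big_ord0; exact: tends_cst.
  under eq_fun do rewrite big_ord_recr /=.
  by have := tendsD IH (a0 (n%:Z - K%:Z)); rewrite addr0.
move=> e e0; have e2 : 0 < e / 2 by rewrite divr_gt0.
pose K := (Num.trunc (2 * B / (e / 2))).+1.
have hK : 2 * B * K%:R^-1 < e / 2.
  have : 2 * B / (e / 2) < K%:R.
    have /Num.Theory.truncn_itv/andP[_ ->]// : 0 <= 2 * B / (e / 2).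
    by rewrite !mulr_ge0// invr_ge0 ltW.
  by rewrite ltr_pdivrMr// => h; rewrite ltr_pdivrMr ?ltr0n// [ltRHS]mulrC.
have [N HN] := aK K _ e2.
exists (maxn N K) => M; rewrite geq_max => /andP[/HN h1 KM].
rewrite subr0; rewrite subr0 in h1.
have h2 := @zsum_tail (a M) B K M B0 KM.
have {}h2 : nrm (zsum M (a M) - zsum K (a M)) <= 2 * B * (K%:R^-1 - M%:R^-1).
  by apply: h2 => k /andP[Kk kM]; apply: aB; rewrite kM andbT (leq_trans _ Kk).
have h3 : 0 <= 2 * B * M%:R^-1 by rewrite !mulr_ge0 ?invr_ge0.
have := ler_nrmB (zsum M (a M)) (zsum K (a M)); lra.
Qed.

End SymmetricSums.

(** * Riemann sums over translated periods *)

Section RiemannSums.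
Context {R : realType}.
Local Notation C := R[i].
Implicit Types (P : C -> C) (v w d : C).

Definition riemann P (N : nat) w : C := N%:R^-1 * \sum_(j < N) P (w + j%:R / N%:R).

Lemma sum_periodic (F : nat -> C) N : F N = F 0%N ->
  \sum_(j < N) F j.+1 = \sum_(j < N) F j.
Proof.
case: N => [|N] FN; first by rewrite !big_ord0.
by rewrite big_ord_recr big_ord_recl /= FN addrC.
Qed.

Lemma natC_neq0 (N : nat) : (0 < N)%N -> N%:R != 0 :> C.
Proof. by move=> N0; rewrite pnatr_eq0 -lt0n. Qed.

Lemma nrm_frac (i N : nat) : (0 < N)%N -> (i <= N)%N -> nrm (i%:R / N%:R : C) <= 1.
Proof.
move=> N0 iN; rewrite nrmM nrmV !nrm_nat ler_pdivrMr ?ltr0n//.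
by rewrite mul1r ler_nat.
Qed.

(** To first order a shift by d / N changes P by d times what a shift by 1 / N does, and the latter
    changes sum to zero by periodicity. Only the second-order error remains, of size 1 / N^2 at each
    node. *)
Lemma riemann_step P f2 r d w N : (0 < N)%N ->
  (forall v, P (v + 1) = P v) -> 0 <= f2 ->
  (forall w w1 w2, nrm w <= r -> nrm w1 <= r -> nrm w2 <= r ->
        nrm ((w2 - w) * (P w1 - P w) - (w1 - w) * (P w2 - P w))
          <= f2 * (nrm (w1 - w) * nrm (w2 - w) * (nrm (w1 - w) + nrm (w2 - w)))) ->
  nrm w + nrm d + 2 <= r ->
  nrm (riemann P N (w + d / N%:R) - riemann P N w)
    <= f2 * nrm d * (nrm d + 1) / N%:R ^+ 2.
Proof.
move=> N0 P1 f20 hP wr; have NC := natC_neq0 N0.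
have NR : 0 < N%:R :> R by rewrite ltr0n.
have nN : nrm (N%:R : C) = N%:R by rewrite nrm_nat.
have hper : \sum_(j < N) (P (w + j%:R / N%:R + 1 / N%:R) - P (w + j%:R / N%:R)) = 0.
  rewrite sumrB; have := @sum_periodic (fun j => P (w + j%:R / N%:R)) N.
  rewrite divff// P1 mul0r addr0 => /(_ erefl) <-.
  apply/eqP; rewrite subr_eq0; apply/eqP; apply: eq_bigr => j _.
  by congr P; rewrite -natr1 mulrDl addrA.
have -> : riemann P N (w + d / N%:R) - riemann P N w = N%:R^-1 * \sum_(j < N)
   (P (w + j%:R / N%:R + d / N%:R) - P (w + j%:R / N%:R) -
    d * (P (w + j%:R / N%:R + 1 / N%:R) - P (w + j%:R / N%:R))).
  rewrite sumrB -mulr_sumr hper mulr0 subr0 sumrB /riemann -mulrBr; congr (_ * (_ - _)).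
  by apply: eq_bigr => j _; rewrite addrAC.
rewrite nrmM nrmV nN mulrC ler_pdivrMr// (le_trans (nrm_sum _ _ _))//.
have -> : f2 * nrm d * (nrm d + 1) / N%:R ^+ 2 * N%:R =
  \sum_(j < N) (f2 * nrm d * (nrm d + 1) / N%:R ^+ 2).
  by rewrite big_const_ord iter_addr_0 mulr_natr.
apply: ler_sum => j _; set x := w + j%:R / N%:R.
have xr : nrm x <= nrm w + 1.
  by rewrite (le_trans (nrmD _ _))// lerD2l nrm_frac// ltnW.
have i1 : nrm (1 / N%:R : C) <= 1 by rewrite (@nrm_frac 1 N).
have dN : nrm (d / N%:R) <= nrm d.
  by rewrite nrmM ler_piMr ?nrm_ge0// -[_^-1]mul1r.
have := hP x (x + d / N%:R) (x + 1 / N%:R).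
have w0 := nrm_ge0 w; have d0 := nrm_ge0 d.
have ha : nrm x <= r by lra.
have hb : nrm (x + d / N%:R) <= r by have := nrmD x (d / N%:R); lra.
have hc : nrm (x + 1 / N%:R) <= r by have := nrmD x (1 / N%:R); lra.
move=> /(_ ha hb hc); rewrite ![x + _ - x]addrC !addKr.
set A := P (x + d / N%:R) - P x; set B := P (x + 1 / N%:R) - P x.
have -> : 1 / N%:R * A - d / N%:R * B = N%:R^-1 * (A - d * B) by field.
rewrite nrmM nrmV nN !nrmM !nrmV nN nrm1 mulrC ler_pdivrMr// => h.
apply: le_trans h _; rewrite le_eqVlt; apply/orP; left; apply/eqP.
by field; rewrite gt_eqF.
Qed.

(** A discrete form of Cauchy's theorem: the mean over a period does not change when the period is
    translated, even off the real line. The shift by [d] is made in N steps of d / N, each costing B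
    / N^2. *)
Lemma riemann_shift_tends0 P w d : smooth P -> (forall v, P (v + 1) = P v) ->
  tends (fun M => riemann P M.*2.+1 (w + d) - riemann P M.*2.+1 w) 0.
Proof.
(* The intermediate points have modulus at most |w| + |d|, and [riemann_step] asks for a further
   margin of |d| + 2. *)
move=> sP P1; set r := nrm w + 2 * nrm d + 2.
have [b [f0 [f1 [f2 [[h0 h1 h2 hb] _ _ hP]]]]] := sP r.
set B := f2 * nrm d * (nrm d + 1).
have B0 : 0 <= B by rewrite !mulr_ge0 ?addr_ge0 ?nrm_ge0.
have key N : (0 < N)%N -> nrm (riemann P N (w + d) - riemann P N w) <= B / N%:R.
  move=> N0; have NC := natC_neq0 N0; have NR : 0 < N%:R :> R by rewrite ltr0n.
  suff hi i : (i <= N)%N ->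
      nrm (riemann P N (w + i%:R / N%:R * d) - riemann P N w) <= i%:R * (B / N%:R ^+ 2).
    have := hi N (leqnn _); rewrite divff// mul1r => /le_trans; apply.
    by rewrite le_eqVlt; apply/orP; left; apply/eqP; field; rewrite gt_eqF.
  elim: i => [|i IH] iN; first by rewrite !mul0r addr0 subrr nrm0.
  have {}IH := IH (ltnW iN).
  have := @riemann_step P f2 r d (w + i%:R / N%:R * d) N N0 P1 h2 hP.
  have -> : w + i%:R / N%:R * d + d / N%:R = w + i.+1%:R / N%:R * d.
    by rewrite -natr1; ring.
  have hr : nrm (w + i%:R / N%:R * d) + nrm d + 2 <= r.
    have : nrm (i%:R / N%:R * d) <= nrm d.
      by rewrite nrmM ler_piMl ?nrm_ge0// nrm_frac// ltnW.
    have := nrmD w (i%:R / N%:R * d); rewrite /r; lra.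
  move=> /(_ hr) => h; set a := riemann _ _ _ in h *.
  set c := riemann P N (w + i%:R / N%:R * d) in h IH *.
  have -> : a - riemann P N w = (a - c) + (c - riemann P N w) by ring.
  by rewrite -natr1 mulrDl mul1r addrC (le_trans (nrmD _ _))// lerD.
apply: (@tends_le _ _ _ (fun M => B / M.*2.+1%:R)) => [M|e e0].
  by rewrite subr0 key.
exists (Num.trunc (B / e)) => n Nn.
rewrite ltr_pdivrMr ?ltr0n// [ltRHS]mulrC -ltr_pdivrMr//.
have /Num.Theory.truncn_itv/andP[_ /lt_le_trans->//] : 0 <= B / e.
  by rewrite divr_ge0// ltW.
by rewrite ler_nat ltnS (leq_trans Nn)// -addnn leq_addl.
Qed.

End RiemannSums.

(** * Discrete Fourier coefficients and uniqueness *)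

Section Rigidity.
Context {R : realType}.
Local Notation C := R[i].
Implicit Types (P Q : C -> C) (u v w t : C) (k : int).

Definition quasiperiodic t P :=
  [/\ smooth P, forall v, P (v + 1) = P v
    & forall v, P (v + t) = cexp (- (2 * piC * iC * v) - piC * iC * t) * P v].

(** The k-th term of the classical theta series, the sum over k of e^{2 pi i k v + pi i k^2 t}. *)
Definition gauss t k v : C := cexp (2 * piC * iC * k%:~R * v + piC * iC * k%:~R ^+ 2 * t).

(** By quasi-periodicity the left side does not change from j to j + 1; an induction in both
    directions leads to j = 0, where it is [P v]. *)
Lemma gauss_shift t P k v : quasiperiodic t P -> gauss t k v * P (v + k%:~R * t) = P v.
Proof.
move=> [_ _ Pt].
have step (j : int) : gauss t j v * P (v + j%:~R * t) = gauss t (j + 1) v * P (v + (j + 1)%:~R * t).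
  have -> : v + (j + 1)%:~R * t = v + j%:~R * t + t by rewrite intrD; ring.
  rewrite Pt mulrA -cexpD; congr (cexp _ * _); rewrite intrD; ring.
have g0 : gauss t 0 v * P (v + 0%:~R * t) = P v.
  by rewrite /gauss mulr0z expr0n /= !(mulr0, mul0r) !addr0 cexp0 mul1r.
elim/int_rec: k => [//|n IH|n IH].
- have -> : n.+1%:Z = n%:Z + 1 by lia.
  by rewrite -step.
- rewrite step; have -> : - n.+1%:Z + 1 = - n%:Z by lia.
  by [].
Qed.

Lemma gauss_add t k v (x : C) : gauss t k (v + x) = gauss t k v * expi (k%:~R * x).
Proof. by rewrite /gauss /expi -cexpD; congr cexp; ring. Qed.

(** Completing the square absorbs the linear part of the exponent into half of the quadratic one;
    then e^{-y} <= 1 / y gives the inverse square decay that [zsum_tends0] requires. *)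
Lemma gauss_decay t v : 0 < complex.Im t -> exists2 B : R, 0 <= B &
  forall k : int, k != 0 -> nrm (gauss t k v) <= B / (k%:~R : R) ^+ 2.
Proof.
move=> t0; set a := pi * complex.Im t; set b := 2 * pi * complex.Im v.
have a0 : 0 < a by rewrite mulr_gt0// pi_gt0.
exists (expR (b ^+ 2 / (2 * a)) * (2 / a)); first by rewrite mulr_ge0 ?expR_ge0 ?divr_ge0 ?ltW.
move=> k k0; rewrite nrm_cexp.
have kR : (k%:~R : R) != 0 by rewrite intr_eq0.
have k2 : 0 < (k%:~R : R) ^+ 2 by rewrite exprn_even_gt0.
have -> : complex.Re (2 * piC * iC * k%:~R * v + piC * iC * k%:~R ^+ 2 * t)
   = - (b * k%:~R) - a * k%:~R ^+ 2.
  have -> : 2 * piC * iC * k%:~R * v + piC * iC * k%:~R ^+ 2 * t =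
    iC * ((2 * pi * k%:~R)%:C%C * v + (pi * k%:~R ^+ 2)%:C%C * t).
    by rewrite !rmorphM /= !rmorph_int rmorph_nat /piC; ring.
  by rewrite iC_mul /= /a /b; case: (v) => v1 v2; case: (t) => t1 t2 /=; ring.
set x : R := k%:~R in kR k2 *.
have h1 : - (b * x) - a * x ^+ 2 <= b ^+ 2 / (2 * a) - a * x ^+ 2 / 2.
  rewrite -subr_ge0.
  have -> : b ^+ 2 / (2 * a) - a * x ^+ 2 / 2 - (- (b * x) - a * x ^+ 2) =
     (b + a * x) ^+ 2 / (2 * a) by field; rewrite gt_eqF.
  by rewrite divr_ge0 ?sqr_ge0// mulr_ge0// ltW.
apply: (@le_trans _ _ (expR (b ^+ 2 / (2 * a) - a * x ^+ 2 / 2))); first by rewrite ler_expR.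
rewrite expRD -[leRHS]mulrA ler_wpM2l ?expR_ge0// expRN.
have -> : 2 / a / x ^+ 2 = (a * x ^+ 2 / 2)^-1 by field; rewrite kR gt_eqF.
have y0 : 0 < a * x ^+ 2 / 2 by rewrite divr_gt0 ?(mulr_gt0 a0 k2).
rewrite lef_pV2 ?posrE ?expR_gt0//.
by have := expR_ge1Dx (a * x ^+ 2 / 2); lra.
Qed.

(** A discrete Fourier coefficient on the grid v + j / N. Being based at v, it already carries the
    phase e^{2 pi i k v}, so inversion at v is a plain sum over k. *)
Definition fourier P N k v : C :=
  N%:R^-1 * \sum_(j < N) P (v + j%:R / N%:R) * expi (- (k%:~R * (j%:R / N%:R))).

(** [gauss_shift] at each node moves the node by k t, and the phase that [gauss_add] releases
    cancels the character. The coefficient becomes the mean of P over the translated period. *)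
Lemma fourierE t P N k v : quasiperiodic t P ->
  fourier P N k v = gauss t k v * riemann P N (v + k%:~R * t).
Proof.
move=> qP; rewrite /fourier /riemann mulrCA; congr (_ * _).
rewrite mulr_sumr; apply: eq_bigr => j _.
set a := j%:R / N%:R; have := gauss_shift k (v + a) qP; rewrite gauss_add => <-.
have e1 : expi (k%:~R * a) * expi (- (k%:~R * a)) = 1 by rewrite -expiD subrr expi0.
by rewrite mulrAC -[gauss t k v * _ * _]mulrA e1 mulr1 (addrAC v a).
Qed.

Lemma frac_real (k : int) (j N : nat) :
  (k%:~R * (j%:R / N%:R) : C) = (k%:~R * (j%:R / N%:R) : R)%:C%C.
Proof. by rewrite rmorphM fmorph_div /= rmorph_int !rmorph_nat. Qed.

(** Exact for each M: -M, ..., M represents every residue modulo N = 2M + 1 once, so the sum over k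
    annihilates every node except j = 0 as a geometric sum of an N-th root of unity other than 1. *)
Lemma fourier_inversion P M v : zsum M (fun k => fourier P M.*2.+1 k v) = P v.
Proof.
set N := M.*2.+1; have NC := @natC_neq0 R N (ltn0Sn _).
rewrite /zsum /fourier -mulr_sumr exchange_big /= (bigD1 ord0)//= mul0r addr0.
rewrite (eq_bigr (fun=> P v)); last by move=> i _; rewrite mulr0 oppr0 expi0 mulr1.
rewrite big_const_ord iter_addr_0 -[P v *+ N]mulr_natl big1 ?addr0 ?mulKf// => j j0.
rewrite -mulr_sumr; set z := expi (- (j%:R / N%:R : C)).
have -> : \sum_(i < N) expi (- ((i%:Z - M%:Z)%:~R * (j%:R / N%:R))) =
   expi (M%:R * (j%:R / N%:R)) * \sum_(i < N) z ^+ i.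
  rewrite mulr_sumr; apply: eq_bigr => i _; rewrite /z /expi -cexpMn -cexpD.
  by congr cexp; rewrite intrB -!pmulrn; ring.
have jN : 0 < (j%:R / N%:R : R) < 1.
  rewrite divr_gt0 ?ltr0n//=; last by rewrite lt0n; apply: contra j0 => /eqP j0; apply/eqP/val_inj.
  by rewrite ltr_pdivrMr ?ltr0n// mul1r ltr_nat ltn_ord.
have z1 : z != 1.
  have := expi_neq1 jN; rewrite /z expiN fmorph_div /= !rmorph_nat.
  by apply: contra => /eqP h; rewrite -[expi _]invrK h invr1.
have zN : z ^+ N = 1.
  rewrite /z /expi -cexpMn.
  have -> : N%:R * (2 * piC * iC * - (j%:R / N%:R)) = 2 * piC * iC * ((- j%:Z)%:~R : C).
    by rewrite mulrNz -pmulrn; field.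
  exact: expi_int.
have := subrX1 z N; rewrite zN subrr => /esym/eqP; rewrite mulf_eq0 subr_eq0 (negPf z1)/=.
by move=> /eqP ->; rewrite mulr0 mulr0.
Qed.

(** Two discrete summations by parts: (w - 1)^2 times the sum is a sum of second differences of P,
    which smoothness makes O(1 / N^2). The restriction |k| <= M puts k / N in [-1/2, 1/2], where |w
    - 1| >= |k| / (2N). The bound is uniform in M, as Tannery's theorem needs. *)
Lemma fourier_decay t P v : quasiperiodic t P -> exists B : R,
  forall M k, k != 0 -> `|k%:~R : R| <= M%:R ->
    nrm (fourier P M.*2.+1 k v) <= B / (k%:~R : R) ^+ 2.
Proof.
move=> [sP P1 _]; set r := nrm v + 3.
have [b [f0 [f1 [f2 [[h0 h1 h2 hb] _ _ hP]]]]] := sP r.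
(* 24 = 6 * 4: the increments 2 / N and 1 / N give 2 * 1 * 3 = 6 in the second difference, and the
   squared lower bound on |w - 1| gives 4. *)
exists (24 * f2) => M k k0 kM; set N := M.*2.+1.
have NC := @natC_neq0 R N (ltn0Sn _); have NR : 0 < N%:R :> R by rewrite ltr0n.
set w : C := expi (k%:~R * (1 / N%:R)).
pose F j : C := P (v + j%:R / N%:R) * expi (- (k%:~R * (j%:R / N%:R))).
have FS (j : nat) : P (v + j.+1%:R / N%:R) * expi (- (k%:~R * (j%:R / N%:R))) = w * F j.+1.
  rewrite /F; have -> : expi (- (k%:~R * (j%:R / N%:R))) =
      w * expi (- (k%:~R * (j.+1%:R / N%:R))) by rewrite -expiD; congr expi; ring.
  ring.
have FN (j : nat) : F (j + N)%N = F j.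
  rewrite /F natrD mulrDl divff// addrA P1 mulrDr mulr1 opprD expiD.
  by rewrite [X in _ * (_ * X)]expiN expi_int invr1 mulr1.
have s1 : \sum_(j < N) F j.+1 = \sum_(j < N) F j by rewrite sum_periodic// -{1}[N]add0n FN.
have s2 : \sum_(j < N) F j.+2 = \sum_(j < N) F j.
  by rewrite -s1 (@sum_periodic _ (fun j => F j.+1))// -addn1 addnC FN.
have e1 : (w - 1) ^+ 2 * \sum_(j < N) F j = \sum_(j < N)
    (P (v + j.+2%:R / N%:R) - 2 * P (v + j.+1%:R / N%:R) + P (v + j%:R / N%:R)) *
     expi (- (k%:~R * (j%:R / N%:R))).
  have -> : (w - 1) ^+ 2 * \sum_(j < N) F j =
     w ^+ 2 * \sum_(j < N) F j.+2 - 2 * w * \sum_(j < N) F j.+1 + \sum_(j < N) F j.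
    by rewrite s1 s2; ring.
  rewrite !mulr_sumr -sumrB -big_split /=; apply: eq_bigr => j _.
  have -> : w ^+ 2 * F j.+2 = P (v + j.+2%:R / N%:R) * expi (- (k%:~R * (j%:R / N%:R))).
    have -> : expi (- (k%:~R * (j%:R / N%:R))) =
      w * expi (- (k%:~R * (j.+1%:R / N%:R))) by rewrite -expiD; congr expi; ring.
    by rewrite [RHS]mulrCA (FS j.+1) expr2 -mulrA.
  by rewrite -mulrA -FS /F; ring.
have e2 : nrm ((w - 1) ^+ 2 * \sum_(j < N) F j) <= 6 * f2 / N%:R.
  rewrite e1 (le_trans (nrm_sum _ _ _))//.
  have -> : 6 * f2 / N%:R = \sum_(j < N) (6 * f2 / N%:R ^+ 2).
    by rewrite big_const_ord iter_addr_0 -[_ *+ N]mulr_natr; field; rewrite gt_eqF.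
  apply: ler_sum => j _; rewrite nrmM frac_real -rmorphN nrm_expi_real mulr1.
  set x := v + j%:R / N%:R.
  have i1 : nrm (1 / N%:R : C) <= 1 by rewrite (@nrm_frac R 1 N).
  have i1' : nrm (1 / N%:R : C) = N%:R^-1 by rewrite mul1r nrmV nrm_nat.
  have i2 : nrm (2 / N%:R : C) = 2 * N%:R^-1 by rewrite nrmM nrmV !nrm_nat.
  have -> : v + j.+2%:R / N%:R = x + 2 / N%:R by rewrite /x -addn2 natrD; ring.
  have -> : v + j.+1%:R / N%:R = x + 1 / N%:R by rewrite /x -addn1 natrD; ring.
  have xr : nrm x <= nrm v + 1.
    by rewrite (le_trans (nrmD _ _))// lerD2l nrm_frac// ltnW.
  have ha : nrm x <= r by rewrite /r; lra.
  have hb' : nrm (x + 1 / N%:R) <= r by rewrite /r; have := nrmD x (1 / N%:R); lra.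
  have hc : nrm (x + 2 / N%:R) <= r by rewrite /r; have := nrmD x (2 / N%:R); lra.
  have := hP _ _ _ ha hc hb'; rewrite ![x + _ - x]addrC !addKr.
  have -> : 1 / N%:R * (P (x + 2 / N%:R) - P x) - 2 / N%:R * (P (x + 1 / N%:R) - P x)
    = N%:R^-1 * (P (x + 2 / N%:R) - 2 * P (x + 1 / N%:R) + P x) by field.
  rewrite nrmM nrmV nrm_nat i1' i2 mulrC ler_pdivrMr// => /le_trans; apply.
  by rewrite le_eqVlt; apply/orP; left; apply/eqP; field; rewrite gt_eqF.
have kR : (k%:~R : R) != 0 by rewrite intr_eq0.
have e3 : `|k%:~R : R| / N%:R / 2 <= nrm (w - 1).
  have := @nrm_expi_sub1_ge R (k%:~R * (1%:R / N%:R)).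
  have -> : `|k%:~R * (1%:R / N%:R) : R| = `|k%:~R : R| / N%:R.
    by rewrite normrM [`|_ / N%:R|]ger0_norm ?divr_ge0// mul1r.
  have -> : (k%:~R * (1%:R / N%:R) : R)%:C%C = k%:~R * (1 / N%:R) :> C.
    by rewrite -(frac_real k 1 N).
  apply.
  have hN : N%:R = 2 * M%:R + 1 :> R by rewrite /N -natr1 -mul2n natrM.
  by rewrite ler_pdivrMr// (le_trans kM)// hN; lra.
have e4 : (`|k%:~R : R| / N%:R / 2) ^+ 2 * nrm (\sum_(j < N) F j) <= 6 * f2 / N%:R.
  apply: le_trans e2; rewrite nrmM nrmX ler_wpM2r ?nrm_ge0//.
  by rewrite ler_pXn2r ?nnegrE ?nrm_ge0 ?divr_ge0.
rewrite /fourier -/F nrmM nrmV nrm_nat ler_pdivlMr ?exprn_even_gt0//.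
rewrite -(real_normK (num_real (k%:~R : R))).
have -> : N%:R^-1 * nrm (\sum_(j < N) F j) * `|k%:~R : R| ^+ 2 =
  (4 * N%:R) * ((`|k%:~R : R| / N%:R / 2) ^+ 2 * nrm (\sum_(j < N) F j)).
  by field; rewrite gt_eqF.
have -> : 24 * f2 = (4 * N%:R) * (6 * f2 / N%:R) by field; rewrite gt_eqF.
by rewrite ler_wpM2l// mulr_ge0.
Qed.

Lemma riemann_bounded P w : smooth P -> exists B : R,
  forall M, nrm (riemann P M.*2.+1 w) <= B.
Proof.
move=> sP; have [b [f0 [f1 [f2 [_ h _ _]]]]] := sP (nrm w + 1).
exists f0 => M; set N := M.*2.+1; rewrite /riemann nrmM nrmV nrm_nat mulrC.
rewrite ler_pdivrMr ?ltr0n// (le_trans (nrm_sum _ _ _))//.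
have -> : f0 * N%:R = \sum_(j < N) f0 by rewrite big_const_ord iter_addr_0 mulr_natr.
apply: ler_sum => j _; apply: h; rewrite (le_trans (nrmD _ _))// lerD2l.
by rewrite nrm_frac// ltnW.
Qed.

(* Fourier inversion on the grid v + j/N: quasi-periodicity turns the k-th coefficient into a
   Riemann sum over a translated period, and by smoothness Riemann sums over translated periods
   have the same limit. *)
Lemma fourier_asymptotics t P v : 0 < complex.Im t -> quasiperiodic t P ->
  tends (fun M => riemann P M.*2.+1 0 * zsum M (fun k => gauss t k v)) (P v).
Proof.
move=> t0 qP; have [sP P1 _] := qP.
have [B1 hB1] := fourier_decay v qP; have [B2 B20 hB2] := gauss_decay v t0.
have [B3 hB3] := riemann_bounded 0 sP.
pose a M k := fourier P M.*2.+1 k v - riemann P M.*2.+1 0 * gauss t k v.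
have a0 k : tends (fun M => a M k) 0.
  have h := tendsM (tends_cst (gauss t k v)) (riemann_shift_tends0 0 (v + k%:~R * t) sP P1).
  move: h; rewrite mulr0; congr tends; apply/funext => M.
  rewrite /a (fourierE _ _ _ qP) add0r; ring.
have aB M (k : int) : k != 0 -> `|k%:~R : R| <= M%:R ->
    nrm (a M k) <= (B1 + B3 * B2) / (k%:~R : R) ^+ 2.
  move=> k0 kM; rewrite /a (le_trans (nrmB _ _))// mulrDl lerD ?hB1//.
  by rewrite nrmM -mulrA ler_pM ?nrm_ge0 ?hB2 ?hB3.
have := @zsum_tends0 R a (B1 + B3 * B2) a0 _.
move=> /(_ _)/tendsN h.
have {}h : tends (fun M => - zsum M (a M)) (- 0).
  apply: h => M k /andP[k0 kM].
  split; have := aB M; [move=> /(_ k%:Z) | move=> /(_ (- k%:Z))].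
    by apply; [lia | rewrite -pmulrn normr_nat ler_nat].
  by rewrite mulrNz sqrrN; apply; [lia | rewrite normrN -pmulrn normr_nat ler_nat].
have := tendsD (tends_cst (P v)) h; rewrite oppr0 addr0.
congr tends; apply/funext => M.
rewrite -[X in X - _](fourier_inversion P M v) /zsum -sumrB mulr_sumr.
by apply: eq_bigr => j _; rewrite /a opprB addrC subrK.
Qed.

(** In [fourier_asymptotics] the Riemann sum does not depend on the point and the Gaussian sum does
    not depend on the function, so both sides are limits of the same sequence. *)
Lemma quasiperiodic_prop t P Q v w : 0 < complex.Im t ->
  quasiperiodic t P -> quasiperiodic t Q -> P v * Q w = P w * Q v.
Proof.
move=> t0 qP qQ.
have h := fourier_asymptotics _ t0.
have h1 := tendsM (h _ v qP) (h _ w qQ); have h2 := tendsM (h _ w qP) (h _ v qQ).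
apply: (tends_uniq h1); move: h2; congr tends; apply/funext => M; ring.
Qed.

End Rigidity.

(** * Theta functions with characteristics *)

Section ThetaTypes.
Context {R : realType}.
Local Notation C := R[i].
Implicit Types (P Q : C -> C) (u v w t : C).

(* The four characteristics: vtheta1, vtheta2, vtheta3, vtheta0 have types (true, true), (true, false), (false, false), (false, true). *)
Definition theta_type (s1 s2 : bool) t P :=
  [/\ smooth P, forall v, P (v + 1) = (-1) ^+ s1 * P v
    & forall v, P (v + t) = (-1) ^+ s2 * cexp (- (2 * piC * iC * v) - piC * iC * t) * P v].

Lemma cexp_sign (s : bool) : cexp (piC * iC * s%:R) = (-1) ^+ s :> C.
Proof. by case: s; rewrite ?mulr1 ?mulr0 ?cexp_pi ?cexp0. Qed.

(** Translation by the half period (s1 t + s2) / 2 together with the factor e^{pi i s1 v} removes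
    both signs. The form [1 * v] is the one in [smooth_affine]. *)
Lemma theta_type_quasiperiodic s1 s2 t P : theta_type s1 s2 t P ->
  quasiperiodic t (fun v => cexp (piC * iC * s1%:R * v) * P (1 * v + (s1%:R * t + s2%:R) / 2)).
Proof.
move=> [sP P1 Pt]; split.
- by apply: smoothM; [exact: smooth_linexp | exact: smooth_affine].
- move=> v; rewrite !mul1r.
  have -> : v + 1 + (s1%:R * t + s2%:R) / 2 = v + (s1%:R * t + s2%:R) / 2 + 1 by ring.
  rewrite P1 mulrDr mulr1 cexpD cexp_sign.
  have : (-1) ^+ s1 * (-1) ^+ s1 = 1 :> C by rewrite -signr_addb addbb.
  by move=> h; ring: h.
- move=> v; rewrite !mul1r.
  have -> : v + t + (s1%:R * t + s2%:R) / 2 = v + (s1%:R * t + s2%:R) / 2 + t by ring.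
  rewrite Pt -cexp_sign; set b := v + _ / 2.
  have E : cexp (piC * iC * s1%:R * (v + t)) *
      (cexp (piC * iC * s2%:R) * cexp (- (2 * piC * iC * b) - piC * iC * t)) =
      cexp (- (2 * piC * iC * v) - piC * iC * t) * cexp (piC * iC * s1%:R * v).
    by rewrite -!cexpD; congr cexp; rewrite /b; field.
  by rewrite [LHS]mulrA E -[LHS]mulrA.
Qed.

Lemma theta_type_prop s1 s2 t P Q v w : 0 < complex.Im t ->
  theta_type s1 s2 t P -> theta_type s1 s2 t Q -> P v * Q w = P w * Q v.
Proof.
move=> t0 /theta_type_quasiperiodic qP /theta_type_quasiperiodic qQ.
set b := (s1%:R * t + s2%:R) / 2 in qP qQ.
have := quasiperiodic_prop (v - b) (w - b) t0 qP qQ; rewrite /= !mul1r !subrK.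
set e1 := cexp _; set e2 := cexp _ => h.
apply: (mulfI (cexp_neq0 (piC * iC * s1%:R * (v - b)))).
apply: (mulfI (cexp_neq0 (piC * iC * s1%:R * (w - b)))).
rewrite -/e1 -/e2; move: h; rewrite mulrACA [RHS]mulrACA => h.
transitivity (e1 * e2 * (P v * Q w)); first by ring.
by rewrite h -mulrA.
Qed.

Section Level.
Variable t : C.
Hypothesis t0 : 0 < complex.Im t.

Lemma vtheta2_add1 u : vtheta2 (u + 1) t = - vtheta2 u t.
Proof. by rewrite /vtheta2 addrAC vtheta1_add1. Qed.

Lemma vtheta2N u : vtheta2 (- u) t = vtheta2 u t.
Proof.
rewrite /vtheta2; have -> : - u + 1 / 2 = - (u + 1 / 2) + 1 by field.
by rewrite vtheta1_add1// vtheta1N// opprK.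
Qed.

Lemma vtheta1_0 : vtheta1 0 t = 0.
Proof.
have := vtheta1N 0 t0; rewrite oppr0 => /eqP; rewrite -subr_eq0 opprK -mulr2n.
by rewrite mulrn_eq0 /= => /eqP.
Qed.

Lemma vtheta2_half u : vtheta2 (u + 1 / 2) t = - vtheta1 u t.
Proof.
by rewrite /vtheta2 -vtheta1_add1//; congr vtheta1; field.
Qed.

Lemma vtheta2_addt u : vtheta2 (u + t) t =
  cexp (- (2 * piC * iC * u) - piC * iC * t) * vtheta2 u t.
Proof.
rewrite /vtheta2 addrAC vtheta1_addt//.
have -> : - (2 * piC * iC * (u + 1 / 2)) - piC * iC * t =
  - (2 * piC * iC * u) - piC * iC * t + - (piC * iC) by field.
by rewrite cexpD [cexp (- (piC * iC))]cexpN cexp_pi invrN invr1 mulrN1 opprK.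
Qed.

Lemma vtheta1_type : theta_type true true t (vtheta1 ^~ t).
Proof.
split; first exact: smooth_vtheta1.
- by move=> v; rewrite vtheta1_add1// mulN1r.
- by move=> v; rewrite vtheta1_addt// expr1 mulN1r.
Qed.

Lemma smooth_vtheta2 : smooth (vtheta2 ^~ t).
Proof.
rewrite /vtheta2; under eq_fun do rewrite -[X in X + _]mul1r.
exact: (smooth_affine _ _ (smooth_vtheta1 t0)).
Qed.

Lemma vtheta2_type : theta_type true false t (vtheta2 ^~ t).
Proof.
split; first exact: smooth_vtheta2.
- by move=> v; rewrite vtheta2_add1 mulN1r.
- by move=> v; rewrite vtheta2_addt mul1r.
Qed.

Lemma smooth_vtheta_shift (c d : C) :
  smooth (fun v => d * cexp (piC * iC * (v + t / 4)) * vtheta1 (v + c) t).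
Proof.
apply: smoothM.
  apply: smoothZ; apply: smooth_cexp; apply: smoothZ; apply: smoothD.
    exact: smooth_id.
  exact: smooth_cst.
under eq_fun do rewrite -[X in vtheta1 (X + _)]mul1r.
exact: (smooth_affine _ _ (smooth_vtheta1 t0)).
Qed.

Lemma vtheta3_type : theta_type false false t (vtheta3 ^~ t).
Proof.
split.
- rewrite /vtheta3; under eq_fun do rewrite -[cexp _]mul1r; exact: smooth_vtheta_shift.
- move=> v; rewrite /vtheta3 mul1r.
  have -> : v + 1 + (t + 1) / 2 = v + (t + 1) / 2 + 1 by ring.
  have -> : piC * iC * (v + 1 + t / 4) = piC * iC * (v + t / 4) + piC * iC by ring.
  by rewrite vtheta1_add1// cexpD cexp_pi mulrN1 mulrNN.
- move=> v; rewrite /vtheta3 mul1r.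
  have -> : v + t + (t + 1) / 2 = v + (t + 1) / 2 + t by ring.
  rewrite vtheta1_addt//.
  have E : cexp (piC * iC * (v + t + t / 4)) *
      (- cexp (- (2 * piC * iC * (v + (t + 1) / 2)) - piC * iC * t)) =
      cexp (- (2 * piC * iC * v) - piC * iC * t) * cexp (piC * iC * (v + t / 4)).
    by rewrite mulrN -mulN1r -cexp_pi -!cexpD; congr cexp; field.
  by rewrite [LHS]mulrA E -[LHS]mulrA.
Qed.

Lemma vtheta0_type : theta_type false true t (vtheta0 ^~ t).
Proof.
split.
- exact: smooth_vtheta_shift.
- move=> v; rewrite /vtheta0 mul1r.
  have -> : v + 1 + t / 2 = v + t / 2 + 1 by ring.
  have -> : piC * iC * (v + 1 + t / 4) = piC * iC * (v + t / 4) + piC * iC by ring.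
  by rewrite vtheta1_add1// cexpD cexp_pi; ring.
- move=> v; rewrite /vtheta0 expr1.
  have -> : v + t + t / 2 = v + t / 2 + t by ring.
  rewrite vtheta1_addt//.
  have -> : cexp (piC * iC * (v + t + t / 4)) =
    cexp (piC * iC * t) * cexp (piC * iC * (v + t / 4)) by rewrite -cexpD; congr cexp; ring.
  have -> : cexp (- (2 * piC * iC * (v + t / 2)) - piC * iC * t) =
    cexp (- (2 * piC * iC * v) - piC * iC * t) / cexp (piC * iC * t).
    by rewrite -cexpB; congr cexp; field.
  by field; exact: cexp_neq0.
Qed.

Lemma expi_half : expi (1 / 2) = -1 :> C.
Proof.
by rewrite -cexp_pi; congr cexp; field.
Qed.

Lemma nrm_expi_half : nrm (expi (t / 2)) < 1.
Proof.
apply: nrm_expi_lt1; have -> : t / 2 = (2^-1)%:C%C * t.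
  by rewrite fmorphV rmorph_nat mulrC.
by case: (t) t0 => a b /= b0; rewrite mul0r addr0 mulr_gt0.
Qed.

Lemma expi_sqr : expi t = expi (t / 2) ^+ 2.
Proof. by rewrite expr2 -expiD; congr expi; field. Qed.

(** Serves u = t / 2 and u = (t + 1) / 2. Since |e^{2 pi i t}| is the square of |e^{2 pi i u}|, such
    a point lies in the annulus of [vtheta1_neq0]. *)
Lemma vtheta1_neq0_small (u : C) (e : C) : e = 1 \/ e = -1 ->
  expi u = e * expi (t / 2) -> vtheta1 u t != 0.
Proof.
move=> ee ue; set s := expi (t / 2) in ue.
have s0 : s != 0 by exact: expi_neq0.
have ns : nrm s < 1 by exact: nrm_expi_half.
have ne : nrm e = 1 by case: ee => ->; rewrite ?nrmN nrm1.
have e0 : e != 0 by rewrite -nrm_eq0 ne oner_eq0.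
apply: vtheta1_neq0 => //; rewrite ue.
- apply/eqP => h; have := congr1 nrm h; rewrite nrmM ne mul1r nrm1 => hs.
  by rewrite hs ltxx in ns.
- have -> : expi t * (e * s) = e * s ^+ 3 by rewrite expi_sqr -/s; ring.
  rewrite (nrmM e) nrmX ne mul1r.
  by rewrite exprn_ilt1 ?nrm_ge0.
- rewrite expi_sqr -/s; have -> : s ^+ 2 / (e * s) = s / e by field; rewrite e0 s0.
  by rewrite nrmM nrmV ne invr1 mulr1.
Qed.

Lemma vtheta3_0_neq0 : vtheta3 0 t != 0.
Proof.
apply: mulf_neq0; first exact: cexp_neq0.
apply: (@vtheta1_neq0_small _ (-1)); first by right.
by rewrite add0r mulrDl expiD expi_half mulrC.
Qed.

Lemma vtheta0_0_neq0 : vtheta0 0 t != 0.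
Proof.
apply: mulf_neq0.
  by apply: mulf_neq0; [rewrite oppr_eq0; exact: iC_neq0 | exact: cexp_neq0].
apply: (@vtheta1_neq0_small _ 1); first by left.
by rewrite add0r mul1r.
Qed.

Lemma vtheta1_neq0_real (x : R) : 0 < x < 1 -> vtheta1 (x%:C)%C t != 0.
Proof.
move=> x01; have h := nrm_expi_real x; have q1 := nrm_expi_lt1 t0.
by apply: vtheta1_neq0; rewrite ?expi_neq1// nrmM ?nrmV h ?invr1 mulr1.
Qed.

Lemma vtheta2_0_neq0 : vtheta2 0 t != 0.
Proof.
rewrite /vtheta2 add0r; have -> : 1 / 2 = (1 / 2 : R)%:C%C :> C.
  by rewrite fmorph_div /= rmorph1 rmorph_nat.
by apply: vtheta1_neq0_real; lra.
Qed.

End Level.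
End ThetaTypes.

(** * Addition and duplication formulas *)

Section Bilinear.
Context {R : realType}.
Local Notation C := R[i].
Implicit Types (x y z u v w t : C).
Variable t : C.
Hypothesis t0 : 0 < complex.Im t.
Local Notation th1 z := (vtheta1 z (t / 2)).
Local Notation th2 z := (vtheta2 z (t / 2)).

Lemma Im_half : 0 < complex.Im (t / 2).
Proof.
have -> : t / 2 = (2^-1)%:C%C * t by rewrite fmorphV rmorph_nat mulrC.
by case: (t) t0 => a b /= b0; rewrite mul0r addr0 mulr_gt0.
Qed.
Let h0 := Im_half.

Let mult w := cexp (- (2 * piC * iC * w) - piC * iC * (t / 2)).

Lemma mult_prod X y : mult (X / 2 + y) * mult (X / 2 - y) =
  cexp (- (2 * piC * iC * X) - piC * iC * t).
Proof. by rewrite /mult -cexpD; congr cexp; field. Qed.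

Lemma halfD X y : (X + 1) / 2 + y = X / 2 + y + 1 / 2.
Proof. by field. Qed.
Lemma halfB X y : (X + 1) / 2 - y = X / 2 - y + 1 / 2.
Proof. by field. Qed.
Lemma halftD X y : (X + t) / 2 + y = X / 2 + y + t / 2.
Proof. by field. Qed.
Lemma halftB X y : (X + t) / 2 - y = X / 2 - y + t / 2.
Proof. by field. Qed.

Let th1_half w : th1 (w + 1 / 2) = th2 w. Proof. by []. Qed.
Let th2_half w : th2 (w + 1 / 2) = - th1 w. Proof. exact: vtheta2_half. Qed.
Let th1_t w : th1 (w + t / 2) = - mult w * th1 w. Proof. exact: vtheta1_addt. Qed.
Let th2_t w : th2 (w + t / 2) = mult w * th2 w. Proof. exact: vtheta2_addt. Qed.

Let smooth1 y : smooth (fun X => th1 (X / 2 + y)).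
Proof.
under eq_fun do rewrite [_ / 2]mulrC.
exact: (smooth_affine _ _ (smooth_vtheta1 h0)).
Qed.
Let smooth2 y : smooth (fun X => th2 (X / 2 + y)).
Proof.
under eq_fun do rewrite [_ / 2]mulrC.
exact: (smooth_affine _ _ (smooth_vtheta2 h0)).
Qed.

(** In the variable X, the period 1 acts on X / 2 as the half period 1 / 2, which exchanges th1 and
    th2 up to sign, and the period t acts as the period t / 2. The four combinations here and below
    are the eigenvectors of that exchange, one for each characteristic at modulus t. *)
Lemma sum_type y : theta_type false false t
  (fun X => th2 (X / 2 + y) * th2 (X / 2 - y) + th1 (X / 2 + y) * th1 (X / 2 - y)).
Proof.
split.
- by apply: smoothD; apply: smoothM.
- move=> X; rewrite halfD halfB !th1_half !th2_half expr0.
  move: (th1 (X / 2 + y)) (th1 (X / 2 - y)) (th2 (X / 2 + y)) (th2 (X / 2 - y)) => a b c d; ring.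
- move=> X; rewrite halftD halftB !th1_t !th2_t -(mult_prod X y) expr0.
  move: (mult _) (mult _) => m m'; move: (th1 (X / 2 + y)) (th1 (X / 2 - y)) (th2 (X / 2 + y)) (th2 (X / 2 - y)) => a b c d; ring.
Qed.

Lemma dif_type y : theta_type true false t
  (fun X => th2 (X / 2 + y) * th2 (X / 2 - y) - th1 (X / 2 + y) * th1 (X / 2 - y)).
Proof.
split.
- by apply: smoothB; apply: smoothM.
- move=> X; rewrite halfD halfB !th1_half !th2_half expr1.
  move: (th1 (X / 2 + y)) (th1 (X / 2 - y)) (th2 (X / 2 + y)) (th2 (X / 2 - y)) => a b c d; ring.
- move=> X; rewrite halftD halftB !th1_t !th2_t -(mult_prod X y) expr0.
  move: (mult _) (mult _) => m m'; move: (th1 (X / 2 + y)) (th1 (X / 2 - y)) (th2 (X / 2 + y)) (th2 (X / 2 - y)) => a b c d; ring.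
Qed.

Lemma alt_type y : theta_type false true t
  (fun X => th1 (X / 2 + y) * th2 (X / 2 - y) - th2 (X / 2 + y) * th1 (X / 2 - y)).
Proof.
split.
- by apply: smoothB; apply: smoothM.
- move=> X; rewrite halfD halfB !th1_half !th2_half expr0.
  move: (th1 (X / 2 + y)) (th1 (X / 2 - y)) (th2 (X / 2 + y)) (th2 (X / 2 - y)) => a b c d; ring.
- move=> X; rewrite halftD halftB !th1_t !th2_t -(mult_prod X y) expr1.
  move: (mult _) (mult _) => m m'; move: (th1 (X / 2 + y)) (th1 (X / 2 - y)) (th2 (X / 2 + y)) (th2 (X / 2 - y)) => a b c d; ring.
Qed.

Lemma mix_type y : theta_type true true t
  (fun X => th1 (X / 2 + y) * th2 (X / 2 - y) + th2 (X / 2 + y) * th1 (X / 2 - y)).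
Proof.
split.
- by apply: smoothD; apply: smoothM.
- move=> X; rewrite halfD halfB !th1_half !th2_half expr1.
  move: (th1 (X / 2 + y)) (th1 (X / 2 - y)) (th2 (X / 2 + y)) (th2 (X / 2 - y)) => a b c d; ring.
- move=> X; rewrite halftD halftB !th1_t !th2_t -(mult_prod X y) expr1.
  move: (mult _) (mult _) => m m'; move: (th1 (X / 2 + y)) (th1 (X / 2 - y)) (th2 (X / 2 + y)) (th2 (X / 2 - y)) => a b c d; ring.
Qed.

Let half2 x : 2 * x / 2 = x. Proof. by field. Qed.
Let zhalf : 0 / 2 = 0 :> C. Proof. by rewrite mul0r. Qed.

(** Proportionality of [sum_type] to [vtheta3], with the constant read off at X = 0; likewise for
    the next two formulas. *)
Lemma vtheta3_sum x y :
  (th2 (x + y) * th2 (x - y) + th1 (x + y) * th1 (x - y)) * vtheta3 0 t =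
  (th2 y ^+ 2 - th1 y ^+ 2) * vtheta3 (2 * x) t.
Proof.
have := theta_type_prop (2 * x) 0 t0 (sum_type y) (vtheta3_type t0) => /=.
rewrite half2 zhalf add0r sub0r (vtheta2N h0) (vtheta1N _ h0) => ->.
by rewrite mulrN -!expr2.
Qed.

Lemma vtheta2_sum x y :
  (th2 (x + y) * th2 (x - y) - th1 (x + y) * th1 (x - y)) * vtheta2 0 t =
  (th2 y ^+ 2 + th1 y ^+ 2) * vtheta2 (2 * x) t.
Proof.
have := theta_type_prop (2 * x) 0 t0 (dif_type y) (vtheta2_type t0) => /=.
rewrite half2 zhalf add0r sub0r (vtheta2N h0) (vtheta1N _ h0) => ->.
by rewrite mulrN opprK -!expr2.
Qed.

Lemma vtheta0_sum x y :
  (th1 (x + y) * th2 (x - y) - th2 (x + y) * th1 (x - y)) * vtheta0 0 t =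
  2 * (th1 y * th2 y) * vtheta0 (2 * x) t.
Proof.
have := theta_type_prop (2 * x) 0 t0 (alt_type y) (vtheta0_type t0) => /=.
rewrite half2 zhalf add0r sub0r (vtheta2N h0) (vtheta1N _ h0) => ->.
move: (th1 y) (th2 y) (vtheta0 _ _) => a b c; ring.
Qed.

Let th1_0 : th1 0 = 0. Proof. exact: vtheta1_0. Qed.

Lemma vtheta3_dup x : vtheta3 (2 * x) t * th2 0 ^+ 2 = (th2 x ^+ 2 + th1 x ^+ 2) * vtheta3 0 t.
Proof.
have := vtheta3_sum x 0; rewrite addr0 subr0 th1_0.
move: (th1 x) (th2 x) (th2 0) (vtheta3 _ _) (vtheta3 _ _) => a b c d e h.
by transitivity ((b * b + a * a) * e); [rewrite h; ring | ring].
Qed.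

Lemma vtheta2_dup x : vtheta2 (2 * x) t * th2 0 ^+ 2 = (th2 x ^+ 2 - th1 x ^+ 2) * vtheta2 0 t.
Proof.
have := vtheta2_sum x 0; rewrite addr0 subr0 th1_0.
move: (th1 x) (th2 x) (th2 0) (vtheta2 (2 * x) t) (vtheta2 0 t) => a b c d e h.
by transitivity ((b * b - a * a) * e); [rewrite h; ring | ring].
Qed.

(** Both functions of X vanish at 0, so the constant is read off at X = 1 / 2, where [vtheta1] takes
    the value [vtheta2 0 t]; this brings in the quarter period. *)
Lemma vtheta1_dup x : th1 x * th2 x * vtheta2 0 t =
  th1 (1 / 2 / 2) * th2 (1 / 2 / 2) * vtheta1 (2 * x) t.
Proof.
have := theta_type_prop (2 * x) (1 / 2) t0 (mix_type 0) (vtheta1_type t0) => /=.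
rewrite half2 !addr0 !subr0.
have -> : vtheta2 0 t = vtheta1 (1 / 2) t by rewrite /vtheta2 add0r.
move: (th1 x) (th2 x) (th1 (1 / 2 / 2)) (th2 (1 / 2 / 2)) => a b c d.
move: (vtheta1 (2 * x) t) (vtheta1 (1 / 2) t) => e f h.
apply: (mulfI (@two_neq0 R)).
by transitivity ((a * b + b * a) * f); [ring | rewrite h; ring].
Qed.

Let n3 : vtheta3 0 t != 0. Proof. exact: vtheta3_0_neq0. Qed.
Let n2 : vtheta2 0 t != 0. Proof. exact: vtheta2_0_neq0. Qed.

(** Eliminates [vtheta3 (2 * x) t] between [vtheta3_sum] and [vtheta3_dup], leaving a relation at
    modulus t / 2 alone; [dif_add] does the same with [vtheta2]. *)
Let sum_add x y : (th2 (x + y) * th2 (x - y) + th1 (x + y) * th1 (x - y)) * th2 0 ^+ 2 =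
  (th2 x ^+ 2 + th1 x ^+ 2) * (th2 y ^+ 2 - th1 y ^+ 2).
Proof.
apply: (mulfI n3); move: (vtheta3_sum x y) (vtheta3_dup x).
move: (th2 (x + y) * th2 (x - y) + th1 (x + y) * th1 (x - y)) => A.
move: (th1 x) (th2 x) (th1 y) (th2 y) (th2 0) (vtheta3 (2 * x) t) (vtheta3 0 t).
move=> a b c d e f g h1 h2.
by rewrite mulrA [g * A]mulrC h1 -mulrA h2; ring.
Qed.

Let dif_add x y : (th2 (x + y) * th2 (x - y) - th1 (x + y) * th1 (x - y)) * th2 0 ^+ 2 =
  (th2 x ^+ 2 - th1 x ^+ 2) * (th2 y ^+ 2 + th1 y ^+ 2).
Proof.
apply: (mulfI n2); move: (vtheta2_sum x y) (vtheta2_dup x).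
move: (th2 (x + y) * th2 (x - y) - th1 (x + y) * th1 (x - y)) => A.
move: (th1 x) (th2 x) (th1 y) (th2 y) (th2 0) (vtheta2 (2 * x) t) (vtheta2 0 t).
move=> a b c d e f g h1 h2.
by rewrite mulrA [g * A]mulrC h1 -mulrA h2; ring.
Qed.

Lemma th22_add x y : th2 (x + y) * th2 (x - y) * th2 0 ^+ 2 =
  th2 x ^+ 2 * th2 y ^+ 2 - th1 x ^+ 2 * th1 y ^+ 2.
Proof.
move: (sum_add x y) (dif_add x y).
move: (th2 (x + y) * th2 (x - y)) (th1 (x + y) * th1 (x - y)) (th2 0 ^+ 2) => A B D.
move: (th1 x) (th2 x) (th1 y) (th2 y) => a b c d h1 h2.
apply: (mulfI (@two_neq0 R)).
transitivity ((A + B) * D + (A - B) * D); first by ring.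
by rewrite h1 h2; ring.
Qed.

Lemma th11_add x y : th1 (x + y) * th1 (x - y) * th2 0 ^+ 2 =
  th1 x ^+ 2 * th2 y ^+ 2 - th2 x ^+ 2 * th1 y ^+ 2.
Proof.
move: (sum_add x y) (dif_add x y).
move: (th2 (x + y) * th2 (x - y)) (th1 (x + y) * th1 (x - y)) (th2 0 ^+ 2) => A B D.
move: (th1 x) (th2 x) (th1 y) (th2 y) => a b c d h1 h2.
apply: (mulfI (@two_neq0 R)).
transitivity ((A + B) * D - (A - B) * D); first by ring.
by rewrite h1 h2; ring.
Qed.

(** Exchanging x and y in [vtheta0_sum] reverses the sign of th1 (x - y); adding the two instances
    isolates one product. *)
Lemma th12_add x y : th1 (x + y) * th2 (x - y) * vtheta0 0 t =
  th1 x * th2 x * vtheta0 (2 * y) t + th1 y * th2 y * vtheta0 (2 * x) t.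
Proof.
have := vtheta0_sum x y; have := vtheta0_sum y x.
have -> : y - x = - (x - y) by rewrite opprB.
rewrite (vtheta2N h0) (vtheta1N _ h0) [y + x]addrC.
move: (th1 (x + y)) (th2 (x + y)) (th1 (x - y)) (th2 (x - y)) => e f g k.
move: (vtheta0 0 t) (vtheta0 (2 * x) t) (vtheta0 (2 * y) t) => m n p.
move: (th1 x) (th2 x) (th1 y) (th2 y) => a b c d h1 h2.
apply: (mulfI (@two_neq0 R)).
transitivity ((e * k - f * g) * m + (e * k - f * - g) * m); first by ring.
by rewrite h1 h2; ring.
Qed.

End Bilinear.

Section Duplication.
Context {R : realType}.
Local Notation C := R[i].
Variable t : C.
Hypothesis t0 : 0 < complex.Im t.

(* th22_add one level up, shifted by the half period (1 + t) / 2 *)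
Lemma vtheta0_dup z : vtheta0 (2 * z) t * vtheta0 0 t * vtheta2 0 t ^+ 2 =
  vtheta0 z t ^+ 2 * vtheta2 z t ^+ 2 + vtheta3 z t ^+ 2 * vtheta1 z t ^+ 2.
Proof.
have T0 : 0 < complex.Im (2 * t).
  rewrite -[2](rmorph_nat (real_complex R)); case: (t) t0 => a b /= b0.
  by rewrite mul0r addr0 mulr_gt0.
have := th22_add T0 (z + (t + 1) / 2) z.
have -> : 2 * t / 2 = t by field.
have -> : z + (t + 1) / 2 + z = 2 * z + (t + 1) / 2 by ring.
have -> : z + (t + 1) / 2 - z = 0 + (t + 1) / 2 by ring.
pose e w : C := cexp (piC * iC * (w + t / 4)).
have e0 w : e w != 0 by exact: cexp_neq0.
have s2 w : vtheta2 (w + (t + 1) / 2) t = - (iC * vtheta0 w t / e w).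
  have -> : vtheta2 (w + (t + 1) / 2) t = - vtheta1 (w + t / 2) t.
    by rewrite -vtheta1_add1// /vtheta2; congr vtheta1; field.
  rewrite /vtheta0 -/(e w); have i2 := @sqr_iC R; congr (- _).
  by field: i2; exact: e0.
have s1 w : vtheta1 (w + (t + 1) / 2) t = vtheta3 w t / e w.
  by rewrite /vtheta3 -/(e w); field; exact: e0.
rewrite !s2 s1 => h.
have ee : e (2 * z) * e 0 = e z * e z by rewrite -!cexpD; congr cexp; field.
have i2 := @sqr_iC R.
have : - (vtheta0 (2 * z) t * vtheta0 0 t * vtheta2 0 t ^+ 2) / (e (2 * z) * e 0) =
  - (vtheta0 z t ^+ 2 * vtheta2 z t ^+ 2 + vtheta3 z t ^+ 2 * vtheta1 z t ^+ 2) / (e z * e z).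
  transitivity (- (iC * vtheta0 (2 * z) t / e (2 * z)) * - (iC * vtheta0 0 t / e 0) * vtheta2 0 t ^+ 2).
    by field: i2; rewrite !e0.
  by rewrite h; field: i2; rewrite !e0.
rewrite ee => /(mulIf _) E; apply: oppr_inj; apply: E.
by rewrite invr_eq0; apply: mulf_neq0.
Qed.

End Duplication.

(** * The imaginary transformation and the normalization factor *)

Section DoubleProducts.
Context {R : realType}.
Local Notation C := R[i].
Implicit Types (y a b z : C) (k B : R).

Lemma nrm_prod1D_sub1 (c : nat -> C) N :
  nrm (\prod_(i < N) (1 + c i) - 1) <= expR (\sum_(i < N) nrm (c i)) - 1.
Proof.
elim: N => [|N IH]; first by rewrite !big_ord0 subrr nrm0 expR0 subrr.
rewrite !big_ord_recr /= expRD; set S := \sum_(i < N) _ in IH *.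
set P := \prod_(i < N) _ in IH *.
have -> : P * (1 + c N) - 1 = (P - 1) * (1 + c N) + c N by ring.
have h1 : nrm (1 + c N) <= 1 + nrm (c N) by rewrite (le_trans (nrmD _ _))// nrm1.
have h2 := expR_ge1Dx (nrm (c N)); have c0 := nrm_ge0 (c N).
have S1 : 1 <= expR S.
  by rewrite -[leLHS]expR0 ler_expR; apply: sumr_ge0 => i _; exact: nrm_ge0.
rewrite (le_trans (nrmD _ _))// nrmM.
have : nrm (P - 1) * nrm (1 + c N) <= (expR S - 1) * expR (nrm (c N)).
  by rewrite ler_pM ?nrm_ge0// (le_trans h1).
nra.
Qed.

Lemma expR_sub1_le (s B : R) : 0 <= s <= B -> expR s - 1 <= s * expR B.
Proof.
move=> /andP[s0 sB]; have h := expR_ge1Dx (- s); have e0 := expR_gt0 s.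
have hs := expRxMexpNx_1 s.
apply: (@le_trans _ _ (s * expR s)); last by rewrite ler_wpM2l// ler_expR.
have : expR s * (1 - s) <= expR s * expR (- s) by rewrite ler_wpM2l// ltW.
lra.
Qed.

(** The n-th row of the double product is within O(k^n) of 1, uniformly in its length. This yields
    both convergence and the recursion in the first base. *)
Lemma row_bound y a b k n N : 0 <= k < 1 -> nrm a <= k -> nrm b <= k ->
  nrm (\prod_(i < N) (1 + - (y * a ^+ n * b ^+ i)) - 1) <=
    nrm y / (1 - k) * expR (nrm y / (1 - k)) * k ^+ n.
Proof.
move=> k01 ak bk; have /andP[k0 k1] := k01.
have k1' : 0 < 1 - k by rewrite subr_gt0.
apply: le_trans (nrm_prod1D_sub1 (fun i => - (y * a ^+ n * b ^+ i)) N) _.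
set S := \sum_(i < N) _.
have hS : S <= nrm y * k ^+ n / (1 - k).
  apply: le_trans (@geometric_sum_le R k (nrm y * k ^+ n) N k01 _); last first.
    by rewrite mulr_ge0 ?nrm_ge0 ?exprn_ge0.
  apply: ler_sum => i _; rewrite nrmN !nrmM !nrmX.
  by rewrite ler_pM ?mulr_ge0 ?exprn_ge0 ?nrm_ge0 ?ler_wpM2l ?nrm_ge0// lerXn2r ?nnegrE ?nrm_ge0.
have hS' : nrm y * k ^+ n / (1 - k) <= nrm y / (1 - k).
  by rewrite ler_wpM2r ?invr_ge0 ?(ltW k1')// ler_piMr ?nrm_ge0// exprn_ile1// ltW.
apply: le_trans (@expR_sub1_le S (nrm y / (1 - k)) _) _.
  by rewrite (le_trans hS hS') andbT; apply: sumr_ge0 => i _; exact: nrm_ge0.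
have -> : nrm y / (1 - k) * expR (nrm y / (1 - k)) * k ^+ n =
  nrm y * k ^+ n / (1 - k) * expR (nrm y / (1 - k)) by ring.
by rewrite ler_wpM2r ?expR_ge0.
Qed.

Let D y a b N := \prod_(m < N) \prod_(n < N) (1 - y * a ^+ m * b ^+ n).

Let kmax a b : nrm a < 1 -> nrm b < 1 ->
  exists k : R, [/\ 0 <= k < 1, nrm a <= k & nrm b <= k].
Proof.
move=> a1 b1; exists (Num.max (nrm a) (nrm b)).
by rewrite le_max nrm_ge0 gt_max a1 b1 !le_max !lexx orbT.
Qed.

Lemma dqpoch_tends y a b : nrm a < 1 -> nrm b < 1 ->
  tends (fun N => \prod_(m < N) \prod_(n < N) (1 - y * a ^+ m * b ^+ n)) (dqpoch y a b).
Proof.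
move=> a1 b1; have [k [k01 ak bk]] := kmax a1 b1; have /andP[k0 k1] := k01.
(* The gnomon that enlarges the N by N square to the next one: N new entries with b^N, and N + 1
   with a^N including the corner. *)
pose g N := \prod_(m < N) (1 + - (y * b ^+ N * a ^+ m)) *
  \prod_(n < N.+1) (1 + - (y * a ^+ N * b ^+ n)).
set A := nrm y / (1 - k) * expR (nrm y / (1 - k)).
have A0 : 0 <= A by rewrite !mulr_ge0 ?expR_ge0 ?nrm_ge0// invr_ge0 subr_ge0 ltW.
have kN N : k ^+ N <= 1 by rewrite exprn_ile1// ltW.
have gb N : nrm (g N - 1) <= (A + A * (1 + A)) * k ^+ N.
  have h1 := @row_bound y b a k N N k01 bk ak.
  have h2 := @row_bound y a b k N N.+1 k01 ak bk.
  rewrite -/A in h1 h2; rewrite /g.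
  set p1 := \prod_(m < N) _ in h1 *; set p2 := \prod_(n < N.+1) _ in h2 *.
  have -> : p1 * p2 - 1 = (p1 - 1) + (p2 - 1) * (1 + (p1 - 1)) by ring.
  have h3 : nrm (1 + (p1 - 1)) <= 1 + A.
    rewrite (le_trans (nrmD _ _))// nrm1 lerD2l (le_trans h1)// ler_piMr//.
  rewrite [leRHS]mulrDl (le_trans (nrmD _ _))// lerD// nrmM.
  by rewrite [leRHS]mulrAC ler_pM ?nrm_ge0.
have [l hl] := @prod1D_tends R (fun N => g N - 1) k _ k01 gb.
suff Dl : tends (D y a b) l by rewrite /dqpoch (tends_clim Dl).
move: hl; congr tends; apply/funext; elim=> [|N IH]; first by rewrite /D !big_ord0.
rewrite big_ord_recr /= IH addrC subrK /D big_ord_recr /= mulrA; congr (_ * _).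
rewrite -big_split /=; apply: eq_bigr => m _; rewrite big_ord_recr /=.
by rewrite mulrAC.
Qed.

(** Consider N + 1 rows of length N. Splitting off the first row leaves the square product at
    [y * a]; splitting off the last leaves the square product at [y], and that last row tends to
    1. *)
Lemma dqpoch_rec y a b : nrm a < 1 -> nrm b < 1 ->
  dqpoch y a b = dqpoch (y * a) a b * ((1 - y) * qinf b y).
Proof.
move=> a1 b1; have [k [k01 ak bk]] := kmax a1 b1.
have h1 : tends (fun N => \prod_(i < N) (1 + - (y * a ^+ N * b ^+ i))) 1.
  apply: (@tends_le _ _ _ (fun N => nrm y / (1 - k) * expR (nrm y / (1 - k)) * k ^+ N)).
    by move=> N; exact: row_bound.
  exact: geometric_small.
have h2 : tends (fun N => \prod_(n < N) (1 - y * b ^+ n)) ((1 - y) * qinf b y).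
  apply: (@tends_unshift _ _ _ 1).
  have := tendsM (tends_cst (1 - y)) (qinf_tends_ord y b1).
  congr tends; apply/funext => N; rewrite addn1 big_ord_recl expr0 mulr1; congr (_ * _).
  by apply: eq_bigr => i _; rewrite lift0 mulrC.
have := tendsM (dqpoch_tends y a1 b1) h1; rewrite mulr1.
move=> /tends_uniq; apply.
have := tendsM (dqpoch_tends (y * a) a1 b1) h2; congr tends; apply/funext => N.
pose h m := \prod_(n < N) (1 - y * a ^+ m * b ^+ n).
transitivity (\prod_(m < N) h m * h N); last by [].
transitivity (\prod_(m < N.+1) h m); last by rewrite big_ord_recr.
rewrite big_ord_recl mulrC; congr (_ * _).
  by rewrite /h; apply: eq_bigr => n _; rewrite expr0 mulr1.
by apply: eq_bigr => m _; rewrite lift0 /h; apply: eq_bigr => n _; rewrite exprS mulrA.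
Qed.

End DoubleProducts.

(** * Jacobi's imaginary transformation up to a constant *)

Section Jacobi.
Context {R : realType}.
Local Notation C := R[i].
Variable t : C.
Hypothesis t0 : 0 < complex.Im t.

Let s : C := - t^-1.

Lemma tau_neq0 : t != 0.
Proof. by apply: contraTneq t0 => ->; rewrite ltxx. Qed.

Lemma Im_opp_inv : 0 < complex.Im (- t^-1).
Proof.
case: (t) t0 => a b /= b0; rewrite opprK divr_gt0//.
by rewrite ltr_wpDl ?sqr_ge0// exprn_gt0.
Qed.
Let s0 := Im_opp_inv.

(** Proportional to [vtheta1 v t] by Jacobi's imaginary transformation. The constant is left
    undetermined, since only ratios of two values are used. *)
Definition jacobi (v : C) : C := cexp (- (piC * iC * v * v / t)) * vtheta1 (v / t) s.

Lemma vtheta1_subt w : vtheta1 (w - s) s = - cexp (2 * piC * iC * w - piC * iC * s) * vtheta1 w s.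
Proof.
have := vtheta1_addt (w - s) s0; rewrite subrK => ->.
rewrite mulrA mulrNN -cexpD.
have -> : 2 * piC * iC * w - piC * iC * s + (- (2 * piC * iC * (w - s)) - piC * iC * s) = 0.
  by ring.
by rewrite cexp0 mul1r.
Qed.

Lemma jacobi_type : theta_type true true t jacobi.
Proof.
have tn := tau_neq0; split.
- apply: smoothM.
    apply: smooth_cexp; have -> : (fun v => - (piC * iC * v * v / t)) =
      (fun v : C => - (piC * iC / t) * (v * v)) by apply/funext => v; ring.
    apply: smoothZ; apply: smoothM; exact: smooth_id.
  have -> : (fun v => vtheta1 (v / t) s) = (fun v => vtheta1 (t^-1 * v + 0) s).
    by apply/funext => v; rewrite addr0 mulrC.
  exact: (smooth_affine _ _ (smooth_vtheta1 s0)).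
- move=> v; rewrite /jacobi expr1.
  have -> : (v + 1) / t = v / t - s by rewrite /s; ring.
  rewrite vtheta1_subt.
  have E : cexp (- (piC * iC * (v + 1) * (v + 1) / t)) * - cexp (2 * piC * iC * (v / t) - piC * iC * s)
    = -1 * cexp (- (piC * iC * v * v / t)).
    rewrite mulrN -cexpD mulN1r; congr (- cexp _); rewrite /s; ring.
  by rewrite [LHS]mulrA E [RHS]mulrA.
- move=> v; rewrite /jacobi expr1.
  have -> : (v + t) / t = v / t + 1 by field.
  rewrite vtheta1_add1//.
  have -> : cexp (- (piC * iC * (v + t) * (v + t) / t)) =
    cexp (- (2 * piC * iC * v) - piC * iC * t) * cexp (- (piC * iC * v * v / t)).
    by rewrite -cexpD; congr cexp; field.
  move: (cexp _) (cexp _) (vtheta1 _ _) => A B D; ring.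
Qed.

Lemma jacobi_prop v w : vtheta1 v t * jacobi w = vtheta1 w t * jacobi v.
Proof. exact: theta_type_prop t0 (vtheta1_type t0) jacobi_type. Qed.

(** Proportionality reduces this to one point where [jacobi] does not vanish: at t / 2 its theta
    argument is the real number 1 / 2. *)
Lemma jacobi_neq0 v : vtheta1 v t != 0 -> jacobi v != 0.
Proof.
move=> v0; have h : jacobi (t / 2) != 0.
  apply: mulf_neq0; first exact: cexp_neq0.
  have -> : t / 2 / t = (1 / 2 : R)%:C%C.
    by rewrite fmorph_div /= rmorph1 rmorph_nat; field; exact: tau_neq0.
  by apply: vtheta1_neq0_real => //; lra.
have := jacobi_prop v (t / 2); apply: contra_eq_neq => ->.
by rewrite mulr0; apply: mulf_neq0.
Qed.

(** The multiplicative theta function (z; p)_oo (p / z; p)_oo. *)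
Definition qtheta (p z : C) : C := (1 - z) * (qinf p z * qinf p z^-1).

Lemma jacobiE v : jacobi v = theta_cst s / (2 * iC) *
  (cexp (piC * iC * (v / t) - piC * iC * v * v / t) * qtheta (expi s) (expi (- (v / t)))).
Proof.
rewrite /jacobi vtheta1E// csinE /qtheta (expiN (v / t)) invrK.
set E := expi (v / t); have En : E != 0 by exact: expi_neq0.
have -> : cexp (piC * iC * (v / t) - piC * iC * v * v / t) =
  cexp (- (piC * iC * v * v / t)) * (cexp (- (piC * iC * (v / t))) * E).
  by rewrite -!cexpD; congr cexp; ring.
move: (cexp _) (cexp _) (qinf _ _) (qinf _ _) (theta_cst s) => A B D F G.
by field; rewrite En iC_neq0.
Qed.

End Jacobi.

(** * The product of the four scalar factors *)

Section Normalization.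
Context {R : realType}.
Local Notation C := R[i].
Variables K K' lam : C.
Implicit Types u y z : C.
Local Notation tau := (par_tau K K').
Local Notation r := (par_r K' lam).
Local Notation p := (par_p K K').
Local Notation x := (par_x K lam).
Local Notation xp := (xpow K lam).
Hypothesis tau_gt0 : 0 < complex.Im tau.
Hypothesis x_lt1 : `|x| < 1.

Lemma K_neq0 : K != 0.
Proof. by apply: contraTneq tau_gt0 => ->; rewrite /par_tau mulr0 mul0r ltxx. Qed.
Lemma K'_neq0 : K' != 0.
Proof. by apply: contraTneq tau_gt0 => ->; rewrite /par_tau invr0 mulr0 ltxx. Qed.
Lemma lam_neq0 : lam != 0.
Proof.
apply: contraTneq x_lt1 => ->; rewrite /par_x mulr0 mul0r cexp0 normr1 ltxx//.
Qed.
Lemma r_neq0 : r != 0.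
Proof. by rewrite /par_r; apply: mulf_neq0; rewrite ?invr_eq0 ?K'_neq0 ?lam_neq0. Qed.

Let Kn := K_neq0.
Let K'n := K'_neq0.
Let ln := lam_neq0.
Let rn := r_neq0.

Lemma nrm_x : nrm x < 1.
Proof. by move: x_lt1; rewrite nrm_normr -(rmorph1 (real_complex R)) ltcR. Qed.

Lemma pE : p = expi (- tau^-1).
Proof.
rewrite /par_p /expi /par_tau; congr cexp; have i2 := @sqr_iC R.
by field: i2; rewrite Kn K'n iC_neq0.
Qed.

Lemma nrm_p : nrm p < 1.
Proof. by rewrite pE; apply: nrm_expi_lt1; exact: Im_opp_inv. Qed.

Lemma nrm_x4 : nrm (x ^+ 4) < 1.
Proof. by rewrite nrmX exprn_ilt1 ?nrm_ge0 ?nrm_x. Qed.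

Lemma xpowD u v : xp (u + v) = xp u * xp v.
Proof. by rewrite /xpow mulrDr cexpD. Qed.
Lemma xpow_neq0 u : xp u != 0.
Proof. exact: cexp_neq0. Qed.
Lemma xpow1 : xp 1 = x.
Proof. by rewrite /xpow mulr1. Qed.
Lemma xpow2S u : xp (2 * (u + 1)) = x ^+ 2 * xp (2 * u).
Proof.
have -> : 2 * (u + 1) = 1 + 1 + 2 * u by ring.
by rewrite !xpowD xpow1 expr2.
Qed.
Let xn : x != 0. Proof. exact: cexp_neq0. Qed.

Local Notation D y := (dqpoch y (x ^+ 4) p).

Lemma D_rec y : D y = D (y * x ^+ 4) * ((1 - y) * qinf p y).
Proof. exact: dqpoch_rec nrm_x4 nrm_p. Qed.

Lemma qtheta_split y : y != 0 ->
  (1 - y) * qinf p y * ((1 - p / y) * qinf p (p / y)) = qtheta p y.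
Proof.
by move=> y0; rewrite -(qinf_shift y^-1 nrm_p) /qtheta mulrA.
Qed.

Lemma qthetaV y : y != 0 -> qtheta p y^-1 = - y^-1 * qtheta p y.
Proof.
move=> y0; rewrite /qtheta invrK; move: (qinf _ _) (qinf _ _) => A B.
by field.
Qed.

(** Passing from u to u + 1 multiplies z by x^2. Four double products of the numerators cancel
    against the denominators; the other four face one whose argument differs by x^4, and
    [dqpoch_rec] turns each quotient into a simple product in p. The nonvanishing is recorded
    because the result divides by it. *)
Lemma R0_pair u : R0_den K K' lam (u + 1) != 0 -> R0_den K K' lam u != 0 ->
  qtheta p (xp (2 * u))^-1 != 0 /\
  R0_num K K' lam (u + 1) / R0_den K K' lam (u + 1) * (R0_num K K' lam u / R0_den K K' lam u)
  = qtheta p (x ^+ 2 * xp (2 * u)) / qtheta p (xp (2 * u))^-1.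
Proof.
rewrite /R0_num /R0_den xpow2S; set z := xp (2 * u).
have zn : z != 0 by exact: xpow_neq0.
have -> : p * x ^+ 2 * (x ^+ 2 * z) = p * z * x ^+ 4 by ring.
have -> : x ^+ 2 * (x ^+ 2 * z) = x ^+ 4 * z by ring.
have -> : x ^+ 4 / (x ^+ 2 * z) = x ^+ 2 / z by field; rewrite xn zn.
have -> : p * x ^+ 2 / (x ^+ 2 * z) = p / z by field; rewrite xn zn.
have -> : x ^+ 2 / (x ^+ 2 * z) = z^-1 by field; rewrite xn zn.
have -> : p * (x ^+ 2 * z) = p * x ^+ 2 * z by ring.
have -> : x ^+ 4 * (x ^+ 2 * z) = x ^+ 2 * z * x ^+ 4 by ring.
have -> : p * x ^+ 2 / z = p / (x ^+ 2 * z) * x ^+ 4 by field; rewrite xn zn.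
have -> : x ^+ 4 / z = z^-1 * x ^+ 4 by ring.
have yn : x ^+ 2 * z != 0 by rewrite mulf_neq0// expf_neq0.
have e1 := D_rec (x ^+ 2 * z); have e2 := D_rec z^-1.
have e3 := D_rec (p * z); have e4 := D_rec (p / (x ^+ 2 * z)).
rewrite -(qtheta_split yn) -(@qtheta_split z^-1) ?invr_eq0// invrK.
move: e1 e2 e3 e4.
move: (D (x ^+ 2 * z)) (D (x ^+ 2 * z * x ^+ 4)) ((1 - x ^+ 2 * z) * qinf p (x ^+ 2 * z)) => d1 d1' q1 e1.
move: (D z^-1) (D (z^-1 * x ^+ 4)) ((1 - z^-1) * qinf p z^-1) => d2 d2' q2 e2.
move: (D (p * z)) (D (p * z * x ^+ 4)) ((1 - p * z) * qinf p (p * z)) => d3 d3' q3 e3.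
move: (D (p / (x ^+ 2 * z))) (D (p / (x ^+ 2 * z) * x ^+ 4))
  ((1 - p / (x ^+ 2 * z)) * qinf p (p / (x ^+ 2 * z))) => d4 d4' q4 e4.
move: (D (p * x ^+ 2 * z)) (D (p / z)) (D (x ^+ 2 / z)) (D (x ^+ 4 * z)) => d5 d6 d7 d8.
rewrite e1 e2 e3 e4 !mulf_eq0 !negb_or -!andbA.
move=> /and5P[a1 a2 a3 a4 a5] /and5P[b1 b2 b3 b4 b5]; split.
  by rewrite a3 b4.
by field; rewrite a1 a2 a3 a4 a5 b1 b2 b3 b4 b5.
Qed.

Lemma jacobi_xpow u : jacobi tau (u / r) = theta_cst (- tau^-1) / (2 * iC) *
  (xp (- u + u * u / r) * qtheta p (xp (2 * u))).
Proof.
rewrite jacobiE// -pE; congr (_ * (_ * qtheta p _)).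
  have i2 := @sqr_iC R; rewrite /xpow /par_tau /par_r; congr cexp.
  by field: i2; rewrite Kn K'n ln iC_neq0.
have i2 := @sqr_iC R; rewrite /expi /xpow /par_tau /par_r; congr cexp.
by field: i2; rewrite Kn K'n ln iC_neq0.
Qed.

(** The power of x is the difference of the exponents -v + v^2 / r at v = u + 1 and v = u - 1. *)
Lemma br_ratio u : br K K' lam (u - 1) != 0 ->
  br K K' lam (u + 1) / br K K' lam (u - 1) =
  xp (4 * u / r - 2) * qtheta p (x ^+ 2 * xp (2 * u)) / qtheta p (x ^- 2 * xp (2 * u)) /\
  qtheta p (x ^- 2 * xp (2 * u)) != 0.
Proof.
rewrite /br; set c := xpow _ _ _ * _ * _ => h.
have : vtheta1 ((u - 1) / r) tau != 0 /\ c != 0.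
  by split; apply: contraNneq h => ->; rewrite ?mulr0 ?mul0r.
move=> [v0 c0]; have j0 := jacobi_neq0 tau_gt0 v0.
have := jacobi_prop tau_gt0 ((u + 1) / r) ((u - 1) / r).
move: j0; rewrite !jacobi_xpow; set cst := _ / _ => j0; clearbody cst.
have z1 : xp (2 * (u - 1)) = x ^- 2 * xp (2 * u).
  have -> : xp (2 * u) = xp (2 * (u - 1 + 1)) by rewrite subrK.
  by rewrite xpow2S mulrA mulVf ?mul1r// expf_neq0.
have E : xp (- (u + 1) + (u + 1) * (u + 1) / r) =
  xp (4 * u / r - 2) * xp (- (u - 1) + (u - 1) * (u - 1) / r).
  by rewrite -xpowD; congr (xpow _ _ _); field; exact: rn.
move: j0; rewrite xpow2S z1 E.
move: (xpow_neq0 (- (u - 1) + (u - 1) * (u - 1) / r)) v0.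
move: (xp (- (u - 1) + (u - 1) * (u - 1) / r)) (xp (4 * u / r - 2)) => e f.
move: (qtheta p (x ^+ 2 * xp (2 * u))) (qtheta p (x ^- 2 * xp (2 * u))) => q1 q2.
move: (vtheta1 ((u + 1) / r) tau) (vtheta1 ((u - 1) / r) tau) => v1 v2 en v2n.
rewrite !mulf_eq0 !negb_or => /andP[cn /andP[_ q2n]] hv; split=> //.
have hv' : v1 * q2 = v2 * f * q1.
  by apply: (mulfI cn); apply: (mulfI en);
    transitivity (v1 * (cst * (e * q2))); [ring | rewrite hv; ring].
have -> : c * v1 / (c * v2) = v1 * q2 / (v2 * q2) by field; rewrite c0 v2n q2n.
by rewrite hv'; field; rewrite v2n q2n.
Qed.

(** [R0_pair] at u and at u - 1 gives theta(x^2 z) theta(z) over theta(1 / z) theta(x^2 / z), with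
    theta = [qtheta p]. Inverting the two arguments by [qthetaV] cancels theta(z) and yields z^2 /
    x^2. *)
Lemma R0_prod u : R0_den K K' lam (u + 1) != 0 -> R0_den K K' lam u != 0 ->
  R0_den K K' lam (u - 1) != 0 -> br K K' lam (u - 1) != 0 ->
  R0 K K' lam (u + 1) * R0 K K' lam u * (R0 K K' lam u * R0 K K' lam (u - 1)) =
  br K K' lam (u + 1) / br K K' lam (u - 1).
Proof.
move=> d1 d0 dm hb; have [-> qn] := br_ratio hb.
have [q1n h1] := R0_pair d1 d0; have := @R0_pair (u - 1); rewrite subrK => /(_ d0 dm)[q2n h2].
have z1 : xp (2 * (u - 1)) = x ^- 2 * xp (2 * u).
  have -> : xp (2 * u) = xp (2 * (u - 1 + 1)) by rewrite subrK.
  by rewrite xpow2S mulrA mulVf ?mul1r// expf_neq0.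
(* The four prefactors multiply to x^{-4u + 4u / r}, and the z^2 coming from the inversions is
   x^{4u}. *)
have E : xp (2 * (u + 1) * - ((r - 1) / (2 * r))) * xp (2 * u * - ((r - 1) / (2 * r))) *
  (xp (2 * u * - ((r - 1) / (2 * r))) * xp (2 * (u - 1) * - ((r - 1) / (2 * r)))) *
  (xp (2 * u) * xp (2 * u)) = xp (4 * u / r).
  by rewrite -!xpowD; congr (xpow _ _ _); field; exact: rn.
have E2 : xp (4 * u / r - 2) * x ^+ 2 = xp (4 * u / r).
  rewrite expr2 -xpow1 -!xpowD; congr (xpow _ _ _); ring.
rewrite /R0; move: E; set e1 := xp (_ * - _); set e0 := xp (_ * - _); set em := xp (_ * - _) => E.
transitivity (e1 * e0 * (e0 * em) * ((R0_num K K' lam (u + 1) / R0_den K K' lam (u + 1) *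
  (R0_num K K' lam u / R0_den K K' lam u)) * (R0_num K K' lam u / R0_den K K' lam u *
  (R0_num K K' lam (u - 1) / R0_den K K' lam (u - 1))))); first by ring.
rewrite h1 h2; move: q1n q2n qn.
have zn : xp (2 * u) != 0 by exact: xpow_neq0.
have z1n : x ^- 2 * xp (2 * u) != 0 by rewrite -z1; exact: xpow_neq0.
rewrite z1 [x ^+ 2 * (x ^- 2 * _)]mulrA divff ?expf_neq0// mul1r.
rewrite !qthetaV//; move: E E2; move: (e1 * e0 * (e0 * em)) (xp (4 * u / r)) (xp (4 * u / r - 2)) => A B B' E E2.
move: (qtheta p (x ^+ 2 * xp (2 * u))) (qtheta p (x ^- 2 * xp (2 * u))) => Q1 Q2.
move: zn E; move: (xp (2 * u)) (qtheta p _) => z Q zn E.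
rewrite !mulf_eq0 !negb_or => /andP[_ Qn] /andP[_ Q2n] _.
have -> : B' = A * z * z / x ^+ 2.
  by rewrite -[A * z * z]mulrA E -E2; field; exact: xn.
by field; rewrite zn Qn Q2n xn.
Qed.

End Normalization.

(** * Fusion *)

Section TensorLegs.
Context {R : realType}.
Local Notation C := R[i].
Implicit Types (A B : 'M[C]_(2 * 2)).
Local Notation mi := mxtens_index.

Definition idx4 (a b c d : 'I_2) : 'I_(2 * 2 * (2 * 2)) := mi (mi (a, b), mi (c, d)).

Lemma sum_mxtens (m n : nat) (F : 'I_(m * n) -> C) :
  \sum_s F s = \sum_i \sum_j F (mi (i, j)).
Proof.
rewrite pair_big /= (reindex (@mxtens_index m n)) /=.
  by apply: eq_bigr => -[i j] _.
by exists (@mxtens_unindex m n) => x _; rewrite ?mxtens_indexK ?mxtens_unindexK.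
Qed.

Lemma sum_idx4 (F : 'I_(2 * 2 * (2 * 2)) -> C) :
  \sum_s F s = \sum_a \sum_b \sum_c \sum_d F (idx4 a b c d).
Proof.
rewrite sum_mxtens sum_mxtens; apply: eq_bigr => a _; apply: eq_bigr => b _.
by rewrite sum_mxtens.
Qed.

Lemma f1E : f1 = @Ordinal 4 0 isT. Proof. by apply/val_inj; rewrite /f1 /= inordK. Qed.
Lemma f2E : f2 = @Ordinal 4 1 isT. Proof. by apply/val_inj; rewrite /f2 /= inordK. Qed.
Lemma fb1E : fb1 = @Ordinal 4 2 isT. Proof. by apply/val_inj; rewrite /fb1 /= inordK. Qed.
Lemma fb2E : fb2 = @Ordinal 4 3 isT. Proof. by apply/val_inj; rewrite /fb2 /= inordK. Qed.

Lemma forall_ord4 (P : pred 'I_4) : [forall k, P k] =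
  [&& P (@Ordinal 4 0 isT), P (@Ordinal 4 1 isT), P (@Ordinal 4 2 isT) & P (@Ordinal 4 3 isT)].
Proof.
apply/forallP/and4P => [h|[h0 h1 h2 h3]]; first by split.
by case=> [[|[|[|[|//]]]] ik]; rewrite (bool_irrelevance ik isT).
Qed.

Lemma leg_idx4 a b c d (k : 'I_4) : leg (idx4 a b c d) k = nth a [:: a; b; c; d] k.
Proof. by rewrite /leg /idx4 !mxtens_indexK. Qed.

Lemma on2_12 A a b c d a' b' c' d' :
  on2 f1 f2 A (idx4 a b c d) (idx4 a' b' c' d') =
  A (mi (a, b)) (mi (a', b')) *+ ((c == c') && (d == d')).
Proof. by rewrite mxE forall_ord4 !leg_idx4 f1E f2E /= ?andbT. Qed.

Lemma on2_b1b2 A a b c d a' b' c' d' :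
  on2 fb1 fb2 A (idx4 a b c d) (idx4 a' b' c' d') =
  A (mi (c, d)) (mi (c', d')) *+ ((a == a') && (b == b')).
Proof. by rewrite mxE forall_ord4 !leg_idx4 fb1E fb2E /= ?andbT. Qed.

Lemma on2_1b1 A a b c d a' b' c' d' :
  on2 f1 fb1 A (idx4 a b c d) (idx4 a' b' c' d') =
  A (mi (a, c)) (mi (a', c')) *+ ((b == b') && (d == d')).
Proof. by rewrite mxE forall_ord4 !leg_idx4 f1E fb1E /= ?andbT. Qed.

Lemma on2_2b1 A a b c d a' b' c' d' :
  on2 f2 fb1 A (idx4 a b c d) (idx4 a' b' c' d') =
  A (mi (b, c)) (mi (b', c')) *+ ((a == a') && (d == d')).
Proof. by rewrite mxE forall_ord4 !leg_idx4 f2E fb1E /= ?andbT. Qed.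

Lemma on2_1b2 A a b c d a' b' c' d' :
  on2 f1 fb2 A (idx4 a b c d) (idx4 a' b' c' d') =
  A (mi (a, d)) (mi (a', d')) *+ ((b == b') && (c == c')).
Proof. by rewrite mxE forall_ord4 !leg_idx4 f1E fb2E /= ?andbT. Qed.

Lemma on2_2b2 A a b c d a' b' c' d' :
  on2 f2 fb2 A (idx4 a b c d) (idx4 a' b' c' d') =
  A (mi (b, d)) (mi (b', d')) *+ ((a == a') && (c == c')).
Proof. by rewrite mxE forall_ord4 !leg_idx4 f2E fb2E /= ?andbT. Qed.

Lemma idx4P (s : 'I_(2 * 2 * (2 * 2))) : exists a b c d, s = idx4 a b c d.
Proof.
case: (mxtens_indexP s) => i j; case: (mxtens_indexP i) => a b.
by case: (mxtens_indexP j) => c d; exists a, b, c, d.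
Qed.

Lemma mi_eq (m n : nat) (i i' : 'I_m) (j j' : 'I_n) :
  (mi (i, j) == mi (i', j')) = (i == i') && (j == j').
Proof. by rewrite (can_eq (@mxtens_indexK m n)) xpair_eqE. Qed.

Lemma on2_tensl A : on2 f1 f2 A = A *t 1%:M.
Proof.
apply/matrixP => s t; have [a [b [c [d ->]]]] := idx4P s.
have [a' [b' [c' [d' ->]]]] := idx4P t.
by rewrite on2_12 /idx4 tensmxE [in RHS]mxE mi_eq mulr_natr.
Qed.

Lemma on2_tensr A : on2 fb1 fb2 A = 1%:M *t A.
Proof.
apply/matrixP => s t; have [a [b [c [d ->]]]] := idx4P s.
have [a' [b' [c' [d' ->]]]] := idx4P t.
by rewrite on2_b1b2 /idx4 tensmxE [in RHS]mxE mi_eq mulr_natl.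
Qed.

Lemma sum_delta (T : finType) (F : T -> C) (y : T) :
  (forall x, x != y -> F x = 0) -> \sum_x F x = F y.
Proof. by move=> h; rewrite (bigD1 y)//= big1 ?addr0. Qed.

(** Both operators meet the factor b2, so only its intermediate state l is summed; the factor b1 is
    a spectator. *)
Lemma on2_mul_b2 A B a b c d a' b' c' d' :
  (on2 f1 fb2 A *m on2 f2 fb2 B) (idx4 a b c d) (idx4 a' b' c' d') =
  (\sum_l A (mi (a, d)) (mi (a', l)) * B (mi (b, l)) (mi (b', d'))) *+ (c == c').
Proof.
rewrite mxE sum_idx4 (sum_delta (y := a')); last first.
  move=> x /negPf xa; apply: big1 => ? _; apply: big1 => ? _; apply: big1 => ? _.
  by rewrite on2_2b2 xa mulr0.
rewrite (sum_delta (y := b)); last first.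
  move=> x /negPf xa; apply: big1 => ? _; apply: big1 => ? _.
  by rewrite on2_1b2 eq_sym xa mul0r.
rewrite (sum_delta (y := c)); last first.
  by move=> x /negPf xa; apply: big1 => ? _; rewrite on2_1b2 andbC eq_sym xa mul0r.
rewrite -sumrMnl; apply: eq_bigr => l _.
by rewrite on2_1b2 on2_2b2 !eqxx /= mulrnAr.
Qed.

Lemma on2_mul_b1 A B a b c d a' b' c' d' :
  (on2 f1 fb1 A *m on2 f2 fb1 B) (idx4 a b c d) (idx4 a' b' c' d') =
  (\sum_l A (mi (a, c)) (mi (a', l)) * B (mi (b, l)) (mi (b', c'))) *+ (d == d').
Proof.
rewrite mxE sum_idx4 (sum_delta (y := a')); last first.
  move=> x /negPf xa; apply: big1 => ? _; apply: big1 => ? _; apply: big1 => ? _.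
  by rewrite on2_2b1 xa mulr0.
rewrite (sum_delta (y := b)); last first.
  move=> x /negPf xa; apply: big1 => ? _; apply: big1 => ? _.
  by rewrite on2_1b1 eq_sym xa mul0r.
rewrite -sumrMnl; apply: eq_bigr => l _; rewrite (sum_delta (y := d)); last first.
  by move=> x /negPf xa; rewrite on2_1b1 andbC eq_sym xa mul0r.
by rewrite on2_1b1 on2_2b1 !eqxx /= mulrnAr.
Qed.

Section Fused.
Variables (K : 'M[C]_(3, 2 * 2)) (J : 'M[C]_(2 * 2, 3)).

(** The once-fused weight on V^(2) (x) V: k, k' are states of the symmetric pair in the bases given
    by [K] and [J], and l, l' are states of the barred factor; unprimed indices are outputs. *)
Definition fused A B (k : 'I_3) (l : 'I_2) (k' : 'I_3) (l' : 'I_2) : C :=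
  \sum_a' \sum_b' (\sum_a \sum_b K k (mi (a, b)) *
    (\sum_l2 A (mi (a, l)) (mi (a', l2)) * B (mi (b, l2)) (mi (b', l')))) * J (mi (a', b')) k'.

(** The b1 state c' passes through unchanged, so the coordinates [K] on the barred pair meet a
    single fused weight. [fused_right] is the mirror image, with b2 as spectator. *)
Lemma fused_left A B k m k2 c' d' :
  ((K *t K) *m (on2 f1 fb2 A *m on2 f2 fb2 B) *m (J *t 1%:M)) (mi (k, m)) (mi (k2, mi (c', d'))) =
  \sum_d K m (mi (c', d)) * fused A B k d k2 d'.
Proof.
rewrite mxE sum_idx4; under eq_bigr => a' _ do under eq_bigr => b' _ do (
  rewrite (sum_delta (y := c')); last by
    (move=> x /negPf xc; apply: big1 => ? _; rewrite /idx4 tensmxE [X in _ * (_ * X)]mxE mi_eq xc !mulr0)).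
under eq_bigr => a' _ do under eq_bigr => b' _ do (
  rewrite (sum_delta (y := d')); last by
    (move=> x /negPf xc; rewrite /idx4 tensmxE [X in _ * (_ * X)]mxE mi_eq xc andbF !mulr0)).
under [RHS]eq_bigr => d _ do rewrite /fused mulr_sumr.
rewrite [RHS]exchange_big /=; apply: eq_bigr => a' _.
under [RHS]eq_bigr => d _ do rewrite mulr_sumr.
rewrite [RHS]exchange_big /=; apply: eq_bigr => b' _.
rewrite /idx4 tensmxE [X in _ * (_ * X)]mxE eqxx mulr1.
under [RHS]eq_bigr => d _ do rewrite mulrA.
rewrite -mulr_suml; congr (_ * _); rewrite mxE sum_idx4.
under [RHS]eq_bigr => d _ do rewrite mulr_sumr.
rewrite [RHS]exchange_big /=; apply: eq_bigr => a _.
under [RHS]eq_bigr => d _ do rewrite mulr_sumr.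
rewrite [RHS]exchange_big /=; apply: eq_bigr => b _.
rewrite (sum_delta (y := c')); last first.
  by move=> x /negPf xc; apply: big1 => ? _; rewrite on2_mul_b2 xc mulr0.
apply: eq_bigr => d _; rewrite on2_mul_b2 eqxx /= /idx4 tensmxE; ring.
Qed.

Lemma fused_right A B k' m' k2 c' d' :
  ((K *t 1%:M) *m (on2 f1 fb1 A *m on2 f2 fb1 B) *m (J *t J)) (mi (k2, mi (c', d'))) (mi (k', m')) =
  \sum_c fused A B k2 c' k' c * J (mi (c, d')) m'.
Proof.
rewrite mxE sum_idx4.
under [RHS]eq_bigr => d _ do rewrite /fused mulr_suml.
rewrite [RHS]exchange_big /=; apply: eq_bigr => a' _.
under [RHS]eq_bigr => d _ do rewrite mulr_suml.
rewrite [RHS]exchange_big /=; apply: eq_bigr => b' _.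
apply: eq_bigr => c _; rewrite (sum_delta (y := d')); last first.
  move=> x /negPf xd; rewrite mxE sum_idx4 big1 ?mul0r// => a _.
  apply: big1 => b _; apply: big1 => c2 _; apply: big1 => d2 _.
  rewrite on2_mul_b1; case: eqP => [->|_]; last by rewrite mulr0.
  by rewrite /idx4 tensmxE [X in _ * X * _]mxE mi_eq eq_sym [in X in X && _]eq_sym andbC eq_sym xd mulr0 mul0r.
rewrite {2}/idx4 tensmxE mulrA; congr (_ * _ * _); rewrite mxE sum_idx4.
apply: eq_bigr => a _; apply: eq_bigr => b _.
rewrite (sum_delta (y := c')); last first.
  move=> x /negPf xc; apply: big1 => ? _.
  by rewrite /idx4 tensmxE [X in _ * X * _]mxE mi_eq eq_sym xc mulr0 mul0r.
rewrite (sum_delta (y := d')); last first.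
  move=> x /negPf xc.
  by rewrite /idx4 tensmxE [X in _ * X * _]mxE mi_eq andbC eq_sym xc mulr0 mul0r.
by rewrite on2_mul_b1 eqxx /= /idx4 tensmxE [X in _ * X * _]mxE eqxx mulr1.
Qed.

End Fused.
End TensorLegs.

(** * Tables of fused weights *)

Section Tables.
Context {R : realType}.
Local Notation C := R[i].
Local Notation mi := mxtens_index.
(** [h] stands for 1 / sqrt 2 and is known only through [hh]; replacing 1 / 2 by [h * h] makes the
    table entries polynomial identities for [ring]. *)
Variable h : C.
Hypothesis hh : 2 * h * h = 1.

Lemma sum2 (F : 'I_2 -> C) : \sum_i F i = F (Ordinal (isT : (0 < 2)%N)) + F (Ordinal (isT : (1 < 2)%N)).
Proof.
by rewrite !big_ord_recl big_ord0 addr0; congr (F _ + F _); apply/val_inj.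
Qed.

Lemma sum3 (F : 'I_3 -> C) : \sum_i F i = F (Ordinal (isT : (0 < 3)%N)) +
  (F (Ordinal (isT : (1 < 3)%N)) + F (Ordinal (isT : (2 < 3)%N))).
Proof.
by rewrite !big_ord_recl big_ord0 addr0; congr (F _ + (F _ + F _)); apply/val_inj.
Qed.

(* The rows are the coordinates, and the columns the vectors, of the basis (v_2 + v_-2)/sqrt 2, v_0, (v_2 - v_-2)/sqrt 2 of the symmetric tensors. *)
Definition Kmx : 'M[C]_(3, 2 * 2) := mx_of_rows _ _
  [:: [:: h; 0; 0; h]; [:: 0; 1; 1; 0]; [:: h; 0; 0; - h]].
Definition Jmx : 'M[C]_(2 * 2, 3) := mx_of_rows _ _
  [:: [:: h; 0; h]; [:: 0; 2^-1; 0]; [:: 0; 2^-1; 0]; [:: h; 0; - h]].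
Definition wmx (a b c d : C) : 'M[C]_(2 * 2) := mx_of_rows _ _
  [:: [:: a; 0; 0; d]; [:: 0; b; c; 0]; [:: 0; c; b; 0]; [:: d; 0; 0; a]].

(** Tables indexed by natural numbers compute by [cbv] once the ordinals have been destructed,
    unlike matrices indexed through [mxtens_index]. *)
Definition tab3 (s : seq (seq (seq C))) (i j k : nat) : C :=
  nth 0 (nth [::] (nth [::] s i) j) k.
Definition tab4 (s : seq (seq (seq (seq C)))) (i j k l : nat) : C :=
  nth 0 (nth [::] (nth [::] (nth [::] s i) j) k) l.

Definition Kf := tab3 [:: [:: [:: h; 0]; [:: 0; h]]; [:: [:: 0; 1]; [:: 1; 0]];
  [:: [:: h; 0]; [:: 0; - h]]].
Definition Jf := tab3 [:: [:: [:: h; 0; h]; [:: 0; 2^-1; 0]];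
  [:: [:: 0; 2^-1; 0]; [:: h; 0; - h]]].
Definition wf (a b c d : C) := tab4
  [:: [:: [:: [:: a; 0]; [:: 0; d]]; [:: [:: 0; b]; [:: c; 0]]];
      [:: [:: [:: 0; c]; [:: b; 0]]; [:: [:: d; 0]; [:: 0; a]]]].

Lemma KmxE (k : 'I_3) (a b : 'I_2) : Kmx k (mi (a, b)) = Kf k a b.
Proof.
by rewrite mxE; case: k => [[|[|[|//]]] ?]; case: a => [[|[|//]] ?]; case: b => [[|[|//]] ?].
Qed.
Lemma JmxE (k : 'I_3) (a b : 'I_2) : Jmx (mi (a, b)) k = Jf a b k.
Proof.
by rewrite mxE; case: k => [[|[|[|//]]] ?]; case: a => [[|[|//]] ?]; case: b => [[|[|//]] ?].
Qed.
Lemma wmxE a b c d (i j i' j' : 'I_2) : wmx a b c d (mi (i, j)) (mi (i', j')) = wf a b c d i j i' j'.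
Proof.
by rewrite mxE; case: i => [[|[|//]] ?]; case: j => [[|[|//]] ?];
  case: i' => [[|[|//]] ?]; case: j' => [[|[|//]] ?].
Qed.

(* Indexed by k, l, k', l' with k, k' in the basis of Kmx and l, l' in that of V. *)
Definition gtab (g00 g01 g02 g10 g11 g12 g20 g21 g22 : C) := tab4
  [:: [:: [:: [:: g00; 0]; [:: 0; g01]; [:: g02; 0]];
          [:: [:: 0; g00]; [:: g01; 0]; [:: 0; - g02]]];
      [:: [:: [:: 0; g10]; [:: g11; 0]; [:: 0; g12]];
          [:: [:: g10; 0]; [:: 0; g11]; [:: - g12; 0]]];
      [:: [:: [:: g20; 0]; [:: 0; g21]; [:: g22; 0]];
          [:: [:: 0; - g20]; [:: - g21; 0]; [:: 0; g22]]]].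

(** Exchanging v_+ and v_- everywhere commutes with the weights, fixes the first two basis vectors
    and negates the third. Hence the rows with l = 1 repeat those with l = 0 up to sign, and nine
    weights fill the table. *)
Lemma fused_wmx a' b' c' d' a b c d (k : 'I_3) (l : 'I_2) (k' : 'I_3) (l' : 'I_2) :
  fused Kmx Jmx (wmx a' b' c' d') (wmx a b c d) k l k' l' =
  gtab ((a * a' + b * b' + c * d' + c' * d) / 2)
       (h * ((a * c' + a' * d + b * d' + b' * c) / 2))
       ((a * a' - b * b' - c * d' + c' * d) / 2)
       (h * (a * d' + a' * c + b * c' + b' * d))
       ((a * b' + a' * b + c * c' + d * d') / 2)
       (h * (a' * c - a * d' + b * c' - b' * d))
       ((a * a' - b * b' + c * d' - c' * d) / 2)
       (h * ((a' * d - a * c' + b * d' - b' * c) / 2))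
       ((a * a' + b * b' - c * d' - c' * d) / 2) k l k' l'.
Proof.
have n2 : 2 != 0 :> C by rewrite pnatr_eq0.
have e2 : 2^-1 = h * h by apply: (mulfI n2); rewrite divff// mulrA hh.
rewrite /fused !sum2 !KmxE !JmxE !wmxE.
case: k => [[|[|[|//]]] ?]; case: l => [[|[|//]] ?]; case: k' => [[|[|[|//]]] ?];
  case: l' => [[|[|//]] ?];
cbv [gtab Kf Jf wf tab3 tab4 nth nat_of_ord]; rewrite ?e2; ring.
Qed.

Variables g00 g01 g02 g10 g11 g12 g20 g21 g22 : C.
Variables f00 f01 f02 f10 f11 f12 f20 f21 f22 : C.
Let G := gtab g00 (h * g01) g02 (h * g10) g11 (h * g12) g20 (h * g21) g22.
Let F := gtab f00 (h * f01) f02 (h * f10) f11 (h * f12) f20 (h * f21) f22.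

(* Indices (i, j), (k, l) as in the 9 x 9 matrices of the 21-vertex model. *)
Definition wtab := tab4
  [:: [:: [:: [:: g00 * f00 + 2^-1 * (g01 * f10) + g02 * f20; 0; 0];
              [:: 0; 2^-1 * (g00 * f01 + g01 * f11 + g02 * f21); 0];
              [:: 0; 0; g00 * f02 - 2^-1 * (g01 * f12) + g02 * f22]];
          [:: [:: 0; g00 * f00 + 2^-1 * (g01 * f10) - g02 * f20; 0];
              [:: g00 * f01 + g01 * f11 - g02 * f21; 0; 0];
              [:: 0; 0; 0]];
          [:: [:: 0; 0; g00 * f00 - 2^-1 * (g01 * f10) + g02 * f20];
              [:: 0; 0; 0];
              [:: g00 * f02 + 2^-1 * (g01 * f12) + g02 * f22; 0; 0]]];
      [:: [:: [:: 0; 2^-1 * (g10 * f00 + g11 * f10 + g12 * f20); 0];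
              [:: 2^-1 * (g10 * f01) + g11 * f11 + 2^-1 * (g12 * f21); 0; 0];
              [:: 0; 0; 0]];
          [:: [:: g10 * f00 + g11 * f10 - g12 * f20; 0; 0];
              [:: 0; 2^-1 * (g10 * f01) + g11 * f11 - 2^-1 * (g12 * f21); 0];
              [:: 0; 0; g10 * f02 - g11 * f12 - g12 * f22]];
          [:: [:: 0; 0; 0];
              [:: 0; 0; g11 * f11 - 2^-1 * (g10 * f01) - 2^-1 * (g12 * f21)];
              [:: 0; 2^-1 * (g10 * f02 + g11 * f12 + g12 * f22); 0]]];
      [:: [:: [:: 0; 0; g20 * f00 - 2^-1 * (g21 * f10) + g22 * f20];
              [:: 0; 0; 0];
              [:: g20 * f02 + 2^-1 * (g21 * f12) + g22 * f22; 0; 0]];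
          [:: [:: 0; 0; 0];
              [:: 0; 0; g20 * f01 - g21 * f11 - g22 * f21];
              [:: 0; g22 * f22 - g20 * f02 - 2^-1 * (g21 * f12); 0]];
          [:: [:: g20 * f00 + 2^-1 * (g21 * f10) + g22 * f20; 0; 0];
              [:: 0; 2^-1 * (g20 * f01 + g21 * f11 + g22 * f21); 0];
              [:: 0; 0; g20 * f02 - 2^-1 * (g21 * f12) + g22 * f22]]]].

Lemma wtabE (k m k' m' : 'I_3) :
  \sum_(k2 < 3) \sum_(c' < 2) \sum_(d' < 2)
    (\sum_(d < 2) Kf m c' d * G k d k2 d') * (\sum_(c < 2) F k2 c' k' c * Jf c d' m')
  = wtab k m k' m'.
Proof.
have n2 : 2 != 0 :> C by rewrite pnatr_eq0.
have e2 : 2^-1 = h * h by apply: (mulfI n2); rewrite divff// mulrA hh.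
rewrite sum3 !sum2.
case: k => [[|[|[|//]]] ?]; case: m => [[|[|[|//]]] ?]; case: k' => [[|[|[|//]]] ?];
  case: m' => [[|[|[|//]]] ?];
cbv [G F gtab Kf Jf wtab tab3 tab4 nth nat_of_ord]; rewrite ?e2;
(* If the two sides have different degrees in [h], one of them is first multiplied by 1 = 2 h h. *)
first [by ring | by rewrite -[RHS]mul1r -[in RHS]hh; ring | by rewrite -[LHS]mul1r -[in LHS]hh; ring].
Qed.

End Tables.

(** * Factorization of the fused matrix through the symmetric tensors *)

Section GaugeTransform.
Context {R : realType}.
Local Notation C := R[i].
Local Notation mi := mxtens_index.
Let h : C := (sqrtC 2)^-1.

Lemma sqrt2_inv : 2 * h * h = 1.
Proof.
have n2 : (2 : C) != 0 by rewrite pnatr_eq0.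
by rewrite -mulrA -expr2 /h exprVn sqrtCK divff.
Qed.

Definition Hmx : 'M[C]_3 := mx_of_rows 3 3 [:: [:: h; 0; h]; [:: 0; 1; 0]; [:: h; 0; - h]].

Lemma Hmx_sqr : Hmx *m Hmx = 1%:M.
Proof.
have hh := sqrt2_inv; apply/matrixP => i j; rewrite mxE sum3 !mxE.
case: i => [[|[|[|//]]] ?]; case: j => [[|[|[|//]]] ?];
rewrite /= ?(mulr0, mul0r, addr0, add0r, mulr1, mulrN, mulNr, opprK, subrr)//;
by rewrite -[RHS]hh; ring.
Qed.

Lemma Hmx_coord : Hmx *m sym_coord = Kmx h.
Proof.
apply/matrixP => i j; rewrite mxE sum3 !mxE.
by case: i => [[|[|[|//]]] ?]; case: j => [[|[|[|[|//]]]] ?];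
rewrite /= ?(mulr0, mul0r, addr0, add0r, mulr1).
Qed.

Lemma incl_Hmx : sym_incl *m Hmx = Jmx h.
Proof.
apply/matrixP => i j; rewrite mxE sum3 !mxE.
by case: i => [[|[|[|[|//]]]] ?]; case: j => [[|[|[|//]]] ?];
rewrite /= ?(mulr0, mul0r, addr0, add0r, mulr1, mul1r).
Qed.

Lemma symprojE (a b a' b' : 'I_2) : symproj (mi (a, b)) (mi (a', b')) =
  2^-1 * (((a == b') && (b == a'))%:R + ((a == a') && (b == b'))%:R) :> C.
Proof. by rewrite !mxE !mxtens_indexK xpair_eqE mi_eq. Qed.

Lemma symproj_coord : sym_coord *m symproj = sym_coord :> 'M[C]_(3, 2 * 2).
Proof.
apply/matrixP => i j; case: (mxtens_indexP j) => a b.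
rewrite mxE sum_mxtens !sum2 !symprojE !mxE -!val_eqE.
case: i => [[|[|[|//]]] ?]; case: a => [[|[|//]] ?]; case: b => [[|[|//]] ?];
by rewrite /=; field.
Qed.

Lemma incl_coord : sym_incl *m sym_coord = symproj :> 'M[C]_(2 * 2).
Proof.
apply/matrixP => i j; case: (mxtens_indexP i) => a b; case: (mxtens_indexP j) => a' b'.
rewrite symprojE mxE sum3 !mxE -!val_eqE.
case: a => [[|[|//]] ?]; case: b => [[|[|//]] ?]; case: a' => [[|[|//]] ?];
  case: b' => [[|[|//]] ?];
by rewrite /=; field.
Qed.

Lemma JKmx : Jmx h *m Kmx h = symproj.
Proof.
by rewrite -incl_Hmx -Hmx_coord -mulmxA [Hmx *m _]mulmxA Hmx_sqr mul1mx incl_coord.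
Qed.

Lemma Kmx_symproj : Kmx h *m symproj = Kmx h.
Proof. by rewrite -Hmx_coord -mulmxA symproj_coord. Qed.

(** The projector between the two copies of [R21] factors as [Jmx] times [Kmx], which cuts the
    product of four R-matrices into two independent fused halves; the outer projectors are absorbed
    by the coordinates. *)
Lemma R22_Hmx (K K' lam u : C) :
  (Hmx *t Hmx) *m R22 K K' lam u *m (Hmx *t Hmx) =
  ((Kmx h *t Kmx h) *m (on2 f1 fb2 (Rbaxter K K' lam (u + 1)) *m on2 f2 fb2 (Rbaxter K K' lam u))
    *m (Jmx h *t 1%:M)) *m
  ((Kmx h *t 1%:M) *m (on2 f1 fb1 (Rbaxter K K' lam u) *m on2 f2 fb1 (Rbaxter K K' lam (u - 1)))
    *m (Jmx h *t Jmx h)).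
Proof.
rewrite /R22 /R22_full /R21 subrK on2_tensl on2_tensr.
set A := on2 f1 fb2 _; set B := on2 f2 fb2 _; set A' := on2 f1 fb1 _; set B' := on2 f2 fb1 _.
have KK : (Kmx h *t Kmx h) *m (1%:M *t symproj *m (symproj *t 1%:M)) = Kmx h *t Kmx h.
  by rewrite !tensmx_mul mulmx1 mul1mx !Kmx_symproj.
have JK : symproj *t 1%:M = (Jmx h *t 1%:M) *m (Kmx h *t 1%:M) :> 'M[C]_(2 * 2 * (2 * 2)).
  by rewrite tensmx_mul mulmx1 JKmx.
have HC : (Hmx *t Hmx) *m (sym_coord *t sym_coord) = Kmx h *t Kmx h.
  by rewrite tensmx_mul Hmx_coord.
have IH : (sym_incl *t sym_incl) *m (Hmx *t Hmx) = Jmx h *t Jmx h.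
  by rewrite tensmx_mul incl_Hmx.
move: KK JK HC IH; move: (Hmx *t Hmx) (sym_coord *t sym_coord) (sym_incl *t sym_incl)
  (1%:M *t symproj) (symproj *t 1%:M) (Kmx h *t Kmx h) (Jmx h *t 1%:M) (Kmx h *t 1%:M) (Jmx h *t Jmx h).
move=> HH CC II P2 P1 K2 J1 K1 J2 KK JK HC IH; rewrite -IH -{1}KK -HC.
transitivity (HH *m CC *m (P2 *m P1) *m (A *m B) *m P1 *m (A' *m B') *m (II *m HH)).
  by rewrite !mulmxA.
by rewrite {2}JK !mulmxA.
Qed.

Lemma RbaxterE (K K' lam u : C) : Rbaxter K K' lam u =
  wmx (R0 K K' lam u * wa K K' lam u) (R0 K K' lam u * wb K K' lam u)
      (R0 K K' lam u * wc K K' lam u) (R0 K K' lam u * wd K K' lam u).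
Proof.
apply/matrixP => i j; rewrite !mxE.
by case: i => [[|[|[|[|//]]]] ?]; case: j => [[|[|[|[|//]]]] ?]; rewrite /= ?mulr0.
Qed.

(** The suffixes 3, 2, 1 refer to the weights at u + 1, u, u - 1. The first nine arguments are the
    fused weights on the factor b2, the last nine those on b1, with the factors [h] removed. *)
Definition weight_wtab (a3 b3 c3 d3 a2 b2 c2 d2 a1 b1 c1 d1 : C) :=
  wtab
    ((a2 * a3 + b2 * b3 + c2 * d3 + c3 * d2) / 2)
    ((a2 * c3 + a3 * d2 + b2 * d3 + b3 * c2) / 2)
    ((a2 * a3 - b2 * b3 - c2 * d3 + c3 * d2) / 2)
    (a2 * d3 + a3 * c2 + b2 * c3 + b3 * d2)
    ((a2 * b3 + a3 * b2 + c2 * c3 + d2 * d3) / 2)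
    (a3 * c2 - a2 * d3 + b2 * c3 - b3 * d2)
    ((a2 * a3 - b2 * b3 + c2 * d3 - c3 * d2) / 2)
    ((a3 * d2 - a2 * c3 + b2 * d3 - b3 * c2) / 2)
    ((a2 * a3 + b2 * b3 - c2 * d3 - c3 * d2) / 2)
    ((a1 * a2 + b1 * b2 + c1 * d2 + c2 * d1) / 2)
    ((a1 * c2 + a2 * d1 + b1 * d2 + b2 * c1) / 2)
    ((a1 * a2 - b1 * b2 - c1 * d2 + c2 * d1) / 2)
    (a1 * d2 + a2 * c1 + b1 * c2 + b2 * d1)
    ((a1 * b2 + a2 * b1 + c1 * c2 + d1 * d2) / 2)
    (a2 * c1 - a1 * d2 + b1 * c2 - b2 * d1)
    ((a1 * a2 - b1 * b2 + c1 * d2 - c2 * d1) / 2)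
    ((a2 * d1 - a1 * c2 + b1 * d2 - b2 * c1) / 2)
    ((a1 * a2 + b1 * b2 - c1 * d2 - c2 * d1) / 2).

Lemma R22_entries a3 b3 c3 d3 a2 b2 c2 d2 a1 b1 c1 d1 (k m k' m' : 'I_3) :
  (((Kmx h *t Kmx h) *m (on2 f1 fb2 (wmx a3 b3 c3 d3) *m on2 f2 fb2 (wmx a2 b2 c2 d2))
    *m (Jmx h *t 1%:M)) *m
  ((Kmx h *t 1%:M) *m (on2 f1 fb1 (wmx a2 b2 c2 d2) *m on2 f2 fb1 (wmx a1 b1 c1 d1))
    *m (Jmx h *t Jmx h))) (mi (k, m)) (mi (k', m')) =
  weight_wtab a3 b3 c3 d3 a2 b2 c2 d2 a1 b1 c1 d1 k m k' m'.
Proof.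
rewrite mxE sum_mxtens /weight_wtab -(wtabE sqrt2_inv); apply: eq_bigr => k2 _.
rewrite sum_mxtens; apply: eq_bigr => c' _; apply: eq_bigr => d' _.
rewrite fused_left fused_right; congr (_ * _); apply: eq_bigr => l _.
  by rewrite KmxE (fused_wmx sqrt2_inv).
by rewrite JmxE (fused_wmx sqrt2_inv).
Qed.

End GaugeTransform.

(** * The vertex-type identity *)

Section Vertex.
Context {R : realType}.
Local Notation C := R[i].
Variables (al be S T d xi eta : C).
Let P := be ^+ 2 + al ^+ 2.
Let Q := be ^+ 2 - al ^+ 2.
Let m := al * be.
Let NS := be ^+ 2 - S ^+ 2 * al ^+ 2.
Let NT := be ^+ 2 - T ^+ 2 * al ^+ 2.
Let e X : C := (1 - X ^+ 2) / X.
Let f X : C := (1 + X ^+ 2) / X.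
Let DS := T * NS / S - d.
Let DT := d - S * NT / T.
Hypothesis S0 : S != 0.
Hypothesis T0 : T != 0.
Hypothesis hd : 2 * S * T * d =
  (S ^+ 2 + T ^+ 2) * be ^+ 2 - al ^+ 2 - al ^+ 2 * S ^+ 2 * T ^+ 2.
Hypothesis d0 : d != 0.
Hypothesis Q0 : Q != 0.
Hypothesis hxi : xi ^+ 2 = - P / (2 * d).
Hypothesis heta : eta ^+ 2 = - P / Q.

Definition ftab (s1 s2 s3 t0 t a r mu RR nu q rho : C) := tab4
  [:: [:: [:: [:: s1; 0; 0]; [:: 0; mu; 0]; [:: 0; 0; nu]];
          [:: [:: 0; t; 0]; [:: r; 0; 0]; [:: 0; 0; 0]];
          [:: [:: 0; 0; t0]; [:: 0; 0; 0]; [:: RR; 0; 0]]];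
      [:: [:: [:: 0; r; 0]; [:: t; 0; 0]; [:: 0; 0; 0]];
          [:: [:: mu; 0; 0]; [:: 0; s2; 0]; [:: 0; 0; rho]];
          [:: [:: 0; 0; 0]; [:: 0; 0; a]; [:: 0; q; 0]]];
      [:: [:: [:: 0; 0; RR]; [:: 0; 0; 0]; [:: t0; 0; 0]];
          [:: [:: 0; 0; 0]; [:: 0; 0; q]; [:: 0; a; 0]];
          [:: [:: nu; 0; 0]; [:: 0; rho; 0]; [:: 0; 0; s3]]]].

(* The common denominator of the entries of Fateev's matrix, which appear below multiplied by it. *)
Let d2 := d ^+ 2 * Q ^+ 2 + (d ^+ 2 - Q ^+ 2) * P ^+ 2.
Let cn2 := (P * Q) ^+ 2 - 4 * m ^+ 2 * d ^+ 2.
Let dn2 := (P * Q) ^+ 2 + 4 * m ^+ 2 * d ^+ 2.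
Let M := 2 * P * Q.
Let ka := M * DS * DT.

(** By the zero pattern, the gauge factors of (i, j) and (k, l) differ in each nonzero entry by 1,
    or by a ratio of two among 1, xi^2, eta^2, so [hxi] and [heta] suffice. Replacing [d] by its
    value from [hd] then leaves rational identities in four free variables. *)
Lemma vertex_gauge (i j k l : 'I_3) (D := fun i : nat => nth 0 [:: 1; xi; eta] i) :
  ftab (cn2 + ka) (cn2 + dn2 - d2 + ka) (dn2 + ka) d2 cn2 dn2
    (e S * m * d * M) (- (e T * m * d * M)) (d * M * DS) (- (d * M * DT))
    (f S * m * d * M) (- (f T * m * d * M)) i j k l * (D k * D l) =
  D i * D j * wtab
    (Q * d) (m * P * e T) (P * DT)
    (2 * m * d * e T) (P * Q) (2 * m * d * f T)
    (Q * DT) (- (m * Q * f T)) (P * d)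
    (Q * d) (m * P * e S) (P * DS)
    (2 * m * d * e S) (P * Q) (2 * m * d * f S)
    (Q * DS) (- (m * Q * f S)) (P * d) i j k l.
Proof.
have n2 : 2 != 0 :> C by rewrite pnatr_eq0.
have dE : d = ((S ^+ 2 + T ^+ 2) * be ^+ 2 - al ^+ 2 - al ^+ 2 * S ^+ 2 * T ^+ 2) / (2 * S * T).
  by rewrite -hd; field; rewrite S0 T0.
have E0 : (S ^+ 2 + T ^+ 2) * be ^+ 2 - al ^+ 2 - (al * S * T) ^+ 2 != 0.
  by rewrite !exprMn -hd; do ?apply: mulf_neq0.
have Q1 : be ^+ 2 - al ^+ 2 != 0 by [].
have hx : xi * xi = - P / (2 * d) by [].
have hy : eta * eta = - P / Q by [].
case: i => [[|[|[|//]]] ?]; case: j => [[|[|[|//]]] ?]; case: k => [[|[|[|//]]] ?];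
  case: l => [[|[|[|//]]] ?];
cbv [ftab D wtab tab4 nth nat_of_ord]; rewrite ?(mul0r, mulr0)// ?(hx, hy).
all: rewrite /cn2 /dn2 /d2 /ka /M /DS /DT /e /f /m /P /Q /NS /NT dE.
all: by field; rewrite ?S0 ?T0 ?Q1 ?E0.
Qed.
End Vertex.

(** * Elimination of the ratios at u - 1 and u + 2 *)

Section WeightTable.
Context {R : realType}.
Local Notation C := R[i].

Lemma wtabZ (x y g00 g01 g02 g10 g11 g12 g20 g21 g22 f00 f01 f02 f10 f11 f12 f20 f21 f22 : C)
    (i j k l : 'I_3) :
  wtab (x * g00) (x * g01) (x * g02) (x * g10) (x * g11) (x * g12) (x * g20) (x * g21) (x * g22)
       (y * f00) (y * f01) (y * f02) (y * f10) (y * f11) (y * f12) (y * f20) (y * f21) (y * f22) i j k l =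
  x * y * wtab g00 g01 g02 g10 g11 g12 g20 g21 g22 f00 f01 f02 f10 f11 f12 f20 f21 f22 i j k l.
Proof.
case: i => [[|[|[|//]]] ?]; case: j => [[|[|[|//]]] ?]; case: k => [[|[|[|//]]] ?];
  case: l => [[|[|[|//]]] ?]; cbv [wtab tab4 nth nat_of_ord]; rewrite ?mulr0//; ring.
Qed.

Lemma eq_wtab (g00 g01 g02 g10 g11 g12 g20 g21 g22 f00 f01 f02 f10 f11 f12 f20 f21 f22
    g00' g01' g02' g10' g11' g12' g20' g21' g22' f00' f01' f02' f10' f11' f12' f20' f21' f22' : C)
    (i j k l : 'I_3) :
  g00 = g00' -> g01 = g01' -> g02 = g02' -> g10 = g10' -> g11 = g11' -> g12 = g12' ->
  g20 = g20' -> g21 = g21' -> g22 = g22' -> f00 = f00' -> f01 = f01' -> f02 = f02' ->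
  f10 = f10' -> f11 = f11' -> f12 = f12' -> f20 = f20' -> f21 = f21' -> f22 = f22' ->
  wtab g00 g01 g02 g10 g11 g12 g20 g21 g22 f00 f01 f02 f10 f11 f12 f20 f21 f22 i j k l =
  wtab g00' g01' g02' g10' g11' g12' g20' g21' g22' f00' f01' f02' f10' f11' f12' f20' f21' f22' i j k l.
Proof. by do 18 move=> ->. Qed.

Variables (al be S T V W d p3 p2 p1 : C).
Let P := be ^+ 2 + al ^+ 2.
Let Q := be ^+ 2 - al ^+ 2.
Let m := al * be.
Let NS := be ^+ 2 - S ^+ 2 * al ^+ 2.
Let NT := be ^+ 2 - T ^+ 2 * al ^+ 2.
Let e X : C := (1 - X ^+ 2) / X.
Let f X : C := (1 + X ^+ 2) / X.
Let DS := T * NS / S - d.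
Let DT := d - S * NT / T.
Hypothesis S0 : S != 0.
Hypothesis T0 : T != 0.
Hypothesis V0 : V != 0.
Hypothesis NS0 : NS != 0.
Hypothesis NT0 : NT != 0.
Hypothesis sumS : (T + W) * NS = 2 * S * d.
Hypothesis prodS : T * W * NS = S ^+ 2 * be ^+ 2 - al ^+ 2.
Hypothesis prodT : V * S * NT = T ^+ 2 * be ^+ 2 - al ^+ 2.

(** [sumS] multiplied by T contains T W NS, which [prodS] evaluates, so W disappears. *)
Lemma ratio_relation : 2 * S * T * d =
  (S ^+ 2 + T ^+ 2) * be ^+ 2 - al ^+ 2 - al ^+ 2 * S ^+ 2 * T ^+ 2.
Proof.
transitivity (T * (T * NS) + T * W * NS).
  by transitivity (T * (2 * S * d)); [ring | rewrite -sumS; ring].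
by rewrite prodS /NS; ring.
Qed.

(** [prodT] and [prodS] express V and W, the ratios at u + 2 and u - 1, through S and T. Each half
    of the table then shows one common scalar, which [wtabZ] extracts. *)
Lemma weight_ratio (i j k l : 'I_3) :
  weight_wtab (p3 * be) (p3 * (be * T / V)) (p3 * (al / V)) (- (p3 * (al * T)))
    (p2 * be) (p2 * (be * S / T)) (p2 * (al / T)) (- (p2 * (al * S)))
    (p1 * be) (p1 * (be * W / S)) (p1 * (al / S)) (- (p1 * (al * W))) i j k l =
  p3 * p2 * (T / (NT * V)) * (p2 * p1 * (S / (NS * T))) * wtab
    (Q * d) (m * P * e T) (P * DT)
    (2 * m * d * e T) (P * Q) (2 * m * d * f T)
    (Q * DT) (- (m * Q * f T)) (P * d)
    (Q * d) (m * P * e S) (P * DS)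
    (2 * m * d * e S) (P * Q) (2 * m * d * f S)
    (Q * DS) (- (m * Q * f S)) (P * d) i j k l.
Proof.
have n2 : 2 != 0 :> C by rewrite pnatr_eq0.
have dE : d = ((S ^+ 2 + T ^+ 2) * be ^+ 2 - al ^+ 2 - al ^+ 2 * S ^+ 2 * T ^+ 2) / (2 * S * T).
  by rewrite -ratio_relation; field; rewrite S0 T0.
have VE : V = (T ^+ 2 * be ^+ 2 - al ^+ 2) / (S * NT) by rewrite -prodT; field; rewrite S0 NT0.
have WE : W = (S ^+ 2 * be ^+ 2 - al ^+ 2) / (T * NS) by rewrite -prodS; field; rewrite T0 NS0.
have X0 : (T * be) ^+ 2 - al ^+ 2 != 0 by rewrite exprMn -prodT !mulf_neq0.
have NS1 : be ^+ 2 - (S * al) ^+ 2 != 0 by rewrite exprMn.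
have NT1 : be ^+ 2 - (T * al) ^+ 2 != 0 by rewrite exprMn.
rewrite /weight_wtab -wtabZ.
apply: eq_wtab.
all: by rewrite ?VE ?WE /DS /DT /e /f /m /P /Q ?dE /NS /NT; field; rewrite ?S0 ?T0 ?X0 ?NS1 ?NT1.
Qed.
End WeightTable.

(** * The weights as rational functions *)

Section Entries.
Context {R : realType}.
Local Notation C := R[i].

Lemma vtheta2_quarter (t : C) : 0 < complex.Im t -> vtheta2 (1 / 2 / 2) t = vtheta1 (1 / 2 / 2) t.
Proof.
move=> t0; rewrite /vtheta2; have -> : 1 / 2 / 2 + 1 / 2 = - (1 / 2 / 2) + 1 :> C by field.
by rewrite vtheta1_add1// vtheta1N// opprK.
Qed.

Lemma vtheta1_quarter_neq0 (t : C) : 0 < complex.Im t -> vtheta1 (1 / 2 / 2) t != 0.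
Proof.
move=> t0; have -> : 1 / 2 / 2 = ((4^-1 : R)%:C)%C :> C by rewrite fmorphV rmorph_nat; field.
by apply: vtheta1_neq0_real => //; lra.
Qed.

Lemma vtheta0_half_sqr (t : C) : 0 < complex.Im t -> vtheta0 (1 / 2) t ^+ 2 = vtheta3 0 t ^+ 2.
Proof.
move=> t0; rewrite /vtheta0 /vtheta3.
have -> : 1 / 2 + t / 2 = 0 + (t + 1) / 2 :> C by field.
have -> : piC * iC * (1 / 2 + t / 4) = piC * iC * (0 + t / 4) + piC * iC / 2 :> C by field.
rewrite cexpD cexp_pihalf.
move: (cexp _) (vtheta1 _ _) => a b.
move: (@sqr_iC R); move: iC => i ii.
have -> : - i * (a * i) * b = - (i * i) * (a * b) by ring.
by rewrite ii opprK mul1r.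
Qed.

(* Multiply the addition formulas for th1 th1 and th2 th2 at the quarter period. *)
Lemma dup_relation (t x : C) : 0 < complex.Im t ->
  vtheta1 x (t / 2) ^+ 2 * vtheta2 x (t / 2) ^+ 2 * vtheta3 0 t ^+ 2 * vtheta2 0 (t / 2) ^+ 4 =
  (vtheta1 (1 / 2 / 2) (t / 2) * vtheta2 (1 / 2 / 2) (t / 2)) ^+ 2 *
  (vtheta0 (2 * x) t ^+ 2 * vtheta2 0 (t / 2) ^+ 4 -
   (vtheta2 x (t / 2) ^+ 2 - vtheta1 x (t / 2) ^+ 2) ^+ 2 * vtheta0 0 t ^+ 2).
Proof.
move=> t0; have h0 := Im_half t0.
have q := vtheta2_quarter h0.
have A := th12_add t0 x (1 / 2 / 2); have B := vtheta0_sum t0 x (1 / 2 / 2).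
have E := th22_add t0 x (1 / 2 / 2); have F := th11_add t0 x (1 / 2 / 2).
have H := vtheta0_half_sqr t0.
have e : 2 * (1 / 2 / 2) = 1 / 2 :> C by field.
rewrite e in A; move: A B E F H; rewrite q.
move: (vtheta1 (x + _) _) (vtheta2 (x + _) _) (vtheta1 (x - _) _) (vtheta2 (x - _) _).
move: (vtheta1 (1 / 2 / 2) _) (vtheta0 (1 / 2) t) (vtheta3 0 t) (vtheta1 x _) (vtheta2 x _) (vtheta0 (2 * x) t) (vtheta2 0 _) (vtheta0 0 t).
move=> k v3' v3 s c D n v0 a b a' b' A B E F H.
have G : a' * b * v0 = s * c * v3' - k * k * D.
  have -> : a' * b * v0 = a * b' * v0 - (a * b' - b * a') * v0 by ring.
  by rewrite A B; ring.
have : (a * b' * v0) * (a' * b * v0) * n ^+ 4 = (a * a' * n ^+ 2) * (b * b' * n ^+ 2) * v0 ^+ 2 by ring.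
rewrite A G E F -H => h.
have -> : s ^+ 2 * c ^+ 2 * v3' ^+ 2 * n ^+ 4 =
  (s * c * v3' + k * k * D) * (s * c * v3' - k * k * D) * n ^+ 4 + (k * k) ^+ 2 * D ^+ 2 * n ^+ 4 by ring.
by rewrite h; ring.
Qed.

End Entries.

(** * Addition formulas in the scale of the weights *)

Section Dictionary.
Context {R : realType}.
Local Notation C := R[i].
Variables K K' lam : C.
Local Notation tau := (par_tau K K').
Local Notation r := (par_r K' lam).
Hypothesis tau_gt0 : 0 < complex.Im tau.
Hypothesis r0 : r != 0.
Local Notation s := (th1 K K' lam).
Local Notation c := (th2 K K' lam).
Local Notation n := (th2 K K' lam 0).

(** [vtheta0] at modulus tau, rescaled so that [sc_add] has the same constant [n ^+ 2] as [c_add]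
    and [s_add]. Its value at 1 is the [d] of the rational identities. *)
Definition vth z : C := vtheta0 (z / r) tau / vtheta0 0 tau * n ^+ 2.

Let nE : n = vtheta2 0 (tau / 2). Proof. by rewrite /th2 mul0r. Qed.
Let n0 : n != 0. Proof. by rewrite nE; apply: vtheta2_0_neq0; exact: Im_half. Qed.
Let v00 : vtheta0 0 tau != 0. Proof. exact: vtheta0_0_neq0. Qed.
Let v20 : vtheta2 0 tau != 0. Proof. exact: vtheta2_0_neq0. Qed.
Let v30 : vtheta3 0 tau != 0. Proof. exact: vtheta3_0_neq0. Qed.
Let dbl z : 2 * (z / (2 * r)) = z / r. Proof. by field. Qed.
Let addd z w : (z + w) / (2 * r) = z / (2 * r) + w / (2 * r). Proof. by rewrite mulrDl. Qed.
Let subd z w : (z - w) / (2 * r) = z / (2 * r) - w / (2 * r). Proof. by rewrite mulrBl. Qed.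

Lemma c_add z w : c (z + w) * c (z - w) * n ^+ 2 = c z ^+ 2 * c w ^+ 2 - s z ^+ 2 * s w ^+ 2.
Proof. by rewrite nE /th1 /th2 addd subd th22_add. Qed.

Lemma s_add z w : s (z + w) * s (z - w) * n ^+ 2 = s z ^+ 2 * c w ^+ 2 - c z ^+ 2 * s w ^+ 2.
Proof. by rewrite nE /th1 /th2 addd subd th11_add. Qed.

Lemma sc_add z w : s (z + w) * c (z - w) * n ^+ 2 = s z * c z * vth w + s w * c w * vth z.
Proof.
have := th12_add tau_gt0 (z / (2 * r)) (w / (2 * r)).
rewrite /vth !dbl -addd -subd -![vtheta1 (_ / (2 * r)) _]/(s _) -![vtheta2 (_ / (2 * r)) _]/(c _).
move: n (s z) (c z) (s w) (c w) (s _) (c _) (vtheta0 0 tau) (vtheta0 (z / r) tau) (vtheta0 (w / r) tau) v00.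
move=> m a b a' b' x y v vz vw v0 h.
by apply: (mulfI v0); transitivity (m ^+ 2 * (x * y * v)); [ring | rewrite h; field].
Qed.

Lemma sc_sub z w : s (z - w) * c (z + w) * n ^+ 2 = s z * c z * vth w - s w * c w * vth z.
Proof.
have := vtheta0_sum tau_gt0 (z / (2 * r)) (w / (2 * r)); have := sc_add z w.
rewrite {3}/vth /vth !dbl -addd -subd -![vtheta1 (_ / (2 * r)) _]/(s _) -![vtheta2 (_ / (2 * r)) _]/(c _).
move: n (s z) (c z) (s w) (c w) (s (z + w)) (c (z + w)) (s (z - w)) (c (z - w)) (vtheta0 0 tau) (vtheta0 (z / r) tau) (vtheta0 (w / r) tau) v00.
move=> m a b a' b' x y x' y' v vz vw v0 h1 h.
have -> : x' * y * m ^+ 2 = x * y' * m ^+ 2 - (x * y' - y * x') * v * (m ^+ 2 / v) by field.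
by rewrite h h1; field.
Qed.

End Dictionary.

(** * Elliptic functions in terms of th1 and th2 *)

Section Ratios.
Context {R : realType}.
Local Notation C := R[i].
Variables K K' lam : C.
Local Notation tau := (par_tau K K').
Local Notation r := (par_r K' lam).
Hypothesis tau_gt0 : 0 < complex.Im tau.
Hypothesis r0 : r != 0.
Local Notation s := (th1 K K' lam).
Local Notation c := (th2 K K' lam).
Local Notation n := (th2 K K' lam 0).
Local Notation Vth := (vth K K' lam).

Definition thq z : C := s z / c z.
Local Notation al := (s 1).
Local Notation be := (c 1).
Local Notation d := (Vth 1).

Definition thq_norm z : C := be ^+ 2 - thq z ^+ 2 * al ^+ 2.

Let nE : n = vtheta2 0 (tau / 2). Proof. by rewrite /th2 mul0r. Qed.
Lemma th2_0_neq0 : n != 0. Proof. by rewrite nE; apply: vtheta2_0_neq0; exact: Im_half. Qed.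
Let n0 := th2_0_neq0.
Let v00 : vtheta0 0 tau != 0. Proof. exact: vtheta0_0_neq0. Qed.
Let v20 : vtheta2 0 tau != 0. Proof. exact: vtheta2_0_neq0. Qed.
Let v30 : vtheta3 0 tau != 0. Proof. exact: vtheta3_0_neq0. Qed.
Let dbl z : 2 * (z / (2 * r)) = z / r. Proof. by field. Qed.

(** By [c_add], [thq_norm z] is the common denominator of the neighbouring ratios. Their product
    then comes from [s_add], their sum from adding [sc_add] and [sc_sub]. *)
Lemma thqP z : c z != 0 -> c (z + 1) != 0 -> c (z - 1) != 0 ->
  [/\ thq_norm z != 0, (thq (z + 1) + thq (z - 1)) * thq_norm z = 2 * thq z * d,
      thq (z + 1) * thq (z - 1) * thq_norm z = thq z ^+ 2 * be ^+ 2 - al ^+ 2,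
      al * be * Vth z = (thq (z + 1) * thq_norm z - thq z * d) * c z ^+ 2
    & c (z + 1) * c (z - 1) * n ^+ 2 = c z ^+ 2 * thq_norm z].
Proof.
move: (c_add lam tau_gt0 z 1) (s_add lam tau_gt0 z 1) (sc_add tau_gt0 r0 z 1) (sc_sub tau_gt0 r0 z 1).
rewrite /thq_norm /thq; move: n n0 (Vth 1) (Vth z) (s 1) (c 1).
move: (s (z + 1)) (c (z + 1)) (s (z - 1)) (c (z - 1)) (s z) (c z).
move=> sp cp sm cm s0 c0 m m0 D Du a b hc hs h1 h2 nc0 ncp ncm.
have A : cp * cm * m ^+ 2 = c0 ^+ 2 * (b ^+ 2 - (s0 / c0) ^+ 2 * a ^+ 2) by rewrite hc; field.
move: (b ^+ 2 - _) A => N A.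
have NE : N = cp * cm * m ^+ 2 / c0 ^+ 2 by rewrite A; field.
split=> //.
- by rewrite NE mulf_neq0 ?invr_eq0 ?expf_neq0// mulf_neq0 ?expf_neq0// mulf_neq0.
- rewrite NE; transitivity ((sp * cm * m ^+ 2 + sm * cp * m ^+ 2) / c0 ^+ 2).
    by field; rewrite nc0 ncm ncp.
  by rewrite h1 h2; field.
- rewrite NE; transitivity (sp * sm * m ^+ 2 / c0 ^+ 2).
    by field; rewrite nc0 ncm ncp.
  by rewrite hs; field.
- rewrite NE; transitivity (sp * cm * m ^+ 2 - s0 * c0 * D).
    by rewrite h1; ring.
  by field; rewrite nc0 ncp.
Qed.

Lemma th1_dup : s 2 * n ^+ 3 = 2 * (al * be) * d.
Proof.
have h := sc_add tau_gt0 r0 1 1; rewrite subrr in h.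
move: h; rewrite -[1 + 1]/(2); move: (s 2) (s 1) (c 1) n d => ? ? ? ? ? h.
by rewrite exprS mulrA h; ring.
Qed.

Lemma th2_dup : c 2 * n ^+ 3 = be ^+ 4 - al ^+ 4.
Proof.
have h := c_add lam tau_gt0 1 1; rewrite subrr in h.
move: h; rewrite -[1 + 1]/(2); move: (c 2) (s 1) (c 1) n => ? ? ? ? h.
by rewrite exprS mulrA h; ring.
Qed.

Let k := vtheta1 (1 / 2 / 2) (tau / 2) * vtheta2 (1 / 2 / 2) (tau / 2).
Let k0 : k != 0.
Proof.
have h0 := Im_half tau_gt0; have q := vtheta1_quarter_neq0 h0.
rewrite /k (vtheta2_quarter h0); exact: (mulf_neq0 q q).
Qed.

Lemma vtheta1_s z : vtheta1 (z / r) tau = s z * c z * vtheta2 0 tau / k.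
Proof.
have := vtheta1_dup tau_gt0 (z / (2 * r)).
rewrite dbl -/k -[vtheta1 (z / (2 * r)) _]/(s z) -[vtheta2 (z / (2 * r)) _]/(c z).
by move: (s z) (c z) (vtheta2 0 tau) (vtheta1 _ _) k k0 => ? ? ? ? ? kn ->; field.
Qed.

Lemma vtheta2_s z : vtheta2 (z / r) tau = (c z ^+ 2 - s z ^+ 2) * vtheta2 0 tau / n ^+ 2.
Proof.
have := vtheta2_dup tau_gt0 (z / (2 * r)).
rewrite dbl -nE -[vtheta1 (z / (2 * r)) _]/(s z) -[vtheta2 (z / (2 * r)) _]/(c z).
by move: (s z) (c z) (vtheta2 0 tau) (vtheta2 _ _) n n0 => ? ? ? ? ? kn <-; field.
Qed.

Lemma vtheta3_s z : vtheta3 (z / r) tau = (c z ^+ 2 + s z ^+ 2) * vtheta3 0 tau / n ^+ 2.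
Proof.
have := vtheta3_dup tau_gt0 (z / (2 * r)).
rewrite dbl -nE -[vtheta1 (z / (2 * r)) _]/(s z) -[vtheta2 (z / (2 * r)) _]/(c z).
by move: (s z) (c z) (vtheta3 0 tau) (vtheta3 _ _) n n0 => ? ? ? ? ? kn <-; field.
Qed.

Lemma vtheta0_s z : vtheta0 (z / r) tau = Vth z * vtheta0 0 tau / n ^+ 2.
Proof.
rewrite /vth; move: (vtheta0 (z / r) _) (vtheta0 0 tau) v00 n n0 => a b b0 e e0.
by field; rewrite b0 e0.
Qed.

(** The constant relating sn to th1 th2 / [vth]. It cancels in Fateev's entries, where sn occurs in
    quotients of equal degree; its square enters in the derivation of [vth_dup]. *)
Definition sigma : C := vtheta3 0 tau * n ^+ 2 / (k * vtheta0 0 tau).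

Lemma sigma_neq0 : sigma != 0.
Proof.
rewrite /sigma; move: (vtheta3 0 tau) (vtheta0 0 tau) v30 v00 n n0 k k0 => a b a0 b0 m m0 l l0.
by rewrite !(mulf_neq0, invr_eq0, expf_neq0).
Qed.

(** Valid also where [Vth z] vanishes: both sides are then 0 because division by zero gives 0. The
    same holds for [cnE] and [dnE]. *)
Lemma snE z : sn K K' lam z = sigma * (s z * c z) / Vth z.
Proof.
rewrite /sn vtheta1_s vtheta0_s /sigma.
move: (s z) (c z) (Vth z) (vtheta3 0 tau) (vtheta0 0 tau) (vtheta2 0 tau) v30 v00 v20 n n0 k k0.
move=> a b D v3 v0 v2 v3n v0n v2n m mn l ln.
case: (eqVneq D 0) => [->|Dn]; first by rewrite !(mul0r, mulr0, invr0).
by field; rewrite v0n v2n Dn ln mn.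
Qed.

Lemma cnE z : cn K K' lam z = (c z ^+ 2 - s z ^+ 2) / Vth z.
Proof.
rewrite /cn vtheta2_s vtheta0_s.
move: (s z) (c z) (Vth z) (vtheta0 0 tau) (vtheta2 0 tau) v00 v20 n n0.
move=> a b D v0 v2 v0n v2n m mn.
case: (eqVneq D 0) => [->|Dn]; first by rewrite !(mul0r, mulr0, invr0).
by field; rewrite v0n v2n Dn mn.
Qed.

Lemma dnE z : dn K K' lam z = (c z ^+ 2 + s z ^+ 2) / Vth z.
Proof.
rewrite /dn vtheta3_s vtheta0_s.
move: (s z) (c z) (Vth z) (vtheta0 0 tau) (vtheta3 0 tau) v00 v30 n n0.
move=> a b D v0 v2 v0n v2n m mn.
case: (eqVneq D 0) => [->|Dn]; first by rewrite !(mul0r, mulr0, invr0).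
by field; rewrite v0n v2n Dn mn.
Qed.

(** This is sn^2 + cn^2 = 1 with the denominator cleared. *)
Lemma sigma_sqr z : sigma ^+ 2 * (s z * c z) ^+ 2 = Vth z ^+ 2 - (c z ^+ 2 - s z ^+ 2) ^+ 2.
Proof.
have := dup_relation (z / (2 * r)) tau_gt0; rewrite dbl -nE vtheta0_s /sigma -/k.
rewrite -[vtheta1 (z / (2 * r)) _]/(s z) -[vtheta2 (z / (2 * r)) _]/(c z).
move: (s z) (c z) (Vth z) (vtheta3 0 tau) (vtheta0 0 tau) v00 n n0 k k0.
move=> a b D v3 v0 v0n m mn l ln h.
transitivity (a ^+ 2 * b ^+ 2 * v3 ^+ 2 * m ^+ 4 / (l * v0) ^+ 2).
  by field; rewrite ln v0n.
by rewrite h; field; rewrite v0n ln mn.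
Qed.

(** [vtheta0_dup] at 1 / r, where [sigma_sqr] trades the [vtheta1] term for [d] and the squares of
    th1 and th2. The right side is the common denominator of sn, cn and dn at 2. *)
Lemma vth_dup : Vth 2 * n ^+ 6 = d ^+ 2 * (be ^+ 2 - al ^+ 2) ^+ 2 +
  (d ^+ 2 - (be ^+ 2 - al ^+ 2) ^+ 2) * (be ^+ 2 + al ^+ 2) ^+ 2.
Proof.
have := vtheta0_dup tau_gt0 (1 / r).
have -> : 2 * (1 / r) = 2 / r by field.
rewrite !vtheta0_s vtheta1_s vtheta2_s vtheta3_s => h.
have := sigma_sqr 1 => g.
rewrite -g /sigma; move: h.
move: (s 1) (c 1) (Vth 1) (Vth 2) (vtheta2 0 tau) (vtheta3 0 tau) (vtheta0 0 tau) v20 v00 n n0 k k0.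
move=> a b D D2 v2 v3 v0 v2n v0n m mn l ln h.
have -> : D2 * m ^+ 6 = D2 * v0 / m ^+ 2 * v0 * v2 ^+ 2 * (m ^+ 8 / (v0 ^+ 2 * v2 ^+ 2)).
  by field; rewrite v0n v2n mn.
by rewrite h; field; rewrite v0n v2n ln mn.
Qed.

Lemma fateev_factorE z : s (z + 2) != 0 -> c (z + 2) != 0 ->
  fateev_factor K K' lam z = br K K' lam (z + 1) / br K K' lam (z - 1) *
    (Vth 2 / n ^+ 2 * (s z * c z / (s (z + 2) * c (z + 2)))).
Proof.
rewrite /fateev_factor !vtheta1_s vtheta0_s; move: (br _ _ _ _) (br _ _ _ _) => B B'.
move: (s z) (c z) (s (z + 2)) (c (z + 2)) (Vth 2) (vtheta0 0 tau) (vtheta2 0 tau) v00 v20 n n0 k k0.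
move=> a b a' b' D v0 v2 v0n v2n m mn l ln a0 b0.
by congr (_ * _); field; rewrite v0n v2n mn ln a0 b0.
Qed.

Lemma th1E z : c z != 0 -> s z = thq z * c z.
Proof. by move=> c0; rewrite /thq divfK. Qed.

End Ratios.

(** * Comparison of the entries *)

Local Opaque vtheta0 vtheta1 vtheta2 vtheta3 th1 th2.

Section FateevEntries.
Context {R : realType}.
Local Notation C := R[i].
Local Notation mi := mxtens_index.

Lemma RfateevE (K K' lam u : C) (i j k l : 'I_3)
  (sn := sn K K' lam) (cn := cn K K' lam) (dn := dn K K' lam)
  (ka := sn 1 * sn 2 / (sn u * sn (u + 1))) :
  Rfateev K K' lam u (mi (i, j)) (mi (k, l)) = fateev_factor K K' lam u *
  ftab (cn 2 + ka) (cn 2 + dn 2 - 1 + ka) (dn 2 + ka) 1 (cn 2) (dn 2)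
    (cn u * sn 2 / sn u) (- (cn (u + 1) * sn 2 / sn (u + 1)))
    (sn 2 / sn u) (- (sn 2 / sn (u + 1)))
    (dn u * sn 2 / sn u) (- (dn (u + 1) * sn 2 / sn (u + 1))) i j k l.
Proof.
rewrite mxE; congr (_ * _); rewrite mxE.
by case: i => [[|[|[|//]]] ?]; case: j => [[|[|[|//]]] ?];
  case: k => [[|[|[|//]]] ?]; case: l => [[|[|[|//]]] ?].
Qed.

Lemma ftabZ x s1 s2 s3 t0 t a r mu RR nu q rho (i j k l : 'I_3) :
  ftab (x * s1) (x * s2) (x * s3) (x * t0) (x * t) (x * a) (x * r) (x * mu) (x * RR) (x * nu)
    (x * q) (x * rho) i j k l = x * ftab s1 s2 s3 t0 t a r mu RR nu q rho i j k l :> C.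
Proof.
by case: i => [[|[|[|//]]] ?]; case: j => [[|[|[|//]]] ?]; case: k => [[|[|[|//]]] ?];
  case: l => [[|[|[|//]]] ?]; cbv [ftab tab4 nth nat_of_ord]; rewrite ?mulr0.
Qed.

End FateevEntries.

Lemma tens11mx {R : realType} : 1%:M *t 1%:M = 1%:M :> 'M[R[i]]_(3 * 3).
Proof.
apply/matrixP => s t; case: (mxtens_indexP s) => i j; case: (mxtens_indexP t) => k l.
by rewrite tensmxE !mxE mi_eq -natrM mulnb.
Qed.

Section Comparison.
Context {R : realType}.
Local Notation C := R[i].
Local Notation mi := mxtens_index.
Variables K K' lam u : C.
Local Notation tau := (par_tau K K').
Local Notation r := (par_r K' lam).
Local Notation s := (th1 K K' lam).
Local Notation c := (th2 K K' lam).
Local Notation n := (th2 K K' lam 0).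
Local Notation Vth := (vth K K' lam).
Local Notation tq := (thq K K' lam).

Local Notation br := (br K K' lam).
Hypothesis tau_gt0 : 0 < complex.Im tau.
Hypothesis x_lt1 : `|par_x K lam| < 1.
Hypothesis reg1 : elliptic_regular K K' lam 1.
Hypothesis reg2 : elliptic_regular K K' lam 2.
Hypothesis regv2 : vtheta2 (1 / r) tau != 0.
Hypothesis regv3 : vtheta3 (1 / r) tau != 0.
Hypothesis regR : R22_regular K K' lam u.
Hypothesis regF : Rfateev_regular K K' lam u.

Let r0 : r != 0. Proof. exact: r_neq0 tau_gt0 x_lt1. Qed.
Let n0 : n != 0. Proof. exact: th2_0_neq0. Qed.
Let v00 : vtheta0 0 tau != 0. Proof. exact: vtheta0_0_neq0. Qed.
Let u11 : 1 + (u + 1) = u + 2. Proof. by ring. Qed.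
Let u1 : 1 + u = u + 1. Proof. by rewrite addrC. Qed.
Let u1m : 1 + (u - 1) = u. Proof. by ring. Qed.

Let sp2 : s (u + 2) != 0. Proof. by case: regR => -[]; rewrite u11. Qed.
Let cp2 : c (u + 2) != 0. Proof. by case: regR => -[]; rewrite u11. Qed.
Let sp1 : s (u + 1) != 0. Proof. by case: regR => _ []; rewrite u1. Qed.
Let cp1 : c (u + 1) != 0. Proof. by case: regR => _ []; rewrite u1. Qed.
Let su : s u != 0. Proof. by case: regR => _ _ []; rewrite u1m. Qed.
Let cu : c u != 0. Proof. by case: regR => _ _ []; rewrite u1m. Qed.
(** The regularity of [R22] controls the points u, u + 1, u + 2 only. This one comes from
    [br (u - 1)], which contains the product th1 th2 at u - 1. *)
Let cm1 : c (u - 1) != 0.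
Proof.
case: regF => _ _ + _; apply: contraNneq => c0.
by rewrite /Defs.br vtheta1_s// c0 mulr0 !mul0r mulr0.
Qed.

Let vth_neq0 z : elliptic_regular K K' lam z -> Vth z != 0.
Proof.
rewrite /elliptic_regular /vth; move: (vtheta0 (z / r) tau) (vtheta0 0 tau) v00 n n0 => a b b0 m m0 a0.
by rewrite !(mulf_neq0, invr_eq0, expf_neq0).
Qed.

Local Notation al := (s 1).
Local Notation be := (c 1).
Local Notation d := (Vth 1).
Local Notation S := (tq u).
Local Notation T := (tq (u + 1)).
Local Notation V := (tq (u + 2)).
Local Notation W := (tq (u - 1)).

(** The scalar left on each side once all entries are polynomials in the reduced quantities: the
    [br] quotient comes from the four [R0], the rest from the prefactors of the weights. *)
Definition common_factor : C :=
  br (u + 1) / br (u - 1) * (S * c u ^+ 2 / (V * n ^+ 8 * c (u + 2) ^+ 2)).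

Lemma weights z (p := R0 K K' lam z * (c z / (n * c (z + 1)))) :
  c z != 0 -> s (z + 1) != 0 -> c (z + 1) != 0 ->
  Rbaxter K K' lam z = wmx (p * be) (p * (be * tq z / tq (z + 1)))
    (p * (al / tq (z + 1))) (- (p * (al * tq z))).
Proof.
move=> cz sz1 cz1; rewrite RbaxterE /p /wa /wb /wc /wd [1 + z]addrC /thq.
move: n n0 (c z) (s z) (c (z + 1)) (s (z + 1)) (s 1) (c 1) cz sz1 cz1.
move=> m m0 a b a' b' x y h1 h2 h3.
by congr wmx; field; rewrite ?m0 ?h1 ?h2 ?h3.
Qed.

Lemma thqs_neq0 : [/\ S != 0, T != 0 & V != 0].
Proof.
have h (a b : C) : a != 0 -> b != 0 -> a / b != 0 by move=> ? ?; rewrite mulf_neq0 ?invr_eq0.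
by split; exact: h.
Qed.
Local Opaque vth thq Defs.br R0 wtab.



Local Notation P := (be ^+ 2 + al ^+ 2).
Local Notation Q := (be ^+ 2 - al ^+ 2).
Local Notation m := (al * be).
Local Notation NS := (be ^+ 2 - S ^+ 2 * al ^+ 2).
Local Notation NT := (be ^+ 2 - T ^+ 2 * al ^+ 2).
Local Notation e X := ((1 - X ^+ 2) / X).
Local Notation f X := ((1 + X ^+ 2) / X).
Local Notation DS := (T * NS / S - d).
Local Notation DT := (d - S * NT / T).
Local Notation d2 := (d ^+ 2 * Q ^+ 2 + (d ^+ 2 - Q ^+ 2) * P ^+ 2).
Local Notation cn2 := ((P * Q) ^+ 2 - 4 * m ^+ 2 * d ^+ 2).
Local Notation dn2 := ((P * Q) ^+ 2 + 4 * m ^+ 2 * d ^+ 2).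
Local Notation M := (2 * P * Q).
Local Notation ka := (M * DS * DT).

Let relS : [/\ NS != 0, (T + W) * NS = 2 * S * d, T * W * NS = S ^+ 2 * be ^+ 2 - al ^+ 2,
  m * Vth u = (T * NS - S * d) * c u ^+ 2 & c (u + 1) * c (u - 1) * n ^+ 2 = c u ^+ 2 * NS].
Proof. exact: thqP. Qed.

Let relT : [/\ NT != 0, (V + S) * NT = 2 * T * d, V * S * NT = T ^+ 2 * be ^+ 2 - al ^+ 2,
  m * Vth (u + 1) = (V * NT - T * d) * c (u + 1) ^+ 2 & c (u + 2) * c u * n ^+ 2 = c (u + 1) ^+ 2 * NT].
Proof.
have e2 : u + 1 + 1 = u + 2 by ring.
have := @thqP _ K K' lam tau_gt0 r0 (u + 1); rewrite e2 addrK; exact.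
Qed.

Lemma R22_entry (i j k l : 'I_3) :
  ((Hmx *t Hmx) *m R22 K K' lam u *m (Hmx *t Hmx)) (mi (i, j)) (mi (k, l)) =
  common_factor * wtab
    (Q * d) (m * P * e T) (P * DT)
    (2 * m * d * e T) (P * Q) (2 * m * d * f T)
    (Q * DT) (- (m * Q * f T)) (P * d)
    (Q * d) (m * P * e S) (P * DS)
    (2 * m * d * e S) (P * Q) (2 * m * d * f S)
    (Q * DS) (- (m * Q * f S)) (P * d) i j k l.
Proof.
have e2 : u + 1 + 1 = u + 2 by ring.
have [S0 T0 V0] := thqs_neq0.
have [NS0 sS pS _ cS] := relS; have [NT0 _ pT _ cT] := relT.
rewrite R22_Hmx (@weights (u + 1)) ?e2// (@weights u)// (@weights (u - 1)) ?subrK//.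
rewrite R22_entries (weight_ratio _ _ _ S0 T0 V0 NS0 NT0 sS pS pT); congr (_ * _); rewrite /common_factor.
case: regR => -[_ _ R1] [_ _ R2] [_ _ R3]; case: regF => _ _ br0 _.
have := R0_prod tau_gt0 x_lt1 R1 R2 R3 br0.
move: cS cT NS0 NT0; move: NS NT S0 T0 V0 => N N' S0 T0 V0.
move: (br (u + 1) / br (u - 1)) (R0 _ _ _ _) (R0 _ _ _ _) (R0 _ _ _ _) S T V S0 T0 V0.
move: n n0 (c u) (c (u + 1)) (c (u + 2)) (c (u - 1)) cu cp1 cp2 cm1.
move=> m m0 a b b' a' an bn bn' an' B x y z S T V S0 T0 V0 hS hT N0 N0' <-.
(* Writing [NS] and [NT] through values of th2 makes the prefactors of the four R-matrices collapse
   to [common_factor]. *)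
have -> : N = b * a' * m ^+ 2 / a ^+ 2 by rewrite hS; field.
have -> : N' = b' * a * m ^+ 2 / b ^+ 2 by rewrite hT; field.
by field; rewrite ?S0 ?T0 ?V0 m0 an bn bn' an'.
Qed.


Let d0 : d != 0. Proof. exact: vth_neq0. Qed.
Let vth2E : Vth 2 = d2 / n ^+ 6.
Proof. by rewrite -vth_dup//; move: (Vth 2) n n0 => a b b0; field. Qed.
Let d20 : d2 != 0.
Proof. by have := vth_neq0 reg2; rewrite vth2E; apply: contraNneq => ->; rewrite mul0r. Qed.

(** The quotient of [vtheta0] values in the normalization supplies exactly the denominator [d2]
    shared by sn 2, cn 2 and dn 2. *)
Let factorE : fateev_factor K K' lam u = common_factor * d2.
Proof.
have [S0 T0 V0] := thqs_neq0.
rewrite (fateev_factorE tau_gt0 r0 sp2 cp2) vth2E /common_factor (th1E cu) (th1E cp2).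
move: (br _ / br _) d2 S V V0 (c u) (c (u + 2)) cp2 n n0.
by move=> B D S' V' V'0 a b b0 k k0; field; rewrite k0 b0 V'0.
Qed.

Let vthu : m * Vth u = S * DS * c u ^+ 2.
Proof. by have [S0 _ _] := thqs_neq0; have [_ _ _ -> _] := relS; field. Qed.

(** The addition formula gives this in terms of the ratio V at u + 2; the sum relation exchanges V
    for S. *)
Let vthu1 : m * Vth (u + 1) = T * DT * c (u + 1) ^+ 2.
Proof.
have [_ T0 _] := thqs_neq0; have [_ sT _ -> _] := relT.
congr (_ * _); move: V S T d T0 NT sT => v w y D y0 N sT.
have -> : v * N = 2 * y * D - w * N by rewrite -sT; ring.
by field.
Qed.

Lemma Rfateev_entry (i j k l : 'I_3) :
  Rfateev K K' lam u (mi (i, j)) (mi (k, l)) = common_factor *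
  ftab (cn2 + ka) (cn2 + dn2 - d2 + ka) (dn2 + ka) d2 cn2 dn2
    (e S * m * d * M) (- (e T * m * d * M)) (d * M * DS) (- (d * M * DT))
    (f S * m * d * M) (- (f T * m * d * M)) i j k l.
Proof.
rewrite RfateevE factorE -mulrA -ftabZ; congr (_ * _).
have [S0 T0 V0] := thqs_neq0.
case: regF => -[/vth_neq0 vu _] [/vth_neq0 vu1 _] _ _.
have n30 : n ^+ 3 != 0 by exact: expf_neq0.
have s2 : s 2 = 2 * m * d / n ^+ 3 by rewrite -th1_dup// mulfK.
have c2 : c 2 = (be ^+ 4 - al ^+ 4) / n ^+ 3 by rewrite -th2_dup// mulfK.
move: vthu vthu1 (sigma_neq0 lam tau_gt0) d20.
rewrite !snE// !cnE// !dnE// vth2E s2 c2 (th1E cu) (th1E cp1).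
move: d2 DS DT => E2 dS dT.
move: (sigma _ _ _) S T S0 T0 (Vth u) (Vth (u + 1)) vu vu1 n n0 (c u) (c (u + 1)) cu cp1 d d0 (s 1) (c 1).
move=> g x y x0 y0 w w' w0 w0' q q0 z z' z0 z0' D D0 a b hw hw' g0 E20.
(* In most entries [Vth u] and [Vth (u + 1)] cancel. They survive in the three quantities treated
   here, whose reduced forms are therefore rewritten through [hw] and [hw'], so that [field] needs
   no side relation. *)
have RR : 2 * D * (b ^+ 4 - a ^+ 4) * (a * b * w) / (x * z * z) =
    D * (2 * (b ^+ 2 + a ^+ 2) * (b ^+ 2 - a ^+ 2)) * dS by rewrite hw; field; rewrite x0 z0.
have nu : 2 * D * (b ^+ 4 - a ^+ 4) * (a * b * w') / (y * z' * z') =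
    D * (2 * (b ^+ 2 + a ^+ 2) * (b ^+ 2 - a ^+ 2)) * dT by rewrite hw'; field; rewrite y0 z0'.
have kp : 2 * (b ^+ 4 - a ^+ 4) * (a * b * w) * (a * b * w') / (x * z * z * (y * z' * z')) =
    2 * (b ^+ 2 + a ^+ 2) * (b ^+ 2 - a ^+ 2) * dS * dT.
  by rewrite hw hw'; field; rewrite x0 z0 y0 z0'.
rewrite -kp -RR -nu.
congr (ftab _ _ _ _ _ _ _ _ _ _ _ _ i j k l).
all: by field; rewrite ?x0 ?y0 ?z0 ?z0' ?w0 ?w0' ?g0 ?q0 ?E20 ?D0.
Qed.


Let Q0 : Q != 0.
Proof. by move: regv2; rewrite vtheta2_s//; apply: contraNneq => ->; rewrite !mul0r. Qed.
Let P0 : P != 0.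
Proof. by move: regv3; rewrite vtheta3_s//; apply: contraNneq => ->; rewrite !mul0r. Qed.

Definition diag3 (x y : C) : 'M[C]_3 := mx_of_rows 3 3 [:: [:: 1; 0; 0]; [:: 0; x; 0]; [:: 0; 0; y]].

Let D (x y : C) (i : nat) := nth 0 [:: 1; x; y] i.

Lemma diag3E x y (i j : 'I_3) : diag3 x y i j = D x y i * (i == j)%:R.
Proof.
rewrite mxE -val_eqE.
by case: i => [[|[|[|//]]] ?]; case: j => [[|[|[|//]]] ?]; rewrite /= ?mulr0 ?mulr1.
Qed.

Lemma mulmx_diag3 x y (A : 'M[C]_(3 * 3)) s (k l : 'I_3) :
  (A *m (diag3 x y *t diag3 x y)) s (mi (k, l)) = A s (mi (k, l)) * (D x y k * D x y l).
Proof.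
rewrite mxE sum_mxtens (sum_delta (y := k)) => [|i /negPf ik].
  rewrite (sum_delta (y := l)) => [|j /negPf jl].
    by rewrite tensmxE !diag3E !eqxx !mulr1.
  by rewrite tensmxE [in X in _ * (_ * X)]diag3E jl !mulr0.
by apply: big1 => j _; rewrite tensmxE diag3E ik mulr0 mul0r mulr0.
Qed.

Lemma diag3_mulmx x y (A : 'M[C]_(3 * 3)) s (i j : 'I_3) :
  ((diag3 x y *t diag3 x y) *m A) (mi (i, j)) s = D x y i * D x y j * A (mi (i, j)) s.
Proof.
rewrite mxE sum_mxtens (sum_delta (y := i)) => [|k].
  rewrite (sum_delta (y := j)) => [|l].
    by rewrite tensmxE !diag3E !eqxx !mulr1.
  by rewrite eq_sym => /negPf jl; rewrite tensmxE [in X in _ * X * _]diag3E jl !mulr0 mul0r.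
by rewrite eq_sym => /negPf ik; apply: big1 => l _; rewrite tensmxE diag3E ik mulr0 !mul0r.
Qed.

Variables xi eta : C.
Hypothesis hxi : xi ^+ 2 = - (1 / 2) * (vtheta0 0 tau * vtheta3 (1 / r) tau
                         / (vtheta0 (1 / r) tau * vtheta3 0 tau)).
Hypothesis heta : eta ^+ 2 = - (vtheta2 0 tau * vtheta3 (1 / r) tau
                / (vtheta2 (1 / r) tau * vtheta3 0 tau)).

Let xi_sqr : xi ^+ 2 = - P / (2 * d).
Proof.
rewrite hxi vtheta0_s// vtheta3_s//.
move: (vtheta3_0_neq0 tau_gt0) d0 n n0 v00; move: (vtheta3 0 tau) (vtheta0 0 tau) d P.
by move=> a b D' P' a0 D0 z z0 b0; field; rewrite a0 b0 z0 D0.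
Qed.

Let eta_sqr : eta ^+ 2 = - P / Q.
Proof.
rewrite heta vtheta2_s// vtheta3_s//.
move: (vtheta3_0_neq0 tau_gt0) (vtheta2_0_neq0 tau_gt0) Q0 n n0; move: (vtheta3 0 tau) (vtheta2 0 tau) Q P.
by move=> a b Q' P' a0 b0 q0 z z0; field; rewrite a0 b0 z0 q0.
Qed.

Lemma xi_neq0 : xi != 0.
Proof.
have : xi ^+ 2 != 0.
  rewrite xi_sqr; move: P d P0 d0 => p q p0 q0.
  by rewrite mulf_neq0 ?oppr_eq0 ?invr_eq0 ?mulf_neq0 ?pnatr_eq0.
by rewrite expf_eq0.
Qed.

Lemma eta_neq0 : eta != 0.
Proof.
have : eta ^+ 2 != 0.
  rewrite eta_sqr; move: P Q P0 Q0 => p q p0 q0.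
  by rewrite mulf_neq0 ?oppr_eq0 ?invr_eq0.
by rewrite expf_eq0.
Qed.

(** The conjugation by the diagonal part, stated without inverses so that entries can be compared
    directly. *)
Lemma Rfateev_diag3 (DD := diag3 xi eta *t diag3 xi eta) :
  Rfateev K K' lam u *m DD = DD *m ((Hmx *t Hmx) *m R22 K K' lam u *m (Hmx *t Hmx)).
Proof.
apply/matrixP => s t; case: (mxtens_indexP s) => i j; case: (mxtens_indexP t) => k l.
rewrite mulmx_diag3 diag3_mulmx Rfateev_entry R22_entry -[LHS]mulrA [RHS]mulrCA; congr (_ * _).
have [S0 T0 V0] := thqs_neq0; have [NS0 sS pS _ _] := relS.
exact: (vertex_gauge S0 T0 (ratio_relation sS pS) d0 Q0 xi_sqr eta_sqr).
Qed.

Lemma diag3_inv : diag3 xi eta *m diag3 xi^-1 eta^-1 = 1%:M.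
Proof.
apply/matrixP => i j; rewrite mxE sum3 !mxE.
by case: i => [[|[|[|//]]] ?]; case: j => [[|[|[|//]]] ?];
  rewrite /= ?(mulr0, mul0r, mulr1, add0r, addr0, divff xi_neq0, divff eta_neq0).
Qed.

Lemma fateev_gauge (U := gauge xi eta) :
  Rfateev K K' lam u = (U *t U) *m R22 K K' lam u *m invmx (U *t U).
Proof.
have UE : U *t U = (diag3 xi eta *t diag3 xi eta) *m (Hmx *t Hmx).
  by rewrite tensmx_mul.
have HH : (Hmx *t Hmx) *m (Hmx *t Hmx) = 1%:M :> 'M[C]_(3 * 3).
  by rewrite tensmx_mul Hmx_sqr tens11mx.
have Uu : U *t U \in unitmx.
  suff /mulmx1_unit[] : (U *t U) *m ((Hmx *t Hmx) *m (diag3 xi^-1 eta^-1 *t diag3 xi^-1 eta^-1)) = 1%:M by [].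
  by rewrite UE mulmxA -[X in X *m _]mulmxA HH mulmx1 tensmx_mul diag3_inv tens11mx.
(* Both sides now end with [Hmx *t Hmx], an involution, so the identity reduces to the one for the
   diagonal part. *)
suff <- : Rfateev K K' lam u *m (U *t U) = (U *t U) *m R22 K K' lam u by rewrite mulmxK.
rewrite UE mulmxA Rfateev_diag3; move: (_ *t _) (_ *t _) HH (R22 _ _ _ _) => DD H HH X.
by rewrite -!mulmxA HH mulmx1.
Qed.

End Comparison.

Theorem theorem2p4 (R : realType) (K K' lam : R[i]) (xi eta : R[i]) (u : R[i]) :
  let tau := par_tau K K' in
  let r := par_r K' lam in
  let U := gauge xi eta in
  0 < complex.Im tau ->
  `|par_x K lam| < 1 ->
  elliptic_regular K K' lam 1 ->
  elliptic_regular K K' lam 2 ->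
  vtheta2 (1 / r) tau != 0 ->
  vtheta3 (1 / r) tau != 0 ->
  xi ^+ 2 = - (1 / 2) * (vtheta0 0 tau * vtheta3 (1 / r) tau
                         / (vtheta0 (1 / r) tau * vtheta3 0 tau)) ->
  eta ^+ 2 = - (vtheta2 0 tau * vtheta3 (1 / r) tau
                / (vtheta2 (1 / r) tau * vtheta3 0 tau)) ->
  R22_regular K K' lam u ->
  Rfateev_regular K K' lam u ->
  Rfateev K K' lam u = (U *t U) *m R22 K K' lam u *m invmx (U *t U).
Proof.
move=> tau r U tau_gt0 x_lt1 reg1 reg2 regv2 regv3 hxi heta regR regF.
exact: (fateev_gauge tau_gt0 x_lt1 reg1 reg2 regv2 regv3 regR regF hxi heta).
Qed.
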